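(* Let $f=h+\overline g$ be a locally quasiconformal harmonic mapping belonging to a linear and affine invariant family $\mathcal{AL}_H$ with $\mathrm{ord}\,(\mathcal{AL}_H)=\alpha<\infty$, and let $\omega(z)=g'(z)/h'(z)$, $|\omega(z)|<1$. Then $$d_f(z)\ge\frac{1-|\omega(z)|}{2\alpha}\left(\frac{1-|z|}{1+|z|}\right)^{\alpha}\quad\text{for }z\in\mathbb D .$$ The estimate of $d_f(0)$ is sharp, for example, in the universal linear and affine invariant family $\mathcal{AL}_H(\alpha)$.
   Context: $\mathbb D=\{z\in\mathbb C:|z|<1\}$; $\mathrm{Aut}(\mathbb D)$ is the set of maps $\phi(z)=e^{i\theta}\frac{z+a}{1+\overline a z}$, $|a|<1$, $\theta\in\mathbb R$. Harmonic mappings are written $f=h+\overline g$ with $h,g$ analytic in $\mathbb D$ and $f(z)=\sum_{n\ge1}(a_nz^n+a_{-n}\overline z^{\,n})$ (so $h(0)=g(0)=0$, $a_1=h'(0)$, $a_2=h''(0)/2$, $a_{-1}=f_{\overline z}(0)=\overline{g'(0)}$). Such $f$ is locally univalent and sense-preserving if and only if $|h'|^2-|g'|^2>0$ in $\mathbb D$, i.e. $h'\ne0$ and $|\omega|<1$, where $\omega=g'/h'$ is the (complex) dilatation of $f$. A family $\mathcal L$ of locally univalent sense-preserving harmonic functions of this form is a linear invariant family (LIF) if every $f=h+\overline g\in\mathcal L$ has $a_1=1$ and $\frac{f(\phi(z))-f(\phi(0))}{h'(\phi(0))\phi'(0)}\in\mathcal L$ for each $\phi\in\mathrm{Aut}(\mathbb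 D)$. A family $\mathcal{AL}_H$ is linear and affine invariant (ALIF) if it is a LIF and in addition, for each $f\in\mathcal{AL}_H$ and every $\varepsilon\in\mathbb D$, $\frac{f(z)+\varepsilon\overline{f(z)}}{1+\varepsilon\overline{f_{\overline z}(0)}}\in\mathcal{AL}_H$. Its order is $\mathrm{ord}\,\mathcal{AL}_H=\sup_{f\in\mathcal{AL}_H}|a_2|$. The universal ALIF $\mathcal{AL}_H(\alpha)$ is the largest ALIF of order $\alpha$. Radius of the largest univalent disk: a locally univalent smooth map $f$ of $\mathbb D$ is viewed as a univalent map onto a two-dimensional manifold $f(\mathbb D)$ spread over $\mathbb C$. For $z\in\mathbb D$, $d_f(z)$ is the radius of the largest univalent disk on the manifold $f(\mathbb D)$ centered at $f(z)$; a univalent disk centered at $f(z)$ means that $f$ maps an open subset of $\mathbb D$ containing $z$ univalently onto this disk. *)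

(* Defs.v *)
From Stdlib Require Import Reals.
From Coquelicot Require Import Coquelicot.
Open Scope R_scope.

(** Mappings of the unit disk are represented by total functions [C -> C];
    every notion below only looks at their values on [unit_disk]. *)

Definition unit_disk (z : C) : Prop := Cmod z < 1.

(** [h z = sum_n a_n z^n] throughout the disk. *)
Definition analytic_on_disk (h : C -> C) : Prop :=
  exists a : nat -> C, forall z : C, unit_disk z ->
    is_pseries (K := C_AbsRing) (V := C_NormedModule) a z (h z).

(** [f = h + conj g] with [h], [g] analytic and [h 0 = g 0 = 0]; the values of
    [h] and [g] on the disk are determined by those of [f]. *)
Definition harmonic_parts (f h g : C -> C) : Prop :=
  analytic_on_disk h /\ analytic_on_disk g /\
  h (RtoC 0) = RtoC 0 /\ g (RtoC 0) = RtoC 0 /\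
  forall z : C, unit_disk z -> f z = (h z + Cconj (g z))%C.

Definition coef_a2 (h : C -> C) : C :=
  (C_derive (C_derive h) (RtoC 0) / RtoC 2)%C.

(** [f_zbar = conj g'] when [f = h + conj g]. *)
Definition dzbar (g : C -> C) (z : C) : C := Cconj (C_derive g z).

Definition dilatation (h g : C -> C) (z : C) : C :=
  (C_derive g z / C_derive h z)%C.

Definition locally_univalent (f : C -> C) : Prop :=
  forall z : C, unit_disk z ->
    exists delta : R, 0 < delta /\
      forall u v : C, unit_disk u -> unit_disk v ->
        Cmod (u - z)%C < delta -> Cmod (v - z)%C < delta ->
        f u = f v -> u = v.

(** The Jacobian of [h + conj g] is [|h'|^2 - |g'|^2]. *)
Definition sense_preserving (h g : C -> C) : Prop :=
  forall z : C, unit_disk z ->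
    0 < Cmod (C_derive h z) ^ 2 - Cmod (C_derive g z) ^ 2.

(** Every point has a neighbourhood on which [f] is injective with dilatation
    bounded by a constant [k < 1]. *)
Definition locally_quasiconformal (f h g : C -> C) : Prop :=
  forall z : C, unit_disk z ->
    exists delta k : R, 0 < delta /\ k < 1 /\
      (forall u v : C, unit_disk u -> unit_disk v ->
         Cmod (u - z)%C < delta -> Cmod (v - z)%C < delta ->
         f u = f v -> u = v) /\
      (forall u : C, unit_disk u -> Cmod (u - z)%C < delta ->
         C_derive h u <> RtoC 0 /\ Cmod (dilatation h g u) <= k).

Definition disk_aut (theta : R) (a z : C) : C :=
  ((cos theta, sin theta) * ((z + a) / (RtoC 1 + Cconj a * z)))%C.

Definition koebe_transform (phi f h : C -> C) (z : C) : C :=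
  ((f (phi z) - f (phi (RtoC 0))) /
   (C_derive h (phi (RtoC 0)) * C_derive phi (RtoC 0)))%C.

Definition affine_transform (eps : C) (f g : C -> C) (z : C) : C :=
  ((f z + eps * Cconj (f z)) / (RtoC 1 + eps * Cconj (dzbar g (RtoC 0))))%C.

Definition LIF (L : (C -> C) -> Prop) : Prop :=
  forall f : C -> C, L f ->
    exists h g : C -> C,
      harmonic_parts f h g /\
      locally_univalent f /\ sense_preserving h g /\
      C_derive h (RtoC 0) = RtoC 1 /\
      forall (theta : R) (a : C), Cmod a < 1 ->
        L (koebe_transform (disk_aut theta a) f h).

Definition ALIF (L : (C -> C) -> Prop) : Prop :=
  LIF L /\
  forall f h g : C -> C, L f -> harmonic_parts f h g ->
    forall eps : C, unit_disk eps -> L (affine_transform eps f g).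

Definition family_order (L : (C -> C) -> Prop) : Rbar :=
  Lub_Rbar (fun x : R => exists f h g : C -> C,
    L f /\ harmonic_parts f h g /\ x = Cmod (coef_a2 h)).

Definition universal_ALIF (alpha : R) (U : (C -> C) -> Prop) : Prop :=
  ALIF U /\ family_order U = Finite alpha /\
  forall L : (C -> C) -> Prop,
    ALIF L -> family_order L = Finite alpha -> forall f : C -> C, L f -> U f.

(** [f] maps an open subset of the disk containing [z] univalently onto the
    disk of radius [rho] centered at [f z]. *)
Definition univalent_disk (f : C -> C) (z : C) (rho : R) : Prop :=
  0 < rho /\
  exists U : C -> Prop,
    open (T := C_UniformSpace) U /\ (forall u : C, U u -> unit_disk u) /\ U z /\
    (forall u v : C, U u -> U v -> f u = f v -> u = v) /\
    (forall w : C, Cmod (w - f z)%C < rho <-> exists u : C, U u /\ f u = w).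

Definition univalent_radius (f : C -> C) (z : C) : Rbar :=
  Lub_Rbar (univalent_disk f z).

(* Main.v *)
(* Normalising by a Koebe transform, the order bounds the pre-Schwarzian,
   |(1 - |z|^2) h''/(2 h') - conj z| <= alpha, and integrating along radii gives
   |h'(z)| >= (1 - |z|)^(alpha-1) / (1 + |z|)^(alpha+1).  Applying this to
   f + eps conj f and optimising over eps bounds the smallest stretching |h'| - |g'|
   below by (1 - |g'(0)|) times the same function, whose integral over [0, 1] is
   1 / (2 alpha).  Hence radial segments of length less than
   (1 - |g'(0)|) / (2 alpha) lift without leaving the disk, and the lifts invert f
   on a disk about f(0); a Koebe transform moves the centre to an arbitrary z.
   The order is at least 1 since otherwise Re (z h''/h') would be positive on a
   circle although its mean there is its value 0 at the origin.

   For sharpness, the universal family is the union of all families of order alpha,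
   and it contains k - r conj k, where k(z) = (((1 + z)/(1 - z))^alpha - 1) / (2 alpha).
   This map sends (-1, 0] onto (-(1 - r)/(2 alpha), 0], so a larger univalent disk
   would contain the limit at -1. *)

Require Import Defs.
From Stdlib Require Import Reals Lra Lia Classical ClassicalEpsilon.
From Coquelicot Require Import Coquelicot.
Open Scope R_scope.

(** * Complex differentiation *)

(** Two obstacles shape the argument. First, a family only promises that some pair [h], [g] exists
    for each member, and functions are constrained on the disk alone, so every computation with a
    transform rests on uniqueness of the decomposition: a function that is both holomorphic and
    antiholomorphic is constant. Second, disks are lifted without covering spaces or continuous
    paths. All segments from 0 are cut into the same number of equal pieces, and the division points
    are lifted one after another by Newton iteration with constants uniform on a closed disk. The
    radial primitive of the stretching bound serves as a gauge: it grows by at most the image length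
    covered plus a second-order error, and the number of pieces is chosen so that these errors fit
    into the available slack. A local Lipschitz bound carried through the induction keeps
    neighbouring lifts on the same branch. Branches of logarithms and powers are avoided as well:
    growth is read from ln |h'|^2 along radii, and the extremal functions are handled through the
    linear differential equation satisfied by h'. *)

Lemma Cmod_minus_sym (x y : C) : Cmod (x - y) = Cmod (y - x).
Proof. rewrite <- Cmod_opp. f_equal. ring. Qed.

Lemma Cmod_triangle_inv (x y : C) : Cmod x - Cmod y <= Cmod (x - y).
Proof.
  assert (H := Cmod_triangle (x - y) y).
  replace (x - y + y)%C with x in H by ring. lra.
Qed.

Lemma Cmod_triangle_minus (x y : C) : Cmod (x - y) <= Cmod x + Cmod y.
Proof. unfold Cminus. rewrite <- (Cmod_opp y). apply Cmod_triangle. Qed.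

Lemma Cmod_dist_triangle (x y z : C) : Cmod (x - z) <= Cmod (x - y) + Cmod (y - z).
Proof. replace (x - z)%C with ((x - y) + (y - z))%C by ring. apply Cmod_triangle. Qed.

Lemma im_le_Cmod (c : C) : Rabs (Im c) <= Cmod c.
Proof. eapply Rle_trans; [apply Rmax_r | apply Rmax_Cmod]. Qed.

Lemma Cmod_le_ReIm (c : C) : Cmod c <= Rabs (Re c) + Rabs (Im c).
Proof.
  replace c with (RtoC (Re c) + Ci * RtoC (Im c))%C at 1
    by (destruct c; unfold Ci, RtoC, Cplus, Cmult, Re, Im; simpl; f_equal; ring).
  eapply Rle_trans; [apply Cmod_triangle|].
  rewrite Cmod_mult, Cmod_Ci, !Cmod_R. lra.
Qed.

Lemma Cmod_diff_0 (x y : C) : Cmod (x - y) = 0 -> x = y.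
Proof.
  intros H. apply Cmod_eq_0 in H.
  replace x with (x - y + y)%C by ring. rewrite H. ring.
Qed.

Definition Ccont (f : C -> C) (z : C) : Prop :=
  forall eps, 0 < eps -> exists delta, 0 < delta /\
    forall u, Cmod (u - z) < delta -> Cmod (f u - f z) < eps.

(* Caratheodory's form of complex differentiability, which makes the product and
   chain rules algebraic. *)
Definition Cder (f : C -> C) (z l : C) : Prop :=
  exists q : C -> C, q z = l /\ Ccont q z /\
    exists delta, 0 < delta /\
      forall u, Cmod (u - z) < delta -> (f u - f z = q u * (u - z))%C.

Lemma Ccont_const (c z : C) : Ccont (fun _ => c) z.
Proof.
  intros e He. exists 1. split; [lra|]. intros u _.
  replace (c - c)%C with (RtoC 0) by ring. rewrite Cmod_0. exact He.
Qed.

Lemma Ccont_id (z : C) : Ccont (fun u => u) z.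
Proof. intros e He. exists e. auto. Qed.

Lemma Ccont_ext_loc (f g : C -> C) (z : C) (delta : R) :
  0 < delta -> (forall u, Cmod (u - z) < delta -> f u = g u) ->
  Ccont f z -> Ccont g z.
Proof.
  intros Hd H Hf e He. destruct (Hf e He) as [d [Hd' Hf']].
  exists (Rmin d delta). split; [apply Rmin_glb_lt; auto|].
  intros u Hu. rewrite <- !H.
  - apply Hf'. eapply Rlt_le_trans; [exact Hu|apply Rmin_l].
  - replace (z - z)%C with (RtoC 0) by ring. now rewrite Cmod_0.
  - eapply Rlt_le_trans; [exact Hu|apply Rmin_r].
Qed.

Lemma Ccont_plus (f g : C -> C) (z : C) :
  Ccont f z -> Ccont g z -> Ccont (fun u => f u + g u)%C z.
Proof.
  intros Hf Hg e He.
  destruct (Hf (e/2)) as [d1 [H1 K1]]; [lra|].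
  destruct (Hg (e/2)) as [d2 [H2 K2]]; [lra|].
  exists (Rmin d1 d2). split; [apply Rmin_glb_lt; auto|].
  intros u Hu.
  replace (f u + g u - (f z + g z))%C with ((f u - f z) + (g u - g z))%C by ring.
  eapply Rle_lt_trans; [apply Cmod_triangle|].
  specialize (K1 u ltac:(eapply Rlt_le_trans; [exact Hu|apply Rmin_l])).
  specialize (K2 u ltac:(eapply Rlt_le_trans; [exact Hu|apply Rmin_r])). lra.
Qed.

Lemma Ccont_mult (f g : C -> C) (z : C) :
  Ccont f z -> Ccont g z -> Ccont (fun u => f u * g u)%C z.
Proof.
  intros Hf Hg e He.
  set (B := 1 + Cmod (f z) + Cmod (g z)).
  assert (HfB := Cmod_ge_0 (f z)). assert (HgB := Cmod_ge_0 (g z)).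
  assert (HB : 1 <= B) by (unfold B; lra).
  set (e' := Rmin 1 (e / (2 * B))).
  assert (He' : 0 < e').
  { apply Rmin_glb_lt; [lra|]. apply Rdiv_lt_0_compat; lra. }
  destruct (Hf e' He') as [d1 [H1 K1]].
  destruct (Hg e' He') as [d2 [H2 K2]].
  exists (Rmin d1 d2). split; [apply Rmin_glb_lt; auto|].
  intros u Hu.
  specialize (K1 u ltac:(eapply Rlt_le_trans; [exact Hu|apply Rmin_l])).
  specialize (K2 u ltac:(eapply Rlt_le_trans; [exact Hu|apply Rmin_r])).
  replace (f u * g u - f z * g z)%C
    with ((f u - f z) * (g u - g z) + ((f u - f z) * g z + f z * (g u - g z)))%C by ring.
  eapply Rle_lt_trans; [apply Cmod_triangle|].
  assert (T := Cmod_triangle ((f u - f z) * g z)%C (f z * (g u - g z))%C).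
  rewrite !Cmod_mult in *.
  assert (E1 : e' <= 1) by apply Rmin_l.
  assert (E2 : e' * (2 * B) <= e).
  { apply Rle_trans with (e / (2 * B) * (2 * B)).
    - apply Rmult_le_compat_r; [lra|apply Rmin_r].
    - right. field. lra. }
  assert (P1 := Cmod_ge_0 (f u - f z)%C). assert (P2 := Cmod_ge_0 (g u - g z)%C).
  unfold B in *. nra.
Qed.

Lemma Ccont_opp (f : C -> C) (z : C) : Ccont f z -> Ccont (fun u => - f u)%C z.
Proof.
  intros H e He. destruct (H e He) as [d [Hd K]]. exists d. split; auto.
  intros u Hu. replace (- f u - - f z)%C with (- (f u - f z))%C by ring.
  rewrite Cmod_opp. auto.
Qed.

Lemma Ccont_inv (f : C -> C) (z : C) :
  f z <> RtoC 0 -> Ccont f z -> Ccont (fun u => / f u)%C z.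
Proof.
  intros Hz H e He.
  assert (P := proj1 (Cmod_gt_0 _) Hz).
  set (m := Cmod (f z)) in *.
  set (e' := Rmin (m / 2) (e * (m * m / 2))).
  assert (He' : 0 < e').
  { apply Rmin_glb_lt; [lra|]. apply Rmult_lt_0_compat; nra. }
  destruct (H e' He') as [d [Hd K]]. exists d. split; auto.
  intros u Hu. specialize (K u Hu).
  assert (E1 : e' <= m / 2) by apply Rmin_l.
  assert (E2 : e' <= e * (m * m / 2)) by apply Rmin_r.
  assert (Q : m / 2 < Cmod (f u)).
  { assert (T := Cmod_triangle_inv (f z) (f u)). rewrite Cmod_minus_sym in T. fold m in T. lra. }
  assert (Hu0 : f u <> RtoC 0) by (apply Cmod_gt_0; lra).
  replace (/ f u - / f z)%C with ((f z - f u) / (f u * f z))%C by (field; auto).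
  rewrite Cmod_div by (apply Cmult_neq_0; auto).
  rewrite Cmod_mult, Cmod_minus_sym. fold m.
  apply Rmult_lt_reg_r with (Cmod (f u) * m); [nra|].
  unfold Rdiv. rewrite Rmult_assoc, Rinv_l by nra.
  rewrite Rmult_1_r. apply Rlt_le_trans with e'; [exact K|].
  eapply Rle_trans; [exact E2|]. apply Rmult_le_compat_l; nra.
Qed.

Lemma Ccont_comp (f g : C -> C) (z : C) :
  Ccont f (g z) -> Ccont g z -> Ccont (fun u => f (g u)) z.
Proof.
  intros Hf Hg e He. destruct (Hf e He) as [d [Hd K]].
  destruct (Hg d Hd) as [d' [Hd' K']]. exists d'. auto.
Qed.

Lemma Ccont_conj (f : C -> C) (z : C) : Ccont f z -> Ccont (fun u => Cconj (f u)) z.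
Proof.
  intros Hf e He. destruct (Hf e He) as [d [Hd K]]. exists d. split; auto.
  intros u Hu. rewrite <- Cminus_conj, Cmod_conj. auto.
Qed.

Lemma Cder_cont (f : C -> C) (z l : C) : Cder f z l -> Ccont f z.
Proof.
  intros (q & Hq & Cq & d & Hd & K).
  apply Ccont_ext_loc with (fun u => f z + q u * (u - z))%C d; auto.
  - intros u Hu. rewrite <- K by auto. ring.
  - apply Ccont_plus; [apply Ccont_const|]. apply Ccont_mult; auto.
    apply (Ccont_plus (fun u => u) (fun _ => - z)%C); [apply Ccont_id|apply Ccont_const].
Qed.

Lemma Cder_ext_loc (f g : C -> C) (z l : C) (delta : R) :
  0 < delta -> (forall u, Cmod (u - z) < delta -> f u = g u) ->
  Cder f z l -> Cder g z l.
Proof.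
  intros Hd H (q & Hq & Cq & d & Hd' & K).
  exists q. repeat split; auto. exists (Rmin d delta).
  split; [apply Rmin_glb_lt; auto|]. intros u Hu. rewrite <- !H.
  - apply K. eapply Rlt_le_trans; [exact Hu|apply Rmin_l].
  - replace (z - z)%C with (RtoC 0) by ring. now rewrite Cmod_0.
  - eapply Rlt_le_trans; [exact Hu|apply Rmin_r].
Qed.

Lemma Cder_eq (f : C -> C) (z l l' : C) : l = l' -> Cder f z l -> Cder f z l'.
Proof. now intros ->. Qed.

Lemma Cder_const (c z : C) : Cder (fun _ => c) z (RtoC 0).
Proof.
  exists (fun _ => RtoC 0). split; [auto|]. split; [apply Ccont_const|].
  exists 1. split; [lra|]. intros. ring.
Qed.

Lemma Cder_id (z : C) : Cder (fun u => u) z (RtoC 1).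
Proof.
  exists (fun _ => RtoC 1). split; [auto|]. split; [apply Ccont_const|].
  exists 1. split; [lra|]. intros. ring.
Qed.

Lemma Cder_plus (f g : C -> C) (z l m : C) :
  Cder f z l -> Cder g z m -> Cder (fun u => f u + g u)%C z (l + m)%C.
Proof.
  intros (q & Hq & Cq & d & Hd & K) (q' & Hq' & Cq' & d' & Hd' & K').
  exists (fun u => q u + q' u)%C. split; [now subst|].
  split; [now apply Ccont_plus|].
  exists (Rmin d d'). split; [apply Rmin_glb_lt; auto|]. intros u Hu.
  specialize (K u ltac:(eapply Rlt_le_trans; [exact Hu|apply Rmin_l])).
  specialize (K' u ltac:(eapply Rlt_le_trans; [exact Hu|apply Rmin_r])).
  replace (f u + g u - (f z + g z))%C with ((f u - f z) + (g u - g z))%C by ring.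
  rewrite K, K'. ring.
Qed.

Lemma Cder_mult (f g : C -> C) (z l m : C) :
  Cder f z l -> Cder g z m -> Cder (fun u => f u * g u)%C z (l * g z + f z * m)%C.
Proof.
  intros Hf Hg. assert (Cg := Cder_cont _ _ _ Hg).
  destruct Hf as (q & Hq & Cq & d & Hd & K). destruct Hg as (q' & Hq' & Cq' & d' & Hd' & K').
  exists (fun u => q u * g u + f z * q' u)%C. split; [now subst|].
  split. { apply Ccont_plus; apply Ccont_mult; auto. apply Ccont_const. }
  exists (Rmin d d'). split; [apply Rmin_glb_lt; auto|]. intros u Hu.
  specialize (K u ltac:(eapply Rlt_le_trans; [exact Hu|apply Rmin_l])).
  specialize (K' u ltac:(eapply Rlt_le_trans; [exact Hu|apply Rmin_r])).
  replace (f u * g u - f z * g z)%C with ((f u - f z) * g u + f z * (g u - g z))%C by ring.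
  rewrite K, K'. ring.
Qed.

Lemma Cder_scal (c : C) (f : C -> C) (z l : C) :
  Cder f z l -> Cder (fun u => c * f u)%C z (c * l)%C.
Proof.
  intros H. eapply Cder_eq; [|apply Cder_mult; [apply Cder_const|exact H]]. simpl. ring.
Qed.

Lemma Cder_opp (f : C -> C) (z l : C) : Cder f z l -> Cder (fun u => - f u)%C z (- l)%C.
Proof.
  intros H. apply Cder_ext_loc with (fun u => (- RtoC 1) * f u)%C 1; [lra|intros; ring|].
  eapply Cder_eq; [|apply Cder_scal, H]. ring.
Qed.

Lemma Cder_minus (f g : C -> C) (z l m : C) :
  Cder f z l -> Cder g z m -> Cder (fun u => f u - g u)%C z (l - m)%C.
Proof. intros Hf Hg. apply Cder_plus; [exact Hf|]. now apply Cder_opp. Qed.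

Lemma Cder_inv (f : C -> C) (z l : C) :
  f z <> RtoC 0 -> Cder f z l -> Cder (fun u => / f u)%C z (- l / (f z * f z))%C.
Proof.
  intros Hz Hf. assert (Cf := Cder_cont _ _ _ Hf).
  destruct Hf as (q & Hq & Cq & d & Hd & K).
  exists (fun u => - (q u * (/ f u * / f z)))%C.
  split. { subst. field. auto. }
  split. { apply Ccont_opp, Ccont_mult; auto. apply Ccont_mult; [now apply Ccont_inv|apply Ccont_const]. }
  destruct (Cf (Cmod (f z)) (proj1 (Cmod_gt_0 _) Hz)) as [d' [Hd' K']].
  exists (Rmin d d'). split; [apply Rmin_glb_lt; auto|]. intros u Hu.
  specialize (K u ltac:(eapply Rlt_le_trans; [exact Hu|apply Rmin_l])).
  specialize (K' u ltac:(eapply Rlt_le_trans; [exact Hu|apply Rmin_r])).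
  assert (f u <> RtoC 0).
  { intros E. rewrite E in K'. replace (RtoC 0 - f z)%C with (- f z)%C in K' by ring.
    rewrite Cmod_opp in K'. lra. }
  transitivity (- (f u - f z) * (/ f u * / f z))%C; [field; auto|]. rewrite K. ring.
Qed.

Lemma Cder_div (f g : C -> C) (z l m : C) :
  g z <> RtoC 0 -> Cder f z l -> Cder g z m ->
  Cder (fun u => f u / g u)%C z ((l * g z - f z * m) / (g z * g z))%C.
Proof.
  intros Hz Hf Hg. eapply Cder_eq; [|apply Cder_mult; [exact Hf|apply Cder_inv; eauto]].
  simpl. field. auto.
Qed.

Lemma Cder_comp (f g : C -> C) (z l m : C) :
  Cder f (g z) l -> Cder g z m -> Cder (fun u => f (g u)) z (l * m)%C.
Proof.
  intros Hf Hg. assert (Cg := Cder_cont _ _ _ Hg).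
  destruct Hf as (q & Hq & Cq & d & Hd & K). destruct Hg as (q' & Hq' & Cq' & d' & Hd' & K').
  exists (fun u => q (g u) * q' u)%C. split; [now subst|].
  split. { apply Ccont_mult; auto. apply (Ccont_comp q g); auto. }
  destruct (Cg d Hd) as [d2 [Hd2 K2]].
  exists (Rmin d2 d'). split; [apply Rmin_glb_lt; auto|]. intros u Hu.
  specialize (K2 u ltac:(eapply Rlt_le_trans; [exact Hu|apply Rmin_l])).
  specialize (K' u ltac:(eapply Rlt_le_trans; [exact Hu|apply Rmin_r])).
  rewrite K by auto. rewrite K'. ring.
Qed.

(** The slope function is the difference quotient, patched with [l] at [z]. *)
Lemma Cder_of_estimate (f : C -> C) (z l : C) :
  (forall eps, 0 < eps -> exists delta, 0 < delta /\ forall u, Cmod (u - z) < delta ->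
     Cmod (f u - f z - l * (u - z)) <= eps * Cmod (u - z)) ->
  Cder f z l.
Proof.
  intros H.
  set (q := fun u => if excluded_middle_informative (u = z) then l
                     else ((f u - f z) / (u - z))%C).
  exists q. assert (Hq : q z = l).
  { unfold q. destruct excluded_middle_informative; tauto. }
  split; [exact Hq|]. split.
  - intros e He. destruct (H (e/2)) as [d [Hd K]]; [lra|].
    exists d. split; auto. intros u Hu. rewrite Hq. unfold q.
    destruct excluded_middle_informative as [E|E].
    + replace (l - l)%C with (RtoC 0) by ring. now rewrite Cmod_0.
    + assert (Hz : (u - z)%C <> RtoC 0).
      { intros E'. apply E. apply Cmod_diff_0. rewrite E'. apply Cmod_0. }
      assert (P := proj1 (Cmod_gt_0 _) Hz).
      replace ((f u - f z) / (u - z) - l)%C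
        with ((f u - f z - l * (u - z)) / (u - z))%C by (field; auto).
      rewrite Cmod_div by auto.
      apply Rmult_lt_reg_r with (Cmod (u - z)); auto.
      unfold Rdiv. rewrite Rmult_assoc, Rinv_l by lra. specialize (K u Hu). nra.
  - exists 1. split; [lra|]. intros u _. unfold q.
    destruct excluded_middle_informative as [->|E]; [ring|].
    field. intros E'. apply E. apply Cmod_diff_0. rewrite E'. apply Cmod_0.
Qed.

Lemma Cder_estimate (f : C -> C) (z l : C) :
  Cder f z l ->
  forall eps, 0 < eps -> exists delta, 0 < delta /\ forall u, Cmod (u - z) < delta ->
     Cmod (f u - f z - l * (u - z)) <= eps * Cmod (u - z).
Proof.
  intros (q & Hq & Cq & d & Hd & K) e He.
  destruct (Cq e He) as [d' [Hd' K']].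
  exists (Rmin d d'). split; [apply Rmin_glb_lt; auto|]. intros u Hu.
  rewrite K by (eapply Rlt_le_trans; [exact Hu|apply Rmin_l]).
  specialize (K' u ltac:(eapply Rlt_le_trans; [exact Hu|apply Rmin_r])).
  replace (q u * (u - z) - l * (u - z))%C with ((q u - l) * (u - z))%C by ring.
  rewrite Cmod_mult. apply Rmult_le_compat_r; [apply Cmod_ge_0|]. subst l. lra.
Qed.

(** * Bridges to filters, to [C_derive] and to real calculus *)

Lemma locally_Cmod (z : C) (delta : R) :
  0 < delta -> locally (T := C_UniformSpace) z (fun u => Cmod (u - z) < delta).
Proof.
  intros Hd.
  (* The uniform structure of [C] has square balls; a square of half-side [delta / sqrt 2] fits into
     the round disk of radius [delta]. *)
  assert (P : 0 < delta / sqrt 2).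
  { apply Rdiv_lt_0_compat; auto. apply sqrt_lt_R0. lra. }
  exists (mkposreal _ P). intros u Hu.
  assert (H := C_NormedModule_mixin_compat2 z u (mkposreal _ P) Hu).
  simpl in H. unfold minus, plus, opp in H; simpl in H.
  replace (sqrt 2 * (delta / sqrt 2)) with delta in H; [exact H|].
  field. apply Rgt_not_eq, sqrt_lt_R0. lra.
Qed.

Lemma locally_Cmod_iff (z : C) (P : C -> Prop) :
  locally (T := C_UniformSpace) z P <->
  exists delta, 0 < delta /\ forall u, Cmod (u - z) < delta -> P u.
Proof.
  split.
  - intros [e He]. exists e. split; [apply cond_pos|]. intros u Hu.
    apply He. apply C_NormedModule_mixin_compat1. exact Hu.
  - intros [d [Hd H]]. generalize (locally_Cmod z d Hd). apply filter_imp. exact H.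
Qed.

Lemma Cder_is_derive (f : C -> C) (z l : C) :
  Cder f z l -> is_derive (K := C_AbsRing) (V := C_NormedModule) f z l.
Proof.
  intros H. split.
  - apply is_linear_scal_l.
  - intros x Hx.
    assert (E : z = x) by exact (@is_filter_lim_locally_unique C_AbsRing (AbsRing_NormedModule C_AbsRing) z x Hx). subst x.
    intros e. destruct (Cder_estimate _ _ _ H e (cond_pos e)) as [d [Hd K]].
    exists (mkposreal d Hd). intros u Hu.
    assert (Hu' : Cmod (u - z) < d) by exact Hu.
    specialize (K u Hu').
    eapply Rle_trans; [right|exact K].
    change (Cmod ((f u - f z) - (u - z) * l) = Cmod (f u - f z - l * (u - z))).
    f_equal. ring.
Qed.

Lemma Cder_C_derive (f : C -> C) (z l : C) : Cder f z l -> C_derive f z = l.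
Proof. intros H. apply is_C_derive_unique, Cder_is_derive, H. Qed.

Lemma unit_disk_0 : unit_disk (RtoC 0).
Proof. unfold unit_disk. rewrite Cmod_0. lra. Qed.

Lemma unit_disk_nbhd (z : C) :
  unit_disk z -> 0 < 1 - Cmod z /\ forall u, Cmod (u - z) < 1 - Cmod z -> unit_disk u.
Proof.
  unfold unit_disk. intros H. split; [lra|]. intros u Hu.
  assert (T := Cmod_triangle_inv u z). lra.
Qed.

Lemma Cder_ext_disk (f g : C -> C) (z l : C) :
  unit_disk z -> (forall u, unit_disk u -> f u = g u) -> Cder f z l -> Cder g z l.
Proof.
  intros Hz H. destruct (unit_disk_nbhd z Hz) as [P Q].
  apply Cder_ext_loc with (1 - Cmod z); auto.
Qed.

Lemma Re_affine (a b c : C) (r : R) : Re (a - b - RtoC r * c) = Re a - Re b - r * Re c.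
Proof. destruct a, b, c. unfold Re, Cminus, Cplus, Copp, Cmult, RtoC; simpl. ring. Qed.

Lemma Im_affine (a b c : C) (r : R) : Im (a - b - RtoC r * c) = Im a - Im b - r * Im c.
Proof. destruct a, b, c. unfold Im, Cminus, Cplus, Copp, Cmult, RtoC; simpl. ring. Qed.

Lemma is_derive_estimate (f : R -> R) (t l : R) :
  is_derive f t l <->
  forall eps, 0 < eps -> exists delta, 0 < delta /\ forall s, Rabs (s - t) < delta ->
    Rabs (f s - f t - (s - t) * l) <= eps * Rabs (s - t).
Proof.
  split.
  - intros [_ H] e He.
    destruct (H t (fun P HP => HP) (mkposreal e He)) as [d Hd].
    exists d. split; [apply cond_pos|]. intros s Hs. exact (Hd s Hs).
  - intros K. split; [apply is_linear_scal_l|].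
    intros x Hx. assert (E : t = x) by exact (@is_filter_lim_locally_unique R_AbsRing (AbsRing_NormedModule R_AbsRing) t x Hx). subst x.
    intros eps. destruct (K eps (cond_pos eps)) as [d [Hd K']].
    exists (mkposreal d Hd). intros s Hs. exact (K' s Hs).
Qed.

(** Complex derivatives meet real calculus through this chain rule: read in real and imaginary
    parts, it opens the way to the mean value theorem and to Riemann integrals. *)
Lemma Cder_curve (F : C -> C) (c : R -> C) (c' l : C) (t : R) :
  is_derive (fun s => Re (c s)) t (Re c') -> is_derive (fun s => Im (c s)) t (Im c') ->
  Cder F (c t) l ->
  is_derive (fun s => Re (F (c s))) t (Re (l * c')%C) /\
  is_derive (fun s => Im (F (c s))) t (Im (l * c')%C).
Proof.
  rewrite !is_derive_estimate. intros H1 H2 HF.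
  assert (Hc : forall eps, 0 < eps -> exists delta, 0 < delta /\ forall s, Rabs (s - t) < delta ->
     Cmod (c s - c t - RtoC (s - t) * c') <= eps * Rabs (s - t)).
  { intros e He. destruct (H1 (e/2)) as [d1 [P1 K1]]; [lra|].
    destruct (H2 (e/2)) as [d2 [P2 K2]]; [lra|].
    exists (Rmin d1 d2). split; [now apply Rmin_glb_lt|]. intros s Hs.
    specialize (K1 s ltac:(eapply Rlt_le_trans; [exact Hs|apply Rmin_l])).
    specialize (K2 s ltac:(eapply Rlt_le_trans; [exact Hs|apply Rmin_r])).
    eapply Rle_trans; [apply Cmod_le_ReIm|]. rewrite Re_affine, Im_affine. lra. }
  assert (K : forall eps, 0 < eps -> exists delta, 0 < delta /\ forall s, Rabs (s - t) < delta ->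
     Cmod (F (c s) - F (c t) - RtoC (s - t) * (l * c')) <= eps * Rabs (s - t)).
  { intros e He.
    set (B := 1 + Cmod c'). set (Q := 1 + Cmod l).
    assert (PB : 1 <= B) by (unfold B; assert (T := Cmod_ge_0 c'); lra).
    assert (PQ : 1 <= Q) by (unfold Q; assert (T := Cmod_ge_0 l); lra).
    destruct (Cder_estimate _ _ _ HF (e / (2 * B))) as [d [Hd KF]]; [apply Rdiv_lt_0_compat; lra|].
    destruct (Hc 1 ltac:(lra)) as [d1 [Hd1 K1]].
    destruct (Hc (e / (2 * Q))) as [d2 [Hd2 K2]]; [apply Rdiv_lt_0_compat; lra|].
    exists (Rmin (d / B) (Rmin d1 d2)). split.
    { apply Rmin_glb_lt; [apply Rdiv_lt_0_compat; lra|now apply Rmin_glb_lt]. }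
    intros s Hs.
    assert (S1 : Rabs (s - t) < d / B) by (eapply Rlt_le_trans; [exact Hs|apply Rmin_l]).
    assert (S2 : Rabs (s - t) < d1)
      by (eapply Rlt_le_trans; [exact Hs|eapply Rle_trans; [apply Rmin_r|apply Rmin_l]]).
    assert (S3 : Rabs (s - t) < d2)
      by (eapply Rlt_le_trans; [exact Hs|eapply Rle_trans; [apply Rmin_r|apply Rmin_r]]).
    specialize (K1 s S2). specialize (K2 s S3).
    assert (Ps := Rabs_pos (s - t)).
    assert (L : Cmod (c s - c t) <= B * Rabs (s - t)).
    { replace (c s - c t)%C with ((c s - c t - RtoC (s - t) * c') + RtoC (s - t) * c')%C by ring.
      eapply Rle_trans; [apply Cmod_triangle|]. rewrite Cmod_mult, Cmod_R. unfold B. lra. }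
    assert (L2 : Cmod (c s - c t) < d).
    { eapply Rle_lt_trans; [exact L|]. apply Rmult_lt_reg_r with (/ B); [apply Rinv_0_lt_compat; lra|].
      replace (B * Rabs (s - t) * / B) with (Rabs (s - t)) by (field; lra). exact S1. }
    specialize (KF _ L2).
    replace (F (c s) - F (c t) - RtoC (s - t) * (l * c'))%C with
      ((F (c s) - F (c t) - l * (c s - c t)) + l * (c s - c t - RtoC (s - t) * c'))%C by ring.
    eapply Rle_trans; [apply Cmod_triangle|]. rewrite Cmod_mult.
    assert (T1 : e / (2 * B) * Cmod (c s - c t) <= e / 2 * Rabs (s - t)).
    { apply Rle_trans with (e / (2 * B) * (B * Rabs (s - t))).
      - apply Rmult_le_compat_l; auto. left. apply Rdiv_lt_0_compat; lra.
      - right. field. lra. }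
    assert (T2 : Cmod l * Cmod (c s - c t - RtoC (s - t) * c') <= e / 2 * Rabs (s - t)).
    { apply Rle_trans with (Q * (e / (2 * Q) * Rabs (s - t))).
      - apply Rmult_le_compat; auto using Cmod_ge_0. unfold Q. lra.
      - right. field. lra. }
    lra. }
  split; intros e He; destruct (K e He) as [d [Hd Kd]]; exists d; split; auto; intros s Hs;
    (eapply Rle_trans; [|exact (Kd s Hs)]).
  - rewrite <- Re_affine. apply re_le_Cmod.
  - rewrite <- Im_affine. apply im_le_Cmod.
Qed.

Lemma Cder_line (F : C -> C) (z0 e l : C) (t : R) :
  Cder F (z0 + RtoC t * e)%C l ->
  is_derive (fun s : R => Re (F (z0 + RtoC s * e)%C)) t (Re (l * e)%C) /\
  is_derive (fun s : R => Im (F (z0 + RtoC s * e)%C)) t (Im (l * e)%C).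
Proof.
  apply (Cder_curve F (fun s => z0 + RtoC s * e)%C e l t);
    destruct z0, e; unfold Re, Im, Cplus, Cmult, RtoC; simpl; auto_derive; auto; ring.
Qed.

Lemma C_eq_ReIm (z w : C) : Re z = Re w -> Im z = Im w -> z = w.
Proof. destruct z, w; unfold Re, Im; simpl. now intros -> ->. Qed.

Lemma const_of_derive_0 (f : R -> R) (a b : R) :
  a <= b -> (forall t, a <= t <= b -> is_derive f t 0) -> f a = f b.
Proof.
  intros Hab H. destruct (MVT_gen f a b (fun _ => 0)) as [c [_ Hc]].
  - intros x Hx. rewrite Rmin_left, Rmax_right in Hx by lra. apply H. lra.
  - intros x Hx. rewrite Rmin_left, Rmax_right in Hx by lra.
    apply continuity_pt_filterlim.
    apply (ex_derive_continuous (K := R_AbsRing) f x). exists 0. apply H. lra.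
  - lra.
Qed.

Lemma disk_segment (z : C) (t : R) :
  unit_disk z -> 0 <= t <= 1 -> unit_disk (RtoC 0 + RtoC t * z)%C.
Proof.
  unfold unit_disk. intros Hz Ht. rewrite Cplus_0_l, Cmod_mult, Cmod_R, Rabs_pos_eq by lra.
  assert (P := Cmod_ge_0 z). nra.
Qed.

Lemma disk_const (F : C -> C) :
  (forall z, unit_disk z -> Cder F z (RtoC 0)) ->
  forall z, unit_disk z -> F z = F (RtoC 0).
Proof.
  intros H z Hz.
  assert (K : forall t, 0 <= t <= 1 ->
     is_derive (fun s : R => Re (F (RtoC 0 + RtoC s * z)%C)) t 0 /\
     is_derive (fun s : R => Im (F (RtoC 0 + RtoC s * z)%C)) t 0).
  { intros t Ht.
    destruct (Cder_line F (RtoC 0) z (RtoC 0) t) as [A B].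
    - now apply H, disk_segment.
    - rewrite Cmult_0_l in A, B. split; assumption. }
  assert (E1 := const_of_derive_0 _ 0 1 ltac:(lra) (fun t Ht => proj1 (K t Ht))).
  assert (E2 := const_of_derive_0 _ 0 1 ltac:(lra) (fun t Ht => proj2 (K t Ht))).
  simpl in E1, E2.
  replace (RtoC 0 + RtoC 0 * z)%C with (RtoC 0) in E1, E2 by ring.
  replace (RtoC 0 + RtoC 1 * z)%C with z in E1, E2 by ring.
  now apply C_eq_ReIm.
Qed.

(** * Complex power series *)

Notation Cseries := (is_series (K := C_AbsRing) (V := C_NormedModule)).
Notation Csum := (sum_n (G := AbelianGroup.AbelianMonoid C_AbelianGroup)).

Lemma Cseries_iff (x : nat -> C) (l : C) :
  Cseries x l <->
  forall eps, 0 < eps -> exists N, forall n, (N <= n)%nat -> Cmod (Csum x n - l) < eps.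
Proof.
  split.
  - intros H eps He. apply (H (fun u => Cmod (u - l)%C < eps)).
    apply locally_Cmod, He.
  - intros H P HP. apply locally_Cmod_iff in HP. destruct HP as [d [Hd K]].
    destruct (H d Hd) as [N HN]. exists N. intros n Hn. apply K, HN, Hn.
Qed.

Lemma Rseries_iff (x : nat -> R) (l : R) :
  is_series x l <->
  forall eps, 0 < eps -> exists N, forall n, (N <= n)%nat -> Rabs (sum_n x n - l) < eps.
Proof.
  split.
  - intros H eps He. apply (H (fun u => Rabs (u - l) < eps)).
    exists (mkposreal eps He). intros y Hy. exact Hy.
  - intros H P [d K].
    destruct (H d (cond_pos d)) as [N HN]. exists N. intros n Hn. apply K. apply HN, Hn.
Qed.

Lemma Re_Csum (x : nat -> C) (n : nat) : Re (Csum x n) = sum_n (fun k => Re (x k)) n.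
Proof.
  induction n; [now rewrite !sum_O|]. rewrite !sum_Sn, <- IHn. reflexivity.
Qed.

Lemma Im_Csum (x : nat -> C) (n : nat) : Im (Csum x n) = sum_n (fun k => Im (x k)) n.
Proof.
  induction n; [now rewrite !sum_O|]. rewrite !sum_Sn, <- IHn. reflexivity.
Qed.

Lemma Re_minus (a b : C) : Re (a - b) = Re a - Re b.
Proof. destruct a, b. reflexivity. Qed.
Lemma Im_minus (a b : C) : Im (a - b) = Im a - Im b.
Proof. destruct a, b. reflexivity. Qed.

Lemma Cseries_ReIm (x : nat -> C) (l : C) :
  Cseries x l <->
  is_series (fun n => Re (x n)) (Re l) /\ is_series (fun n => Im (x n)) (Im l).
Proof.
  rewrite Cseries_iff, !Rseries_iff. split.
  - intros H. split; intros e He; destruct (H e He) as [N HN]; exists N; intros n Hn;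
      (eapply Rle_lt_trans; [|exact (HN n Hn)]).
    + rewrite <- Re_Csum, <- Re_minus. apply re_le_Cmod.
    + rewrite <- Im_Csum, <- Im_minus. apply im_le_Cmod.
  - intros [H1 H2] e He.
    destruct (H1 (e/2)) as [N1 K1]; [lra|]. destruct (H2 (e/2)) as [N2 K2]; [lra|].
    exists (max N1 N2). intros n Hn.
    specialize (K1 n ltac:(lia)). specialize (K2 n ltac:(lia)).
    eapply Rle_lt_trans; [apply Cmod_le_ReIm|].
    rewrite Re_minus, Im_minus, Re_Csum, Im_Csum. lra.
Qed.

Lemma Cseries_unique (x : nat -> C) (l m : C) : Cseries x l -> Cseries x m -> l = m.
Proof.
  rewrite !Cseries_ReIm. intros [A B] [A' B']. apply C_eq_ReIm.
  - now rewrite <- (is_series_unique _ _ A), <- (is_series_unique _ _ A').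
  - now rewrite <- (is_series_unique _ _ B), <- (is_series_unique _ _ B').
Qed.

Lemma Cseries_ex (x : nat -> C) :
  ex_series (fun n => Cmod (x n)) -> exists l, Cseries x l.
Proof.
  intros H.
  assert (A : ex_series (fun n => Re (x n))).
  { apply (@ex_series_le R_AbsRing R_CompleteNormedModule) with (fun n => Cmod (x n)); auto.
    intros n. apply re_le_Cmod. }
  assert (B : ex_series (fun n => Im (x n))).
  { apply (@ex_series_le R_AbsRing R_CompleteNormedModule) with (fun n => Cmod (x n)); auto.
    intros n. apply im_le_Cmod. }
  destruct A as [a A], B as [b B]. exists (a, b). apply Cseries_ReIm. now split.
Qed.

Lemma Cmod_Csum (x : nat -> C) (b : nat -> R) (n : nat) :
  (forall k, Cmod (x k) <= b k) -> Cmod (Csum x n) <= sum_n b n.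
Proof.
  intros H. induction n; [rewrite !sum_O; auto|]. rewrite !sum_Sn.
  eapply Rle_trans; [apply Cmod_triangle|]. apply Rplus_le_compat; auto.
Qed.

Lemma Cseries_bound (x : nat -> C) (l : C) (b : nat -> R) :
  Cseries x l -> (forall n, Cmod (x n) <= b n) -> ex_series b -> Cmod l <= Series b.
Proof.
  intros H Hb Eb.
  assert (Hbp : forall n, 0 <= b n) by (intros n; eapply Rle_trans; [apply Cmod_ge_0|apply Hb]).
  apply Series_correct in Eb.
  apply le_epsilon. intros e He.
  rewrite Cseries_iff in H. rewrite Rseries_iff in Eb.
  destruct (H (e/2)) as [N HN]; [lra|].
  destruct (Eb (e/2)) as [N' HN']; [lra|].
  specialize (HN (max N N') ltac:(lia)). specialize (HN' (max N N') ltac:(lia)).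
  assert (T := Cmod_Csum x b (max N N') Hb).
  rewrite Cmod_minus_sym in HN. assert (T' := Cmod_triangle_inv l (Csum x (max N N'))).
  apply Rabs_def2 in HN'. lra.
Qed.

Lemma Cseries_terms_bounded (x : nat -> C) (l : C) :
  Cseries x l -> exists B, forall n, Cmod (x n) <= B.
Proof.
  intros H.
  destruct (filterlim_bounded (K := C_AbsRing) (V := C_NormedModule) (sum_n x)) as [M HM].
  { exists l. exact H. }
  assert (HM' : forall n, Cmod (Csum x n) <= M) by (intros n; apply (HM n)).
  exists (2 * M). intros n. destruct n.
  - specialize (HM' 0%nat). rewrite sum_O in HM'. assert (P := Cmod_ge_0 (x 0%nat)). lra.
  - assert (E : x (S n) = (Csum x (S n) - Csum x n)%C).
    { rewrite sum_Sn. change (x (S n) = (Csum x n + x (S n) - Csum x n)%C). ring. }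
    rewrite E. eapply Rle_trans; [apply Cmod_triangle_minus|].
    assert (A := HM' n). assert (B := HM' (S n)). lra.
Qed.

Lemma Cseries_mult (x y : nat -> C) (lx ly : C) :
  Cseries x lx -> Cseries y ly ->
  ex_series (fun n => Cmod (x n)) -> ex_series (fun n => Cmod (y n)) ->
  Cseries (fun n => Csum (fun k => x k * y (n - k)%nat)%C n) (lx * ly)%C.
Proof.
  intros Hx Hy Ax Ay. rewrite Cseries_ReIm in Hx, Hy.
  destruct Hx as [Xr Xi], Hy as [Yr Yi].
  assert (AR : forall u : nat -> C, ex_series (fun n => Cmod (u n)) ->
     ex_series (fun n => Rabs (Re (u n))) /\ ex_series (fun n => Rabs (Im (u n)))).
  { intros u Hu. split;
    apply (@ex_series_le R_AbsRing R_CompleteNormedModule) with (fun n => Cmod (u n)); auto;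
    intros n; unfold norm; simpl; unfold abs; simpl; rewrite Rabs_Rabsolu;
      [apply re_le_Cmod|apply im_le_Cmod]. }
  destruct (AR x Ax) as [AXr AXi], (AR y Ay) as [AYr AYi].
  assert (S1 := is_series_mult _ _ _ _ Xr Yr AXr AYr).
  assert (S2 := is_series_mult _ _ _ _ Xi Yi AXi AYi).
  assert (S3 := is_series_mult _ _ _ _ Xr Yi AXr AYi).
  assert (S4 := is_series_mult _ _ _ _ Xi Yr AXi AYr).
  apply Cseries_ReIm. split.
  - eapply is_series_ext; [|exact (is_series_minus _ _ _ _ S1 S2)].
    intros n. rewrite Re_Csum, sum_n_Reals.
    change (sum_f_R0 (fun k => Re (x k) * Re (y (n-k)%nat)) n - sum_f_R0 (fun k => Im (x k) * Im (y (n-k)%nat)) n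
      = sum_f_R0 (fun k => Re (x k * y (n-k)%nat)%C) n).
    rewrite <- minus_sum. apply sum_eq. intros i _. reflexivity.
  - eapply is_series_ext; [|exact (is_series_plus _ _ _ _ S3 S4)].
    intros n. rewrite Im_Csum, sum_n_Reals.
    change (sum_f_R0 (fun k => Re (x k) * Im (y (n-k)%nat)) n + sum_f_R0 (fun k => Im (x k) * Re (y (n-k)%nat)) n
      = sum_f_R0 (fun k => Im (x k * y (n-k)%nat)%C) n).
    rewrite <- plus_sum. apply sum_eq. intros i _. reflexivity.
Qed.

(** * Power series converging in the unit disk *)

Lemma Cis_pseries_iff (a : nat -> C) (z l : C) :
  is_pseries (K := C_AbsRing) (V := C_NormedModule) a z l <->
  Cseries (fun n => a n * z ^ n)%C l.
Proof.
  assert (E : forall n, scal (pow_n (K := C_Ring) z n) (a n : C_NormedModule) = (a n * z ^ n)%C).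
  { intros n. change (scal (pow_n (K := C_Ring) z n) (a n : C_NormedModule))
      with (pow_n (K := C_Ring) z n * a n)%C.
    apply Cmult_comm. }
  unfold is_pseries. split; apply is_series_ext; intros n; rewrite <- E; reflexivity.
Qed.

(** Phrased with moduli so that the real theory of [CV_radius] applies, in particular its invariance
    under differentiation. *)
Definition conv_disk (a : nat -> C) : Prop :=
  forall r, 0 <= r < 1 -> ex_series (fun n => Cmod (a n) * r ^ n).

Definition dcoef (a : nat -> C) (n : nat) : C := (RtoC (INR (S n)) * a (S n))%C.

Lemma conv_disk_radius (a : nat -> C) :
  (forall r, 0 <= r < 1 -> exists B, forall n, Cmod (a n) * r ^ n <= B) <->
  Rbar_le 1 (CV_radius (fun n => Cmod (a n))).
Proof.
  destruct (CV_radius_bounded (fun n => Cmod (a n))) as [Ub Lub].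
  split.
  - intros H. destruct (CV_radius (fun n => Cmod (a n))) as [c| |] eqn:E.
    + simpl. apply Rnot_lt_le. intros Hc.
      assert (H0 : Rbar_le 0 c) by (rewrite <- E; apply CV_radius_ge_0). simpl in H0.
      destruct (H ((c + 1)/2)) as [B HB]; [lra|].
      assert (K : Rbar_le ((c+1)/2) c).
      { apply Ub. exists B. intros n. rewrite Rabs_pos_eq; auto.
        apply Rmult_le_pos; [apply Cmod_ge_0|apply pow_le; lra]. }
      simpl in K. lra.
    + exact I.
    + assert (H0 := CV_radius_ge_0 (fun n => Cmod (a n))). rewrite E in H0. contradiction.
  - intros H r Hr.
    destruct (CV_disk_inside (fun n => Cmod (a n)) r) as [l Hl].
    + eapply Rbar_lt_le_trans; [|exact H]. simpl. rewrite Rabs_pos_eq; lra.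
    + destruct (filterlim_bounded (sum_n (fun n => Rabs (Cmod (a n) * r ^ n)))) as [M HM].
      { exists l. exact Hl. }
      exists M. intros n. specialize (HM n).
      eapply Rle_trans; [apply Rle_abs|].
      assert (P : forall m, 0 <= sum_n (fun n => Rabs (Cmod (a n) * r ^ n)) m).
      { intros m. rewrite sum_n_Reals. apply cond_pos_sum. intros; apply Rabs_pos. }
      change (Rabs (sum_n (fun n => Rabs (Cmod (a n) * r ^ n)) n) <= M) in HM.
      rewrite Rabs_pos_eq in HM by apply P.
      destruct n; [now rewrite sum_O in HM|].
      rewrite sum_Sn in HM. specialize (P n). unfold plus in HM; simpl in HM. simpl. lra.
Qed.

Lemma conv_disk_iff (a : nat -> C) :
  conv_disk a <-> Rbar_le 1 (CV_radius (fun n => Cmod (a n))).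
Proof.
  split.
  - intros H. apply conv_disk_radius. intros r Hr.
    destruct (H r Hr) as [l Hl].
    destruct (filterlim_bounded (sum_n (fun n => Cmod (a n) * r ^ n))) as [M HM].
    { exists l. exact Hl. }
    assert (T : forall n, 0 <= Cmod (a n) * r ^ n).
    { intros n. apply Rmult_le_pos; [apply Cmod_ge_0|apply pow_le; lra]. }
    exists M. intros n. specialize (HM n).
    assert (P : forall m, 0 <= sum_n (fun n => Cmod (a n) * r ^ n) m).
    { intros m. rewrite sum_n_Reals. apply cond_pos_sum, T. }
    change (Rabs (sum_n (fun n => Cmod (a n) * r ^ n) n) <= M) in HM.
    rewrite Rabs_pos_eq in HM by apply P.
    destruct n; [now rewrite sum_O in HM|].
    rewrite sum_Sn in HM. specialize (P n). unfold plus in HM; simpl in HM. simpl. lra.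
  - intros H r Hr.
    apply ex_series_ext with (fun n => Rabs (Cmod (a n) * r ^ n)).
    + intros n. apply Rabs_pos_eq. apply Rmult_le_pos; [apply Cmod_ge_0|apply pow_le; lra].
    + apply CV_disk_inside. eapply Rbar_lt_le_trans; [|exact H]. simpl. rewrite Rabs_pos_eq; lra.
Qed.

Lemma conv_disk_dcoef (a : nat -> C) : conv_disk a -> conv_disk (dcoef a).
Proof.
  rewrite !conv_disk_iff. intros H.
  replace (CV_radius (fun n => Cmod (dcoef a n))) with (CV_radius (fun n => Cmod (a n))); auto.
  rewrite <- CV_radius_derive. apply CV_radius_ext. intros n. unfold PS_derive, dcoef.
  rewrite Cmod_mult, Cmod_R, Rabs_pos_eq; auto. apply pos_INR.
Qed.

Lemma conv_disk_sum (a : nat -> C) (z : C) :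
  conv_disk a -> unit_disk z -> exists l, Cseries (fun n => a n * z ^ n)%C l.
Proof.
  intros H Hz. apply Cseries_ex.
  eapply ex_series_ext; [|apply (H (Cmod z)); split; [apply Cmod_ge_0|exact Hz]].
  intros n. simpl. now rewrite Cmod_mult, Cmod_pow.
Qed.

Lemma analytic_on_disk_iff (h : C -> C) :
  analytic_on_disk h <->
  exists a, conv_disk a /\ forall z, unit_disk z -> Cseries (fun n => a n * z ^ n)%C (h z).
Proof.
  split.
  - intros [a Ha]. exists a.
    assert (Ha' : forall z, unit_disk z -> Cseries (fun n => a n * z ^ n)%C (h z)).
    { intros z Hz. apply Cis_pseries_iff, Ha, Hz. }
    split; auto. apply conv_disk_iff, conv_disk_radius. intros r Hr.
    destruct (Cseries_terms_bounded _ _ (Ha' (RtoC r) ltac:(unfold unit_disk; rewrite Cmod_R, Rabs_pos_eq; lra)))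
      as [B HB].
    exists B. intros n. specialize (HB n).
    rewrite Cmod_mult, Cmod_pow, Cmod_R, Rabs_pos_eq in HB; lra.
  - intros [a [_ Ha]]. exists a. intros z Hz. apply Cis_pseries_iff, Ha, Hz.
Qed.

(** Classical description picks the sums; the values off the disk are unconstrained. *)
Lemma sum_fun (a : nat -> C) :
  conv_disk a ->
  exists h : C -> C, forall z, unit_disk z -> Cseries (fun n => a n * z ^ n)%C (h z).
Proof.
  intros H.
  assert (K : forall z, exists l, unit_disk z -> Cseries (fun n => a n * z ^ n)%C l).
  { intros z. destruct (classic (unit_disk z)) as [Hz|Hz].
    - destruct (conv_disk_sum a z H Hz) as [l Hl]. now exists l.
    - exists (RtoC 0). tauto. }
  exists (fun z => proj1_sig (constructive_indefinite_description _ (K z))).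
  intros z. exact (proj2_sig (constructive_indefinite_description _ (K z))).
Qed.

(** A second-order Taylor bound uniform in both points. The induction uses u^(n+1) - ... = u D + n
    z^(n-1) (u - z)^2, where D is the previous remainder. The missing factor 1/2 is harmless, since
    only convergence after summation matters. *)
Lemma Cpow_quad (u z : C) (r : R) (n : nat) :
  Cmod u <= r -> Cmod z <= r ->
  Cmod (u ^ n - z ^ n - RtoC (INR n) * z ^ pred n * (u - z))
  <= INR n * INR (pred n) * r ^ pred (pred n) * (Cmod (u - z)) ^ 2.
Proof.
  intros Hu Hz. assert (Hr : 0 <= r) by (eapply Rle_trans; [apply Cmod_ge_0|exact Hu]).
  induction n as [|n IH].
  - simpl. replace (RtoC 1 - RtoC 1 - RtoC 0 * RtoC 1 * (u - z))%C with (RtoC 0) by ring.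
    rewrite Cmod_0. lra.
  - set (D := (u ^ n - z ^ n - RtoC (INR n) * z ^ pred n * (u - z))%C) in *.
    assert (E : (u ^ S n - z ^ S n - RtoC (INR (S n)) * z ^ pred (S n) * (u - z))%C
       = (u * D + RtoC (INR n) * z ^ pred n * ((u - z) * (u - z)))%C).
    { unfold D. rewrite S_INR, RtoC_plus. destruct n; simpl pred.
      - simpl. ring.
      - rewrite !Cpow_S. ring. }
    rewrite E. eapply Rle_trans; [apply Cmod_triangle|].
    rewrite !Cmod_mult, Cmod_pow, Cmod_R, (Rabs_pos_eq (INR n)) by apply pos_INR.
    set (d := Cmod (u - z)) in *. assert (Pd : 0 <= d) by apply Cmod_ge_0.
    assert (Pu := Cmod_ge_0 u). assert (PD := Cmod_ge_0 D).
    assert (B1 : Cmod u * Cmod D <= r * (INR n * INR (pred n) * r ^ pred (pred n) * d ^ 2))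
      by (apply Rmult_le_compat; auto).
    assert (B2 : Cmod z ^ pred n <= r ^ pred n).
    { apply pow_incr. split; [apply Cmod_ge_0|auto]. }
    assert (Pn := pos_INR n). assert (Pd2 : 0 <= d * d) by nra.
    assert (B3 : INR n * Cmod z ^ pred n * (d * d) <= INR n * r ^ pred n * (d * d)).
    { apply Rmult_le_compat_r; auto. apply Rmult_le_compat_l; auto. }
    simpl pred. rewrite S_INR.
    destruct n as [|[|n]].
    + simpl in *. nra.
    + simpl in *. nra.
    + simpl pred in *. change (r ^ S n) with (r * r ^ n) in *.
      rewrite (S_INR (S n)) in *. rewrite (S_INR n) in *.
      assert (Pr : 0 <= r ^ n) by (apply pow_le; auto).
      assert (Pn' := pos_INR n).
      assert (Q : 0 <= (INR n + 1 + 1) * (r * r ^ n) * (d * d)).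
      { apply Rmult_le_pos; auto. apply Rmult_le_pos; [lra|]. nra. }
      simpl pow in *. nra.
Qed.

(** One constant serves all base points of a closed disk. This yields differentiability at once and
    later supplies the uniform error constant of the Newton iteration. *)
Definition quad_estimate (h h1 : C -> C) : Prop :=
  forall r, 0 <= r < 1 -> exists M, 0 <= M /\
    forall u z, Cmod u <= r -> Cmod z <= r ->
      Cmod (h u - h z - h1 z * (u - z)) <= M * Cmod (u - z) ^ 2.

Lemma pseries_quad_estimate (a : nat -> C) (h h1 : C -> C) :
  conv_disk a ->
  (forall z, unit_disk z -> Cseries (fun n => a n * z ^ n)%C (h z)) ->
  (forall z, unit_disk z -> Cseries (fun n => dcoef a n * z ^ n)%C (h1 z)) ->
  quad_estimate h h1.
Proof.
  intros Ha Hh Hh1 r Hr.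
  set (b := fun n => Cmod (a n) * (INR n * INR (pred n) * r ^ pred (pred n))).
  assert (Eb : ex_series b).
  (* The terms with index below 2 vanish; shifted by two, this is the absolute series of the twice
     derived coefficients. *)
  { apply (ex_series_incr_n b 2). assert (K := conv_disk_dcoef _ (conv_disk_dcoef _ Ha) r Hr).
    eapply ex_series_ext; [|exact K]. intros n. unfold b, dcoef.
    rewrite !Cmod_mult, !Cmod_R, !Rabs_pos_eq by apply pos_INR.
    change (2 + n)%nat with (S (S n)). simpl pred. match goal with |- @eq _ ?x ?y => change (@eq R x y) end. ring. }
  exists (Rabs (Series b)). split; [apply Rabs_pos|].
  intros u z Hu Hz.
  assert (Du : unit_disk u) by (unfold unit_disk; lra).
  assert (Dz : unit_disk z) by (unfold unit_disk; lra).
  (* The derived series is re-indexed, with a zero term in front, so that its terms pair with those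
     of [h u] and [h z]. *)
  assert (S1 : Cseries (fun n => RtoC (INR n) * a n * z ^ pred n * (u - z))%C (h1 z * (u - z))%C).
  { apply is_series_decr_1.
    assert (E : @eq C (plus (h1 z * (u - z))%C (opp (RtoC (INR 0) * a 0%nat * z ^ pred 0 * (u - z))%C))
            (scal (u - z)%C (h1 z : C_NormedModule))).
    { change ((h1 z * (u - z) - RtoC 0 * a 0%nat * RtoC 1 * (u - z))%C = ((u - z) * h1 z)%C). ring. }
    refine (eq_ind_r (Cseries _) _ E).
    eapply is_series_ext; [|apply (is_series_scal_l (K := C_AbsRing) (V := C_NormedModule) (u - z)%C), (Hh1 z Dz)].
    intros n. unfold dcoef.
    change ((u - z) * (RtoC (INR (S n)) * a (S n) * z ^ n) =
      RtoC (INR (S n)) * a (S n) * z ^ pred (S n) * (u - z))%C. simpl pred. match goal with |- @eq _ ?x ?y => change (@eq C x y) end. ring. }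
  assert (S2 := is_series_minus (K := C_AbsRing) (V := C_NormedModule) _ _ _ _
                  (is_series_minus (K := C_AbsRing) (V := C_NormedModule) _ _ _ _ (Hh u Du) (Hh z Dz)) S1).
  eapply Rle_trans; [|apply Rmult_le_compat_r; [apply pow_le, Cmod_ge_0|apply Rle_abs]].
  rewrite (Rmult_comm (Series b)).
  rewrite <- (Series_scal_l (Cmod (u - z) ^ 2) b).
  eapply (Cseries_bound _ _ _ S2).
  - intros n.
    match goal with |- Cmod ?t <= _ => replace t with
      (a n * (u ^ n - z ^ n - RtoC (INR n) * z ^ pred n * (u - z)))%C end.
    + rewrite Cmod_mult. unfold b.
      assert (Q := Cpow_quad u z r n Hu Hz). assert (P := Cmod_ge_0 (a n)).
      eapply Rle_trans; [apply Rmult_le_compat_l; [exact P|exact Q]|]. right. ring.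
    + change (a n * (u ^ n - z ^ n - RtoC (INR n) * z ^ pred n * (u - z))
       = a n * u ^ n - a n * z ^ n - RtoC (INR n) * a n * z ^ pred n * (u - z))%C. ring.
  - apply (ex_series_scal_l (Cmod (u - z) ^ 2) b Eb).
Qed.

Lemma quad_estimate_Cder (h h1 : C -> C) :
  quad_estimate h h1 -> forall z, unit_disk z -> Cder h z (h1 z).
Proof.
  intros H z Hz. unfold unit_disk in Hz. assert (Pz := Cmod_ge_0 z).
  destruct (H ((1 + Cmod z)/2)) as [M [HM K]]; [lra|].
  apply Cder_of_estimate. intros e He.
  exists (Rmin ((1 - Cmod z)/2) (e / (M + 1))). split.
  { apply Rmin_glb_lt; [lra|]. apply Rdiv_lt_0_compat; lra. }
  intros u Hu.
  assert (U1 : Cmod (u - z) < (1 - Cmod z)/2) by (eapply Rlt_le_trans; [exact Hu|apply Rmin_l]).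
  assert (U2 : Cmod (u - z) < e / (M + 1)) by (eapply Rlt_le_trans; [exact Hu|apply Rmin_r]).
  assert (T := Cmod_triangle_inv u z).
  eapply Rle_trans; [apply K; lra|].
  assert (U3 : Cmod (u - z) * (M + 1) <= e).
  { apply Rle_trans with (e / (M + 1) * (M + 1)); [apply Rmult_le_compat_r; lra|right; field; lra]. }
  assert (P := Cmod_ge_0 (u - z)). nra.
Qed.

(** * Calculus of analytic functions on the disk *)

Lemma analytic_ext (f g : C -> C) :
  (forall z, unit_disk z -> f z = g z) -> analytic_on_disk f -> analytic_on_disk g.
Proof. intros H [a Ha]. exists a. intros z Hz. rewrite <- H; auto. Qed.

Lemma analytic_quad_estimate (h : C -> C) :
  analytic_on_disk h -> analytic_on_disk (C_derive h) /\ quad_estimate h (C_derive h).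
Proof.
  intros H. apply analytic_on_disk_iff in H. destruct H as [a [Ha Hh]].
  assert (Ha1 := conv_disk_dcoef a Ha).
  destruct (sum_fun _ Ha1) as [h1 Hh1].
  assert (Q := pseries_quad_estimate a h h1 Ha Hh Hh1).
  assert (E : forall z, unit_disk z -> h1 z = C_derive h z).
  { intros z Hz. symmetry. apply Cder_C_derive, quad_estimate_Cder; auto. }
  split.
  - apply analytic_ext with h1; auto. apply analytic_on_disk_iff. exists (dcoef a). auto.
  - intros r Hr. destruct (Q r Hr) as [M [HM K]]. exists M. split; auto.
    intros u z Hu Hz. rewrite <- E by (unfold unit_disk; lra). auto.
Qed.

Lemma analytic_Cder (h : C -> C) (z : C) :
  analytic_on_disk h -> unit_disk z -> Cder h z (C_derive h z).
Proof.
  intros H Hz. apply quad_estimate_Cder; auto. apply analytic_quad_estimate, H.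
Qed.

Lemma analytic_C_derive (h : C -> C) : analytic_on_disk h -> analytic_on_disk (C_derive h).
Proof. intros H. apply analytic_quad_estimate, H. Qed.

Lemma Cseries_at_0 (a : nat -> C) (l : C) :
  Cseries (fun n => a n * RtoC 0 ^ n)%C l -> l = a 0%nat.
Proof.
  intros H. eapply Cseries_unique; [exact H|].
  apply Cseries_iff. intros e He. exists 0%nat. intros n _.
  replace (Csum (fun n => a n * RtoC 0 ^ n)%C n) with (a 0%nat).
  - replace (a 0%nat - a 0%nat)%C with (RtoC 0) by ring. now rewrite Cmod_0.
  - induction n.
    + rewrite sum_O. simpl. ring.
    + rewrite sum_Sn, <- IHn, Cpow_S.
      change (a 0%nat = a 0%nat + a (S n) * (RtoC 0 * RtoC 0 ^ n))%C. ring.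
Qed.

Lemma analytic_primitive (y : C -> C) :
  analytic_on_disk y ->
  exists h, analytic_on_disk h /\ h (RtoC 0) = RtoC 0 /\
    forall z, unit_disk z -> Cder h z (y z).
Proof.
  intros H. apply analytic_on_disk_iff in H. destruct H as [a [Ha Hy]].
  set (A := fun n => match n with O => RtoC 0 | S m => (a m / RtoC (INR (S m)))%C end).
  assert (In : forall m, RtoC (INR (S m)) <> RtoC 0).
  { intros m E. apply RtoC_inj in E. revert E. apply not_0_INR. lia. }
  assert (CA : conv_disk A).
  { intros r Hr. apply (ex_series_incr_1 (fun n => Cmod (A n) * r ^ n)).
    apply (@ex_series_le R_AbsRing R_CompleteNormedModule) with (fun n => Cmod (a n) * r ^ n); auto.
    intros n. change (Rabs (Cmod (A (S n)) * r ^ S n) <= Cmod (a n) * r ^ n).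
    assert (P : 0 <= r ^ n) by (apply pow_le; lra).
    rewrite Rabs_pos_eq.
    2: { apply Rmult_le_pos; [apply Cmod_ge_0|apply pow_le; lra]. }
    unfold A. rewrite Cmod_div by auto. rewrite Cmod_R, Rabs_pos_eq by apply pos_INR.
    assert (B : 1 <= INR (S n)) by (rewrite S_INR; assert (T := pos_INR n); lra).
    apply Rmult_le_compat; [|apply pow_le; lra| |simpl; nra].
    - apply Rmult_le_pos; [apply Cmod_ge_0|]. left. apply Rinv_0_lt_compat; lra.
    - rewrite <- (Rmult_1_r (Cmod (a n))) at 2. apply Rmult_le_compat_l; [apply Cmod_ge_0|].
      rewrite <- Rinv_1. apply Rinv_le_contravar; lra. }
  assert (EA : forall n, dcoef A n = a n).
  { intros n. unfold dcoef, A. field. auto. }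
  destruct (sum_fun A CA) as [h Hh].
  exists h. split; [|split].
  - apply analytic_on_disk_iff. now exists A.
  - apply (Cseries_at_0 A), Hh, unit_disk_0.
  - intros z Hz. apply (quad_estimate_Cder h y); auto.
    apply (pseries_quad_estimate A h y CA Hh). intros w Hw.
    eapply is_series_ext; [|apply Hy, Hw]. intros n. simpl. now rewrite EA.
Qed.

Lemma analytic_mult (f g : C -> C) :
  analytic_on_disk f -> analytic_on_disk g -> analytic_on_disk (fun z => f z * g z)%C.
Proof.
  intros Hf Hg. apply analytic_on_disk_iff in Hf, Hg.
  destruct Hf as [a [Ca Ha]], Hg as [b [Cb Hb]].
  exists (fun n => Csum (fun k => a k * b (n - k)%nat)%C n). intros z Hz. apply Cis_pseries_iff.
  assert (AC : forall c, conv_disk c -> ex_series (fun n => Cmod (c n * z ^ n)%C)).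
  { intros c Hc. eapply ex_series_ext; [|apply (Hc (Cmod z)); split; [apply Cmod_ge_0|exact Hz]].
    intros n. simpl. now rewrite Cmod_mult, Cmod_pow. }
  eapply is_series_ext; [|exact (Cseries_mult _ _ _ _ (Ha z Hz) (Hb z Hz) (AC a Ca) (AC b Cb))].
  intros n. simpl.
  transitivity (sum_n (G := AbelianGroup.AbelianMonoid C_AbelianGroup)
    (fun k => mult (K := C_Ring) (a k * b (n - k)%nat)%C (z ^ n)%C) n).
  - apply (sum_n_ext_loc (G := AbelianGroup.AbelianMonoid C_AbelianGroup)). intros k Hk.
    change ((a k * z ^ k) * (b (n - k)%nat * z ^ (n - k)) = a k * b (n - k)%nat * z ^ n)%C.
    replace (z ^ n)%C with (z ^ k * z ^ (n - k))%C; [ring|].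
    rewrite <- Cpow_add_r. f_equal. lia.
  - apply (sum_n_mult_r (K := C_Ring)).
Qed.

(** * Koebe and affine transforms *)

Lemma is_derive_unique_loc (f g : R -> R) (x l m : R) :
  locally x (fun t => f t = g t) -> is_derive f x l -> is_derive g x m -> l = m.
Proof.
  intros H Hf Hg. rewrite <- (is_derive_unique _ _ _ Hg). symmetry. apply is_derive_unique.
  now apply is_derive_ext_loc with f.
Qed.

Lemma disk_line_nbhd (z e : C) :
  unit_disk z -> Cmod e = 1 -> locally 0 (fun t : R => unit_disk (z + RtoC t * e)%C).
Proof.
  intros Hz He. destruct (unit_disk_nbhd z Hz) as [P Q].
  exists (mkposreal _ P). intros t Ht. apply Q.
  replace (z + RtoC t * e - z)%C with (RtoC t * e)%C by ring.
  rewrite Cmod_mult, He, Cmod_R, Rmult_1_r.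
  change (Rabs (t - 0) < 1 - Cmod z) in Ht. now rewrite Rminus_0_r in Ht.
Qed.

(** With l = F'(z) and m = G'(z), differentiation along a unit vector e gives l e = conj (m e).
    Direction 1 yields l = conj m, direction i yields l = - conj m, so l = 0. *)
Lemma holomorphic_antiholomorphic_const (F G : C -> C) :
  (forall z, unit_disk z -> exists l, Cder F z l) ->
  (forall z, unit_disk z -> exists m, Cder G z m) ->
  (forall z, unit_disk z -> F z = Cconj (G z)) ->
  forall z, unit_disk z -> F z = F (RtoC 0).
Proof.
  intros HF HG E. apply disk_const. intros z Hz.
  destruct (HF z Hz) as [l Hl]. destruct (HG z Hz) as [m Hm].
  assert (K : forall e, Cmod e = 1 -> Re (l * e) = Re (m * e) /\ Im (l * e) = - Im (m * e)).
  { intros e He. assert (Z : (z + RtoC 0 * e)%C = z) by ring.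
    assert (Hl' := Hl). assert (Hm' := Hm). rewrite <- Z in Hl', Hm'.
    destruct (Cder_line _ _ _ _ _ Hl') as [A1 A2].
    destruct (Cder_line _ _ _ _ _ Hm') as [B1 B2].
    assert (N := disk_line_nbhd z e Hz He). split.
    - eapply is_derive_unique_loc; [|exact A1|exact B1].
      eapply filter_imp; [|exact N]. intros t Ht. simpl in Ht. cbv beta. rewrite E by auto.
      apply re_conj.
    - eapply is_derive_unique_loc; [|exact A2|exact (is_derive_opp _ _ _ B2)].
      eapply filter_imp; [|exact N]. intros t Ht. simpl in Ht. cbv beta. rewrite E by auto.
      apply im_conj. }
  destruct (K (RtoC 1) Cmod_1) as [K1 K2]. destruct (K Ci Cmod_Ci) as [K3 K4].
  replace (RtoC 0) with l; auto.
  destruct l as [l1 l2], m as [m1 m2]. unfold Re, Im, Cmult, RtoC, Ci in *; simpl in *.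
  apply C_eq_ReIm; unfold Re, Im, RtoC; simpl; lra.
Qed.

(** The difference of two decompositions satisfies h - H = conj (G - g), hence is constant, and
    vanishes by the values at 0; the normalisation of [G] at 0 is then forced. This identifies the
    existential parts supplied by [LIF] with explicit formulas. *)
Lemma harmonic_parts_unique (f h g H G : C -> C) :
  harmonic_parts f h g ->
  (forall z, unit_disk z -> exists l, Cder H z l) ->
  (forall z, unit_disk z -> exists l, Cder G z l) ->
  H (RtoC 0) = RtoC 0 ->
  (forall z, unit_disk z -> f z = (H z + Cconj (G z))%C) ->
  forall z, unit_disk z -> h z = H z /\ g z = G z.
Proof.
  intros (Ah & Ag & h0 & g0 & Ef) DH DG H0 EF z Hz.
  assert (E : forall w, unit_disk w -> (h w - H w)%C = Cconj (G w - g w)).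
  { intros w Hw. specialize (Ef w Hw). rewrite (EF w Hw) in Ef. rewrite Cminus_conj.
    replace (h w) with (h w + Cconj (g w) - Cconj (g w))%C by ring. rewrite <- Ef. ring. }
  assert (K : (h z - H z)%C = (h (RtoC 0) - H (RtoC 0))%C).
  { apply (holomorphic_antiholomorphic_const (fun w => h w - H w)%C (fun w => G w - g w)%C); auto.
    - intros w Hw. destruct (DH w Hw) as [l Hl]. eexists. apply Cder_minus; [|exact Hl].
      now apply analytic_Cder.
    - intros w Hw. destruct (DG w Hw) as [l Hl]. eexists. apply Cder_minus; [exact Hl|].
      now apply analytic_Cder. }
  rewrite h0, H0 in K.
  assert (K1 : h z = H z).
  { replace (h z) with (h z - H z + H z)%C by ring. rewrite K. ring. }
  split; auto.
  assert (K2 := E z Hz). rewrite K1 in K2.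
  replace (H z - H z)%C with (RtoC 0) in K2 by ring.
  apply (f_equal Cconj) in K2. rewrite Cconj_conj in K2.
  replace (g z) with (G z - (G z - g z))%C by ring. rewrite <- K2.
  apply C_eq_ReIm; destruct (G z); unfold Re, Im, Cminus, Cplus, Copp, Cconj, RtoC; simpl; ring.
Qed.

Lemma C_derive_of_parts (f h g H G H1 G1 : C -> C) :
  harmonic_parts f h g ->
  (forall z, unit_disk z -> Cder H z (H1 z)) ->
  (forall z, unit_disk z -> Cder G z (G1 z)) ->
  H (RtoC 0) = RtoC 0 ->
  (forall z, unit_disk z -> f z = (H z + Cconj (G z))%C) ->
  forall z, unit_disk z -> C_derive h z = H1 z /\ C_derive g z = G1 z.
Proof.
  intros Hp DH DG H0 EF z Hz.
  assert (K := harmonic_parts_unique f h g H G Hp (fun z Hz => ex_intro _ _ (DH z Hz))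
                 (fun z Hz => ex_intro _ _ (DG z Hz)) H0 EF).
  split; apply Cder_C_derive.
  - apply Cder_ext_disk with H; auto. intros u Hu. symmetry. now apply K.
  - apply Cder_ext_disk with G; auto. intros u Hu. symmetry. now apply K.
Qed.

(** * Automorphisms of the disk and the parts of a Koebe transform *)

Definition rot (theta : R) : C := (cos theta, sin theta).

Lemma Cmod_rot (theta : R) : Cmod (rot theta) = 1.
Proof.
  assert (H := sin2_cos2 theta). unfold Rsqr in H.
  unfold Cmod, rot; simpl. rewrite !Rmult_1_r, Rplus_comm, H. apply sqrt_1.
Qed.

Lemma Cmod_lt_of_sq (x y : C) : Cmod x ^ 2 < Cmod y ^ 2 -> Cmod x < Cmod y.
Proof. intros H. assert (P := Cmod_ge_0 x). assert (Q := Cmod_ge_0 y). nra. Qed.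

(** Positivity of the right side gives both that the denominator does not vanish and that the image
    stays in the disk. *)
Lemma disk_aut_identity (a z : C) :
  Cmod (RtoC 1 + Cconj a * z) ^ 2 - Cmod (z + a) ^ 2 = (1 - Cmod a ^ 2) * (1 - Cmod z ^ 2).
Proof.
  rewrite !Cmod2_alt. destruct a, z. unfold Re, Im, Cplus, Cmult, Cconj, RtoC; simpl. ring.
Qed.

Lemma disk_aut_denom (a z : C) :
  Cmod a < 1 -> Cmod z < 1 -> (RtoC 1 + Cconj a * z)%C <> RtoC 0.
Proof.
  intros Ha Hz. apply Cmod_gt_0. rewrite <- Cmod_0 at 1. apply Cmod_lt_of_sq.
  assert (E := disk_aut_identity a z). rewrite Cmod_0.
  assert (P := Cmod_ge_0 a). assert (Q := Cmod_ge_0 z).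
  assert (0 < (1 - Cmod a ^ 2) * (1 - Cmod z ^ 2)) by (apply Rmult_lt_0_compat; nra).
  assert (T := pow2_ge_0 (Cmod (z + a))). lra.
Qed.

Lemma disk_aut_disk (theta : R) (a z : C) :
  Cmod a < 1 -> unit_disk z -> unit_disk (disk_aut theta a z).
Proof.
  intros Ha Hz. unfold unit_disk in *. assert (D := disk_aut_denom a z Ha Hz).
  unfold disk_aut. fold (rot theta). rewrite Cmod_mult, Cmod_rot, Cmod_div, Rmult_1_l by auto.
  assert (PD := proj1 (Cmod_gt_0 _) D).
  apply Rmult_lt_reg_r with (Cmod (RtoC 1 + Cconj a * z)); auto.
  unfold Rdiv. rewrite Rmult_assoc, Rinv_l, Rmult_1_r, Rmult_1_l by lra.
  apply Cmod_lt_of_sq. assert (E := disk_aut_identity a z).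
  assert (P := Cmod_ge_0 a). assert (Q := Cmod_ge_0 z).
  assert (0 < (1 - Cmod a ^ 2) * (1 - Cmod z ^ 2)) by (apply Rmult_lt_0_compat; nra). lra.
Qed.

Definition disk_aut_derive (theta : R) (a z : C) : C :=
  (rot theta * (RtoC 1 - a * Cconj a) / ((RtoC 1 + Cconj a * z) * (RtoC 1 + Cconj a * z)))%C.

Lemma Cder_affine (c d z : C) : Cder (fun u => c + d * u)%C z d.
Proof.
  eapply Cder_eq; [|apply Cder_plus; [apply Cder_const|apply Cder_scal, Cder_id]]. ring.
Qed.

Lemma disk_aut_Cder (theta : R) (a z : C) :
  Cmod a < 1 -> unit_disk z -> Cder (disk_aut theta a) z (disk_aut_derive theta a z).
Proof.
  intros Ha Hz. assert (D := disk_aut_denom a z Ha Hz).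
  unfold disk_aut. fold (rot theta). eapply Cder_eq;
    [|apply Cder_scal, (Cder_div (fun u => u + a)%C (fun u => RtoC 1 + Cconj a * u)%C z (RtoC 1) (Cconj a))].
  - unfold disk_aut_derive. field. auto.
  - auto.
  - eapply Cder_eq; [|apply Cder_plus; [apply Cder_id|apply Cder_const]]. ring.
  - apply Cder_affine.
Qed.

Definition disk_aut_derive2 (theta : R) (a z : C) : C :=
  (- (RtoC 1 + RtoC 1) * Cconj a * disk_aut_derive theta a z / (RtoC 1 + Cconj a * z))%C.

Lemma disk_aut_derive_Cder (theta : R) (a z : C) :
  Cmod a < 1 -> unit_disk z -> Cder (disk_aut_derive theta a) z (disk_aut_derive2 theta a z).
Proof.
  intros Ha Hz. assert (D := disk_aut_denom a z Ha Hz).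
  unfold disk_aut_derive. eapply Cder_eq; [|apply Cder_div; [|apply Cder_const|apply Cder_mult; apply Cder_affine]].
  - unfold disk_aut_derive2, disk_aut_derive. field. auto.
  - now apply Cmult_neq_0.
Qed.

Lemma one_minus_conj (a : C) : (RtoC 1 - a * Cconj a)%C = RtoC (1 - Cmod a ^ 2).
Proof. rewrite <- Cmod2_conj, RtoC_minus. rewrite RtoC_pow. reflexivity. Qed.

Lemma disk_aut_derive_neq_0 (theta : R) (a z : C) :
  Cmod a < 1 -> unit_disk z -> disk_aut_derive theta a z <> RtoC 0.
Proof.
  intros Ha Hz. assert (D := disk_aut_denom a z Ha Hz). unfold disk_aut_derive.
  assert (P := Cmod_ge_0 a).
  apply Cmult_neq_0.
  - apply Cmult_neq_0.
    + apply Cmod_gt_0. rewrite Cmod_rot. lra.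
    + rewrite one_minus_conj. intros E. apply RtoC_inj in E. nra.
  - apply Cmod_gt_0. rewrite Cmod_inv, Cmod_mult by now apply Cmult_neq_0.
    apply Cmod_gt_0 in D. apply Rinv_0_lt_compat. nra.
Qed.

Lemma Cconj_neq_0 (z : C) : z <> RtoC 0 -> Cconj z <> RtoC 0.
Proof. intros H. apply Cmod_gt_0. rewrite Cmod_conj. now apply Cmod_gt_0. Qed.

Lemma Cconj_RtoC (r : R) : Cconj (RtoC r) = RtoC r.
Proof. apply C_eq_ReIm; unfold Re, Im, Cconj, RtoC; simpl; ring. Qed.

(** The normalising factor of [koebe_transform], with the derivative of the automorphism in closed
    form. *)
Definition koebe_const (theta : R) (a : C) (h : C -> C) : C :=
  (C_derive h (disk_aut theta a (RtoC 0)) * disk_aut_derive theta a (RtoC 0))%C.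

Section Koebe.
Context (theta : R) (a : C) (f h g : C -> C) (Ha : Cmod a < 1) (Hp : harmonic_parts f h g)
  (h'_neq_0 : forall z, unit_disk z -> C_derive h z <> RtoC 0).
Let phi := disk_aut theta a.
Let A := koebe_const theta a h.

Lemma koebe_const_neq_0 : A <> RtoC 0.
Proof.
  apply Cmult_neq_0.
  - apply h'_neq_0, disk_aut_disk; auto. apply unit_disk_0.
  - apply disk_aut_derive_neq_0; auto. apply unit_disk_0.
Qed.

Lemma koebe_const_eq :
  (C_derive h (phi (RtoC 0)) * C_derive phi (RtoC 0))%C = A.
Proof.
  unfold A, koebe_const, phi. f_equal.
  apply Cder_C_derive, disk_aut_Cder; auto. apply unit_disk_0.
Qed.

(** Dividing conj g by [A] amounts to dividing g by conj A, so the two parts of the transform carry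
    different constants. *)
Lemma koebe_transform_eq (z : C) : unit_disk z ->
  koebe_transform phi f h z =
  ((h (phi z) - h (phi (RtoC 0))) / A + Cconj ((g (phi z) - g (phi (RtoC 0))) / Cconj A))%C.
Proof.
  intros Hz. unfold koebe_transform. rewrite koebe_const_eq.
  destruct Hp as (_ & _ & _ & _ & Ef). assert (NA := koebe_const_neq_0).
  unfold phi. rewrite !Ef by (apply disk_aut_disk; auto; apply unit_disk_0).
  rewrite Cdiv_conj by now apply Cconj_neq_0.
  rewrite Cconj_conj, Cminus_conj. field. exact NA.
Qed.

Lemma koebe_Cder (k : C -> C) (c z : C) :
  analytic_on_disk k -> c <> RtoC 0 -> unit_disk z ->
  Cder (fun z => (k (phi z) - k (phi (RtoC 0))) / c)%C z (C_derive k (phi z) * disk_aut_derive theta a z / c)%C.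
Proof.
  intros Hk Hc Hz.
  eapply Cder_eq; [|apply Cder_div; [exact Hc|apply Cder_minus; [|apply Cder_const]|apply Cder_const]].
  2: { apply Cder_comp; [|now apply disk_aut_Cder].
       apply analytic_Cder; auto. now apply disk_aut_disk. }
  cbv beta; unfold phi; field. auto.
Qed.

Lemma koebe_Cder2 (k : C -> C) (c z : C) :
  analytic_on_disk k -> c <> RtoC 0 -> unit_disk z ->
  Cder (fun z => C_derive k (phi z) * disk_aut_derive theta a z / c)%C z
   ((C_derive (C_derive k) (phi z) * disk_aut_derive theta a z * disk_aut_derive theta a z
      + C_derive k (phi z) * disk_aut_derive2 theta a z) / c)%C.
Proof.
  intros Hk Hc Hz.
  eapply Cder_eq; [|apply Cder_div; [exact Hc|apply Cder_mult|apply Cder_const]].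
  2: { apply (Cder_comp (C_derive k) phi); [|now apply disk_aut_Cder].
       apply analytic_Cder; auto using analytic_C_derive. now apply disk_aut_disk. }
  2: { now apply disk_aut_derive_Cder. }
  cbv beta; unfold phi; field. auto.
Qed.

Lemma koebe_parts_derive (h1 g1 : C -> C) :
  harmonic_parts (koebe_transform phi f h) h1 g1 ->
  forall z, unit_disk z ->
    C_derive h1 z = (C_derive h (phi z) * disk_aut_derive theta a z / A)%C /\
    C_derive g1 z = (C_derive g (phi z) * disk_aut_derive theta a z / Cconj A)%C.
Proof.
  intros Hp1. assert (NA := koebe_const_neq_0). destruct Hp as (Ah & Ag & _).
  apply (C_derive_of_parts _ h1 g1
    (fun z => (h (phi z) - h (phi (RtoC 0))) / A)%C
    (fun z => (g (phi z) - g (phi (RtoC 0))) / Cconj A)%C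
    (fun z => C_derive h (phi z) * disk_aut_derive theta a z / A)%C
    (fun z => C_derive g (phi z) * disk_aut_derive theta a z / Cconj A)%C Hp1); auto.
  - intros z Hz. now apply koebe_Cder.
  - intros z Hz. apply koebe_Cder; auto. now apply Cconj_neq_0.
  - field. auto.
  - intros z Hz. now apply koebe_transform_eq.
Qed.

Lemma koebe_parts_derive2 (h1 g1 : C -> C) :
  harmonic_parts (koebe_transform phi f h) h1 g1 ->
  forall z, unit_disk z ->
    C_derive (C_derive h1) z =
    ((C_derive (C_derive h) (phi z) * disk_aut_derive theta a z * disk_aut_derive theta a z
      + C_derive h (phi z) * disk_aut_derive2 theta a z) / A)%C.
Proof.
  intros Hp1 z Hz. assert (NA := koebe_const_neq_0). destruct Hp as (Ah & Ag & _).
  apply Cder_C_derive.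
  eapply Cder_ext_disk; [exact Hz| |apply koebe_Cder2; auto].
  intros u Hu. symmetry. now apply (koebe_parts_derive h1 g1).
Qed.
End Koebe.

(** * Estimates from linear and affine invariance *)

Lemma LIF_parts (L : (C -> C) -> Prop) (f h g : C -> C) :
  LIF L -> L f -> harmonic_parts f h g ->
  locally_univalent f /\ sense_preserving h g /\ C_derive h (RtoC 0) = RtoC 1 /\
  forall (theta : R) (a : C), Cmod a < 1 ->
    L (koebe_transform (disk_aut theta a) f h).
Proof.
  intros HL Hf Hp. destruct (HL f Hf) as (h1 & g1 & Hp1 & LU & SP & N & K).
  assert (Hp1' := Hp1). destruct Hp1' as (A1 & B1 & Z1 & _ & E1).
  assert (E : forall z, unit_disk z -> C_derive h z = C_derive h1 z /\ C_derive g z = C_derive g1 z).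
  { apply (C_derive_of_parts f h g h1 g1); auto; intros z Hz; now apply analytic_Cder. }
  split; auto. split; [|split].
  - intros z Hz. destruct (E z Hz) as [-> ->]. now apply SP.
  - rewrite (proj1 (E _ unit_disk_0)). exact N.
  - intros theta a Ha. assert (K' := K theta a Ha).
    (* The transform uses [h] only through one value of its derivative inside the disk, so the two
       transforms agree as total functions and membership in [L] transfers without any
       extensionality of [L]. *)
    replace (koebe_transform (disk_aut theta a) f h) with (koebe_transform (disk_aut theta a) f h1); auto.
    unfold koebe_transform.
    rewrite (proj1 (E (disk_aut theta a (RtoC 0)) ltac:(apply disk_aut_disk; auto; apply unit_disk_0))).
    reflexivity.
Qed.

Lemma sense_preserving_lt (h g : C -> C) (z : C) :
  sense_preserving h g -> unit_disk z -> Cmod (C_derive g z) < Cmod (C_derive h z).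
Proof. intros H Hz. apply Cmod_lt_of_sq. specialize (H z Hz). lra. Qed.

Lemma sense_preserving_neq_0 (h g : C -> C) (z : C) :
  sense_preserving h g -> unit_disk z -> C_derive h z <> RtoC 0.
Proof.
  intros H Hz. apply Cmod_gt_0. eapply Rle_lt_trans; [apply Cmod_ge_0|].
  now apply (sense_preserving_lt h g).
Qed.

Lemma family_order_bound (L : (C -> C) -> Prop) (alpha : R) (f h g : C -> C) :
  family_order L = Finite alpha -> L f -> harmonic_parts f h g -> Cmod (coef_a2 h) <= alpha.
Proof.
  intros HO Hf Hp. unfold family_order in HO.
  destruct (Lub_Rbar_correct (fun x : R => exists f h g : C -> C,
    L f /\ harmonic_parts f h g /\ x = Cmod (coef_a2 h))) as [Ub _].
  rewrite HO in Ub. apply (Ub (Cmod (coef_a2 h))). now exists f, h, g.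
Qed.

Lemma disk_aut_at_0 (theta : R) (a : C) : disk_aut theta a (RtoC 0) = (rot theta * a)%C.
Proof.
  unfold disk_aut, rot. field.
Qed.

(** The expression is exactly [coef_a2] of the Koebe transform with [theta = 0] centred at [a]; the
    term conj a comes from the second derivative of the automorphism at 0. *)
Lemma LIF_pre_schwarzian_bound (L : (C -> C) -> Prop) (alpha : R) (f h g : C -> C) (a : C) :
  LIF L -> family_order L = Finite alpha -> L f -> harmonic_parts f h g -> unit_disk a ->
  Cmod (RtoC ((1 - Cmod a ^ 2) / 2) * (C_derive (C_derive h) a / C_derive h a) - Cconj a) <= alpha.
Proof.
  intros HL HO Hf Hp Ha.
  destruct (LIF_parts L f h g HL Hf Hp) as (_ & SP & _ & K).
  specialize (K 0 a Ha). destruct (HL _ K) as (h1 & g1 & Hp1 & _).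
  assert (B := family_order_bound L alpha _ h1 g1 HO K Hp1).
  assert (NZ : forall z, unit_disk z -> C_derive h z <> RtoC 0)
    by (intros z Hz; now apply (sense_preserving_neq_0 h g)).
  assert (D := koebe_parts_derive2 0 a f h g Ha Hp NZ h1 g1 Hp1 _ unit_disk_0).
  unfold coef_a2 in B. rewrite D in B. clear D.
  assert (R1 : rot 0 = RtoC 1) by (unfold rot, RtoC; now rewrite cos_0, sin_0).
  assert (N1 : RtoC 1 <> RtoC 0) by (intros E; apply RtoC_inj in E; lra).
  assert (D1 : disk_aut_derive 0 a (RtoC 0) = RtoC (1 - Cmod a ^ 2)).
  { unfold disk_aut_derive. rewrite R1, one_minus_conj. field. }
  assert (D2 : disk_aut_derive2 0 a (RtoC 0) = (- RtoC 2 * Cconj a * RtoC (1 - Cmod a ^ 2))%C).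
  { unfold disk_aut_derive2. rewrite D1. replace (RtoC 1 + RtoC 1)%C with (RtoC 2) by (rewrite <- RtoC_plus; f_equal; lra).
    field. }
  unfold koebe_const in B. rewrite disk_aut_at_0, R1, Cmult_1_l in B. rewrite D1, D2 in B.
  unfold unit_disk in Ha. assert (P := Cmod_ge_0 a).
  assert (N2 : RtoC (1 - Cmod a ^ 2) <> RtoC 0) by (intros E; apply RtoC_inj in E; nra).
  assert (N3 : RtoC 2 <> RtoC 0) by (intros E; apply RtoC_inj in E; lra).
  assert (N4 := NZ a Ha).
  eapply Rle_trans; [right|exact B]. f_equal.
  rewrite RtoC_div by lra. field. auto.
Qed.

(* (1 - r)^(alpha - 1) / (1 + r)^(alpha + 1) *)
Definition stretch_minorant (alpha r : R) : R := exp ((alpha - 1) * ln (1 - r) - (alpha + 1) * ln (1 + r)).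

Lemma nondecreasing_of_derive (f f' : R -> R) (a b : R) :
  a <= b -> (forall t, a <= t <= b -> is_derive f t (f' t)) ->
  (forall t, a <= t <= b -> 0 <= f' t) -> f a <= f b.
Proof.
  intros Hab H Hp. destruct (MVT_gen f a b f') as [c [Hc E]].
  - intros x Hx. rewrite Rmin_left, Rmax_right in Hx by lra. apply H. lra.
  - intros x Hx. rewrite Rmin_left, Rmax_right in Hx by lra.
    apply continuity_pt_filterlim.
    apply (ex_derive_continuous (K := R_AbsRing) f x). exists (f' x). apply H. lra.
  - rewrite Rmin_left, Rmax_right in Hc by lra. specialize (Hp c Hc). nra.
Qed.

Lemma Re_div (w v : C) : v <> RtoC 0 ->
  Re (w / v) = (Re w * Re v + Im w * Im v) / (Re v ^ 2 + Im v ^ 2).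
Proof.
  intros H. assert (P := proj1 (Cmod_gt_0 _) H).
  assert (Q : 0 < Re v ^ 2 + Im v ^ 2) by (rewrite <- Cmod2_alt; nra).
  destruct w, v. unfold Re, Im, Cdiv, Cmult, Cinv in *; simpl in *. field. nra.
Qed.

Lemma log_norm_derive (p q : R -> R) (alpha t p' q' : R) :
  is_derive p t p' -> is_derive q t q' -> 0 < p t ^ 2 + q t ^ 2 -> -1 < t < 1 ->
  is_derive (fun t => ln (p t ^ 2 + q t ^ 2) - 2 * ((alpha - 1) * ln (1 - t) - (alpha + 1) * ln (1 + t))) t
   (2 * ((p t * p' + q t * q') / (p t ^ 2 + q t ^ 2)) + 2 * ((alpha - 1) / (1 - t) + (alpha + 1) / (1 + t))).
Proof.
  intros Dp Dq P Ht. auto_derive.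
  - repeat split; try (now exists p'); try (now exists q'); lra.
  - replace (Derive (fun x => p x) t) with p' by (symmetry; now apply is_derive_unique).
    replace (Derive (fun x => q x) t) with q' by (symmetry; now apply is_derive_unique).
    field. repeat split; lra.
Qed.

(** Along the radius to [z], the real function ln |h'|^2 has derivative 2 Re (e h''/h'), where e is
    the direction of [z]; the hypothesis bounds this below by the logarithmic derivative of the
    squared minorant. *)
Lemma growth_bound (alpha : R) (h : C -> C) :
  analytic_on_disk h ->
  (forall z, unit_disk z -> C_derive h z <> RtoC 0) ->
  C_derive h (RtoC 0) = RtoC 1 ->
  (forall a, unit_disk a ->
    Cmod (RtoC ((1 - Cmod a ^ 2) / 2) * (C_derive (C_derive h) a / C_derive h a) - Cconj a) <= alpha) ->
  forall z, unit_disk z -> stretch_minorant alpha (Cmod z) <= Cmod (C_derive h z).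
Proof.
  intros Ah NZ N1 HB z Hz.
  destruct (classic (z = RtoC 0)) as [->|Z0].
  { rewrite N1, Cmod_1, Cmod_0. unfold stretch_minorant.
    rewrite Rminus_0_r, Rplus_0_r, ln_1, !Rmult_0_r, Rminus_0_r, exp_0. lra. }
  set (r := Cmod z). assert (Pr : 0 < r) by now apply Cmod_gt_0.
  assert (Lr : r < 1) by exact Hz.
  assert (Nr : RtoC r <> RtoC 0) by (intros E; apply RtoC_inj in E; lra).
  set (e := (z / RtoC r)%C).
  assert (Me : Cmod e = 1).
  { unfold e. rewrite Cmod_div by auto. rewrite Cmod_R, Rabs_pos_eq by lra. fold r. field. lra. }
  assert (Mt : forall t, 0 <= t <= r -> Cmod (RtoC 0 + RtoC t * e)%C = t).
  { intros t Ht. rewrite Cplus_0_l, Cmod_mult, Me, Cmod_R, Rabs_pos_eq; lra. }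
  assert (Dt : forall t, 0 <= t <= r -> unit_disk (RtoC 0 + RtoC t * e)%C).
  { intros t Ht. unfold unit_disk. rewrite Mt; lra. }
  set (v := fun t => C_derive h (RtoC 0 + RtoC t * e)%C).
  set (w := fun t => (C_derive (C_derive h) (RtoC 0 + RtoC t * e) * e)%C).
  set (N := fun t => Re (v t) ^ 2 + Im (v t) ^ 2).
  assert (PN : forall t, 0 <= t <= r -> 0 < N t).
  { intros t Ht. unfold N. rewrite <- Cmod2_alt. apply pow_lt, Cmod_gt_0, NZ, Dt, Ht. }
  set (l := fun t => ln (N t) - 2 * ((alpha - 1) * ln (1 - t) - (alpha + 1) * ln (1 + t))).
  set (l' := fun t => 2 * Re (w t / v t)%C + 2 * ((alpha - 1) / (1 - t) + (alpha + 1) / (1 + t))).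
  (* [l] is twice the logarithm of the quotient of |h'| by the minorant. It vanishes at 0, so its
     monotonicity is the claim. *)
  assert (Hl : l 0 <= l r).
  { apply nondecreasing_of_derive with l'; [lra| |].
    - intros t Ht.
      destruct (Cder_line (C_derive h) (RtoC 0) e (C_derive (C_derive h) (RtoC 0 + RtoC t * e)%C) t)
        as [D1 D2].
      { apply analytic_Cder; [now apply analytic_C_derive|now apply Dt]. }
      fold (w t) in D1, D2.
      change (is_derive (fun s => Re (v s)) t (Re (w t))) in D1.
      change (is_derive (fun s => Im (v s)) t (Im (w t))) in D2.
      assert (PNt := PN t Ht). unfold N in PNt.
      replace (l' t) with
        (2 * ((Re (v t) * Re (w t) + Im (v t) * Im (w t)) / (Re (v t) ^ 2 + Im (v t) ^ 2))
          + 2 * ((alpha - 1) / (1 - t) + (alpha + 1) / (1 + t))).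
      + apply (log_norm_derive (fun s => Re (v s)) (fun s => Im (v s))); auto. lra.
      + unfold l'. rewrite Re_div by (apply NZ, Dt, Ht). fold (v t). field. repeat split; lra.
    - intros t Ht.
      assert (B := HB _ (Dt t Ht)). rewrite (Mt t Ht) in B.
      assert (Q : 0 < (1 - t ^ 2) / 2) by nra.
      set (p := (C_derive (C_derive h) (RtoC 0 + RtoC t * e) / C_derive h (RtoC 0 + RtoC t * e))%C) in *.
      assert (E : (w t / v t)%C = (p * e)%C).
      { unfold w, v, p. field. apply NZ, Dt, Ht. }
      (* Multiplying by the unit vector [e] turns conj (t e) into the real number t, which isolates
         the radial logarithmic derivative. *)
      assert (B' : Rabs (Re ((RtoC ((1 - t ^ 2) / 2) * p - Cconj (RtoC 0 + RtoC t * e)) * e)%C) <= alpha).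
      { eapply Rle_trans; [apply re_le_Cmod|]. rewrite Cmod_mult, Me, Rmult_1_r. exact B. }
      assert (E2 : Re ((RtoC ((1 - t ^ 2) / 2) * p - Cconj (RtoC 0 + RtoC t * e)) * e)%C
        = (1 - t ^ 2) / 2 * Re (p * e)%C - t).
      { assert (Me2 : Re e ^ 2 + Im e ^ 2 = 1) by (rewrite <- Cmod2_alt, Me; lra).
        replace (t) with (t * (Re e ^ 2 + Im e ^ 2)) at 4 by (rewrite Me2; ring).
        destruct p, e. unfold Re, Im, Cmult, Cminus, Cplus, Copp, Cconj, RtoC; simpl. field. }
      rewrite E2 in B'. unfold l'. rewrite E.
      assert (B2 : t - alpha <= (1 - t ^ 2) / 2 * Re (p * e)%C).
      { assert (T := Rle_abs (- ((1 - t ^ 2) / 2 * Re (p * e)%C - t))). rewrite Rabs_Ropp in T. lra. }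
      (* This factor clears the partial fractions: the terms in [alpha] become 2 (alpha - t). *)
      apply Rmult_le_reg_r with ((1 - t ^ 2) / 2); [lra|].
      rewrite Rmult_0_l.
      replace ((2 * Re (p * e)%C + 2 * ((alpha - 1) / (1 - t) + (alpha + 1) / (1 + t))) * ((1 - t ^ 2) / 2))
        with (2 * ((1 - t ^ 2) / 2 * Re (p * e)%C + (alpha - t))) by (field; lra). lra. }
  unfold l in Hl.
  assert (N0 : N 0 = 1).
  { unfold N, v. replace (RtoC 0 + RtoC 0 * e)%C with (RtoC 0) by ring. rewrite N1.
    unfold Re, Im, RtoC; simpl. ring. }
  rewrite N0, Rminus_0_r, Rplus_0_r, ln_1 in Hl.
  assert (Er : (RtoC 0 + RtoC r * e)%C = z) by (unfold e; field; auto).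
  assert (ENr : N r = Cmod (C_derive h z) ^ 2).
  { unfold N, v. rewrite Er. symmetry. apply Cmod2_alt. }
  assert (Ph : 0 < Cmod (C_derive h z)) by (apply Cmod_gt_0, NZ, Hz).
  rewrite ENr in Hl. simpl in Hl. rewrite Rmult_1_r, ln_mult in Hl by auto.
  unfold stretch_minorant. rewrite <- (exp_ln (Cmod (C_derive h z))) by auto.
  assert (T : (alpha - 1) * ln (1 - r) - (alpha + 1) * ln (1 + r) <= ln (Cmod (C_derive h z))) by lra.
  destruct (Rle_lt_or_eq_dec _ _ T) as [T'|T'].
  - left. now apply exp_increasing.
  - right. now rewrite T'.
Qed.

Lemma affine_parts_derive (f h g h1 g1 : C -> C) (eps : C) :
  harmonic_parts f h g -> (RtoC 1 + eps * C_derive g (RtoC 0))%C <> RtoC 0 ->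
  harmonic_parts (affine_transform eps f g) h1 g1 ->
  forall z, unit_disk z ->
    C_derive h1 z = ((C_derive h z + eps * C_derive g z) / (RtoC 1 + eps * C_derive g (RtoC 0)))%C.
Proof.
  intros (Ah & Ag & h0 & g0 & Ef) NE Hp1 z Hz.
  set (E := (RtoC 1 + eps * C_derive g (RtoC 0))%C) in *.
  apply (C_derive_of_parts _ h1 g1 (fun z => / E * (h z + eps * g z))%C
    (fun z => / Cconj E * (g z + Cconj eps * h z))%C
    (fun z => (C_derive h z + eps * C_derive g z) / E)%C
    (fun z => / Cconj E * (C_derive g z + Cconj eps * C_derive h z))%C Hp1); auto.
  - intros w Hw. eapply Cder_eq; [|apply Cder_scal, Cder_plus; [|apply Cder_scal]; now apply analytic_Cder].
    field. auto.
  - intros w Hw. apply Cder_scal, Cder_plus; [|apply Cder_scal]; now apply analytic_Cder.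
  - rewrite h0, g0. ring.
  - intros w Hw. unfold affine_transform, dzbar. rewrite Cconj_conj. fold E. rewrite (Ef w Hw).
    rewrite !Cmult_conj, !Cplus_conj, !Cmult_conj, !Cconj_conj.
    rewrite <- Cinv_conj by auto. rewrite Cconj_conj. field. auto.
Qed.

(** The affine transform has analytic part (h + eps g) / (1 + eps g'(0)), and its denominator has
    modulus at least 1 - |g'(0)|. Growth of its derivative therefore bounds |h' + eps g'| for every
    [eps]; rotating eps g' against h' brings |h'| - |g'| out. *)
Lemma ALIF_stretch_bound (L : (C -> C) -> Prop) (alpha : R) (f h g : C -> C) :
  ALIF L -> family_order L = Finite alpha -> L f -> harmonic_parts f h g ->
  forall z, unit_disk z ->
    (1 - Cmod (C_derive g (RtoC 0))) * stretch_minorant alpha (Cmod z)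
    <= Cmod (C_derive h z) - Cmod (C_derive g z).
Proof.
  intros [HL HA] HO Hf Hp z Hz.
  destruct (LIF_parts L f h g HL Hf Hp) as (_ & SP & N1 & _).
  assert (G0 := sense_preserving_lt h g _ SP unit_disk_0). rewrite N1, Cmod_1 in G0.
  set (b := stretch_minorant alpha (Cmod z)). assert (Pb : 0 < b) by apply exp_pos.
  set (g'0 := C_derive g (RtoC 0)) in *.
  assert (K : forall eps, unit_disk eps ->
    (1 - Cmod g'0) * b <= Cmod (C_derive h z + eps * C_derive g z)).
  { intros eps He.
    assert (Q : 1 - Cmod g'0 <= Cmod (RtoC 1 + eps * g'0)).
    { assert (T := Cmod_triangle_inv (RtoC 1) (- (eps * g'0))%C).
      replace (RtoC 1 - - (eps * g'0))%C with (RtoC 1 + eps * g'0)%C in T by ring.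
      rewrite Cmod_1, Cmod_opp, Cmod_mult in T. unfold unit_disk in He.
      assert (P1 := Cmod_ge_0 eps). assert (P2 := Cmod_ge_0 g'0). nra. }
    assert (NE : (RtoC 1 + eps * g'0)%C <> RtoC 0) by (apply Cmod_gt_0; lra).
    assert (Lf := HA f h g Hf Hp eps He).
    destruct (HL _ Lf) as (h1 & g1 & Hp1 & _ & SP1 & M1 & _).
    assert (D := affine_parts_derive f h g h1 g1 eps Hp NE Hp1).
    assert (B : b <= Cmod (C_derive h1 z)).
    { apply growth_bound; auto.
      - apply Hp1.
      - intros w Hw. now apply (sense_preserving_neq_0 h1 g1).
      - intros a Ha. apply (LIF_pre_schwarzian_bound L alpha (affine_transform eps f g) h1 g1 a); auto. }
    rewrite (D z Hz) in B. rewrite Cmod_div in B by auto. fold g'0 in B.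
    assert (PE := proj1 (Cmod_gt_0 _) NE).
    assert (B' : b * Cmod (RtoC 1 + eps * g'0) <= Cmod (C_derive h z + eps * C_derive g z)).
    { apply Rmult_le_reg_r with (/ Cmod (RtoC 1 + eps * g'0)); [now apply Rinv_0_lt_compat|].
      rewrite Rmult_assoc, Rinv_r, Rmult_1_r by lra. exact B. }
    eapply Rle_trans; [|exact B']. rewrite Rmult_comm. apply Rmult_le_compat_l; lra. }
  assert (HZ : C_derive h z <> RtoC 0) by now apply (sense_preserving_neq_0 h g).
  assert (PH := proj1 (Cmod_gt_0 _) HZ).
  destruct (classic (C_derive g z = RtoC 0)) as [EG|NG].
  { specialize (K (RtoC 0) unit_disk_0). rewrite Cmult_0_l, Cplus_0_r in K.
    rewrite EG, Cmod_0. lra. }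
  assert (PG := proj1 (Cmod_gt_0 _) NG).
  apply le_epsilon. intros d Hd.
  (* The optimal [eps] is unimodular and hence not admissible. Shrinking it by s < 1 costs (1 - s)
     |g'| <= d; the maximum with 0 covers the case of d larger than |g'|. *)
  set (s := Rmax 0 (1 - d / Cmod (C_derive g z))).
  assert (Hs : 0 <= s < 1).
  { split; [apply Rmax_l|]. apply Rmax_lub_lt; [lra|].
    assert (0 < d / Cmod (C_derive g z)) by (apply Rdiv_lt_0_compat; lra). lra. }
  set (H := Cmod (C_derive h z)) in *. set (G := Cmod (C_derive g z)) in *.
  (* This [eps] has modulus [s] and makes eps g' a negative real multiple of h'. *)
  set (eps := (- (RtoC (s * G / H) * (C_derive h z / C_derive g z)))%C).
  assert (Ms : 0 <= s * G / H).
  { apply Rmult_le_pos; [nra|]. left. now apply Rinv_0_lt_compat. }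
  assert (He : unit_disk eps).
  { unfold unit_disk, eps. rewrite Cmod_opp, Cmod_mult, Cmod_div, Cmod_R, Rabs_pos_eq by auto.
    fold H G. replace (s * G / H * (H / G)) with s by (field; lra). lra. }
  specialize (K eps He).
  replace (C_derive h z + eps * C_derive g z)%C with (RtoC (1 - s * G / H) * C_derive h z)%C in K
    by (unfold eps; rewrite RtoC_minus; field; auto).
  assert (GH : G < H) by now apply sense_preserving_lt.
  rewrite Cmod_mult, Cmod_R in K. fold H in K.
  rewrite Rabs_pos_eq in K.
  2: { apply Rmult_le_reg_r with H; auto.
       replace ((1 - s * G / H) * H) with (H - s * G) by (field; lra). nra. }
  replace ((1 - s * G / H) * H) with (H - s * G) in K by (field; lra).
  assert (s * G >= G - d).
  { assert (T : 1 - d / G <= s) by apply Rmax_r.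
    assert ((1 - d / G) * G <= s * G) by (apply Rmult_le_compat_r; lra).
    replace ((1 - d / G) * G) with (G - d) in H0 by (field; lra). lra. }
  lra.
Qed.

(** * The order is at least one *)

Lemma rot_lipschitz (x y : R) : Cmod (rot x - rot y) <= 2 * Rabs (x - y).
Proof.
  assert (H : forall f f' : R -> R, (forall t, is_derive f t (f' t)) -> (forall t, -1 <= f' t <= 1) ->
     Rabs (f x - f y) <= Rabs (x - y)).
  { intros f f' D B. destruct (MVT_gen f y x f') as [c [_ E]].
    - intros; apply D.
    - intros t _. apply continuity_pt_filterlim.
      apply (ex_derive_continuous (K := R_AbsRing) f t). now exists (f' t).
    - rewrite E, Rabs_mult. rewrite <- (Rmult_1_l (Rabs (x - y))) at 2.
      apply Rmult_le_compat_r; [apply Rabs_pos|]. apply Rabs_le, B. }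
  eapply Rle_trans; [apply Cmod_le_ReIm|].
  rewrite Re_minus, Im_minus. unfold rot, Re, Im; simpl.
  assert (A1 := H cos (fun t => - sin t) ltac:(intros t; auto_derive; auto; ring)
    ltac:(intros t; assert (T := SIN_bound t); lra)).
  assert (A2 := H sin cos ltac:(intros t; auto_derive; auto; ring) COS_bound). lra.
Qed.

(** * Mean value property on circles *)

Lemma RInt_const_R (a b c : R) : RInt (fun _ => c) a b = (b - a) * c.
Proof. exact (RInt_const a b c). Qed.

Section MeanValue.
Context (F F1 : C -> C) (DF : forall z, unit_disk z -> Cder F z (F1 z))
  (CF1 : forall z, unit_disk z -> Ccont F1 z).

Let pt (r th : R) : C := (RtoC r * rot th)%C.

Lemma polar_disk (r th : R) : -1 < r < 1 -> unit_disk (pt r th).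
Proof.
  intros H. unfold unit_disk, pt. rewrite Cmod_mult, Cmod_rot, Cmod_R, Rmult_1_r.
  apply Rabs_def1; lra.
Qed.

Lemma polar_derive_radius (r th : R) : -1 < r < 1 ->
  is_derive (fun s => Re (F (pt s th))) r (Re (F1 (pt r th) * rot th)%C).
Proof.
  intros H. apply (Cder_curve F (fun s => pt s th) (rot th)).
  - unfold pt, rot, Re, RtoC, Cmult; simpl. auto_derive; auto. ring.
  - unfold pt, rot, Im, RtoC, Cmult; simpl. auto_derive; auto. ring.
  - now apply DF, polar_disk.
Qed.

Lemma polar_derive_angle (r th : R) : -1 < r < 1 ->
  is_derive (fun s => Re (F (pt r s))) th (Re (F1 (pt r th) * (Ci * pt r th))%C) /\
  is_derive (fun s => Im (F (pt r s))) th (Im (F1 (pt r th) * (Ci * pt r th))%C).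
Proof.
  intros H. apply (Cder_curve F (fun s => pt r s)).
  - unfold pt, rot, Re, RtoC, Cmult, Ci; simpl. auto_derive; auto. ring.
  - unfold pt, rot, Im, RtoC, Cmult, Ci; simpl. auto_derive; auto. ring.
  - now apply DF, polar_disk.
Qed.

(** Joint continuity of the radial derivative is what differentiation under the integral sign
    requires. *)
Lemma polar_continuity (r th : R) : -1 < r < 1 ->
  continuity_2d_pt (fun u v => Re (F1 (pt u v) * rot v)%C) r th.
Proof.
  intros H eps.
  set (B := 1 + Cmod (F1 (pt r th))).
  assert (PB : 1 <= B) by (unfold B; assert (T := Cmod_ge_0 (F1 (pt r th))); lra).
  assert (Pe := cond_pos eps).
  destruct (CF1 _ (polar_disk r th H) (eps / 2)) as [d [Hd K]]; [lra|].
  assert (Pd : 0 < Rmin (d / 4) (eps / (8 * B))).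
  { apply Rmin_glb_lt; [lra|]. apply Rdiv_lt_0_compat; lra. }
  exists (mkposreal _ Pd). intros u v Hu Hv. cbn [pos] in Hu, Hv. cbv beta.
  assert (U1 : Rabs (u - r) < d / 4) by (eapply Rlt_le_trans; [exact Hu|apply Rmin_l]).
  assert (V1 : Rabs (v - th) < d / 4) by (eapply Rlt_le_trans; [exact Hv|apply Rmin_l]).
  assert (V2 : Rabs (v - th) < eps / (8 * B)) by (eapply Rlt_le_trans; [exact Hv|apply Rmin_r]).
  assert (L := rot_lipschitz v th).
  assert (D : Cmod (pt u v - pt r th) < d).
  { unfold pt. replace (RtoC u * rot v - RtoC r * rot th)%C
      with (RtoC (u - r) * rot v + RtoC r * (rot v - rot th))%C by (rewrite RtoC_minus; ring).
    eapply Rle_lt_trans; [apply Cmod_triangle|].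
    rewrite !Cmod_mult, !Cmod_R, Cmod_rot.
    assert (R1 : Rabs r < 1) by (apply Rabs_def1; lra). assert (R2 := Rabs_pos r).
    assert (P2 := Cmod_ge_0 (rot v - rot th)). nra. }
  specialize (K _ D).
  rewrite <- Re_minus. eapply Rle_lt_trans; [apply re_le_Cmod|].
  replace (F1 (pt u v) * rot v - F1 (pt r th) * rot th)%C
    with ((F1 (pt u v) - F1 (pt r th)) * rot v + F1 (pt r th) * (rot v - rot th))%C by ring.
  eapply Rle_lt_trans; [apply Cmod_triangle|]. rewrite !Cmod_mult, Cmod_rot.
  assert (V3 : Rabs (v - th) * (8 * B) < eps).
  { apply Rlt_le_trans with (eps / (8 * B) * (8 * B)); [apply Rmult_lt_compat_r; lra|].
    right. field. lra. }
  assert (P1 := Cmod_ge_0 (F1 (pt r th))). assert (P2 := Cmod_ge_0 (rot v - rot th)).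
  assert (P3 := Rabs_pos (v - th)). unfold B in *. nra.
Qed.

Lemma radius_nbhd (r : R) : -1 < r < 1 -> locally r (fun x => -1 < x < 1).
Proof.
  intros H. assert (P : 0 < Rmin (1 - r) (r + 1)) by (apply Rmin_glb_lt; lra).
  exists (mkposreal _ P). intros x Hx.
  assert (Hx' : Rabs (x - r) < Rmin (1 - r) (r + 1)) by exact Hx.
  assert (A := Rmin_l (1 - r) (r + 1)). assert (B := Rmin_r (1 - r) (r + 1)).
  apply Rabs_def2 in Hx'. lra.
Qed.

Lemma continuous_angle (r th : R) : -1 < r < 1 -> continuous (fun s => Re (F (pt r s))) th.
Proof.
  intros H. apply (ex_derive_continuous (K := R_AbsRing) (V := R_NormedModule) (fun s => Re (F (pt r s))) th).
  eexists. exact (proj1 (polar_derive_angle r th H)).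
Qed.

(** By the Cauchy-Riemann equations the radial derivative of Re F is the angular derivative of Im F
    divided by r, whose integral over a full turn vanishes. *)
Lemma RInt_derive_radius (r : R) : -1 < r < 1 ->
  RInt (fun th => Re (F1 (pt r th) * rot th)%C) 0 (2 * PI) = 0.
Proof.
  intros H.
  assert (R1 : rot (2 * PI) = rot 0).
  { unfold rot. now rewrite sin_2PI, cos_2PI, sin_0, cos_0. }
  assert (C1 : forall th, continuous (fun s => Re (F1 (pt r s) * rot s)%C) th).
  { intros th. apply continuity_pt_filterlim.
    assert (K := polar_continuity r th H). intros e He.
    destruct (K (mkposreal e He)) as [d Kd].
    exists d. split; [apply cond_pos|]. intros x [_ Hx]. apply Kd; [|exact Hx].
    replace (r - r) with 0 by ring. rewrite Rabs_R0. apply cond_pos. }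
  destruct (Req_dec r 0) as [E|E].
  - apply is_RInt_unique.
    replace 0 with (minus (Im (F1 (RtoC 0) * rot (2 * PI))%C) (Im (F1 (RtoC 0) * rot 0)%C)) at 2
      by (rewrite R1; exact (Rplus_opp_r _)).
    apply (is_RInt_derive (fun th => Im (F1 (RtoC 0) * rot th)%C)); auto.
    intros x _. unfold pt. rewrite E, Cmult_0_l.
    destruct (F1 (RtoC 0)) as [p q]. unfold rot, Im, Re, Cmult; simpl. auto_derive; auto. ring.
  - apply is_RInt_unique.
    replace 0 with (minus (/ r * Im (F (pt r (2 * PI)))) (/ r * Im (F (pt r 0)))) at 2
      by (unfold pt; rewrite R1; exact (Rplus_opp_r _)).
    apply (is_RInt_derive (fun th => / r * Im (F (pt r th)))); auto.
    intros x _. destruct (polar_derive_angle r x H) as [_ D].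
    replace (Re (F1 (pt r x) * rot x)%C) with (/ r * Im (F1 (pt r x) * (Ci * pt r x))%C).
    + now apply is_derive_scal.
    + unfold pt. destruct (F1 (RtoC r * rot x)%C) as [p q].
      unfold rot, Im, Re, Cmult, Ci, RtoC; simpl. field. auto.
Qed.

(** The circle mean has zero derivative in the radius, so it equals its value at radius 0. *)
Lemma mean_value (r : R) : 0 <= r < 1 ->
  RInt (fun th => Re (F (pt r th))) 0 (2 * PI) = 2 * PI * Re (F (RtoC 0)).
Proof.
  intros Hr.
  transitivity (RInt (fun th => Re (F (pt 0 th))) 0 (2 * PI)).
  - symmetry. apply (const_of_derive_0 (fun r => RInt (fun th => Re (F (pt r th))) 0 (2 * PI)));
      [lra|]. intros t Ht.
    assert (H : -1 < t < 1) by lra.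
    assert (E : 0 = RInt (fun th => Derive (fun u => Re (F (pt u th))) t) 0 (2 * PI)).
    { transitivity (RInt (fun th => Re (F1 (pt t th) * rot th)%C) 0 (2 * PI));
        [symmetry; now apply RInt_derive_radius|]. apply RInt_ext. intros x _.
      symmetry. apply is_derive_unique. now apply polar_derive_radius. }
    refine (eq_ind_r (is_derive _ t) _ E).
    apply (is_derive_RInt_param (fun r th => Re (F (pt r th))) 0 (2 * PI) t).
    + eapply filter_imp; [|exact (radius_nbhd t H)]. intros x Hx th _.
      eexists. apply (polar_derive_radius x th). exact Hx.
    + intros th _.
      apply continuity_2d_pt_ext_loc with (fun u v => Re (F1 (pt u v) * rot v)%C).
      * destruct (radius_nbhd t H) as [d Hd]. exists d. intros u v Hu _.
        symmetry. apply is_derive_unique. apply polar_derive_radius. now apply Hd.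
      * now apply polar_continuity.
    + eapply filter_imp; [|exact (radius_nbhd t H)]. intros x Hx.
      apply (ex_RInt_continuous (V := R_CompleteNormedModule)). intros z _. now apply continuous_angle.
  - rewrite (RInt_ext _ (fun _ => Re (F (RtoC 0)))).
    + rewrite RInt_const_R. match goal with |- @eq _ ?x ?y => change (@eq R x y) end. ring.
    + intros x _. unfold pt. now rewrite Cmult_0_l.
Qed.

Lemma mean_value_le (r m : R) : 0 <= r < 1 ->
  (forall z, Cmod z = r -> m <= Re (F z)) -> m <= Re (F (RtoC 0)).
Proof.
  intros Hr H. assert (PP := PI_RGT_0).
  apply Rmult_le_reg_l with (2 * PI); [lra|]. rewrite <- (mean_value r Hr).
  replace (2 * PI * m) with (RInt (fun _ : R => m) 0 (2 * PI)).
  - apply RInt_le; [lra| | |].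
    + apply ex_RInt_const.
    + apply (ex_RInt_continuous (V := R_CompleteNormedModule)). intros z _. apply continuous_angle. lra.
    + intros x _. apply H. unfold pt. rewrite Cmod_mult, Cmod_rot, Cmod_R, Rabs_pos_eq; lra.
  - rewrite RInt_const_R. match goal with |- @eq _ ?x ?y => change (@eq R x y) end. ring.
Qed.
End MeanValue.

Lemma order_ge_1_of_pre_schwarzian_bound (alpha : R) (h : C -> C) :
  analytic_on_disk h ->
  (forall z, unit_disk z -> C_derive h z <> RtoC 0) ->
  (forall a, unit_disk a ->
    Cmod (RtoC ((1 - Cmod a ^ 2) / 2) * (C_derive (C_derive h) a / C_derive h a) - Cconj a) <= alpha) ->
  1 <= alpha.
Proof.
  intros Ah NZ HB. apply Rnot_lt_le. intros Ha.
  assert (A0 : 0 <= alpha) by (eapply Rle_trans; [apply Cmod_ge_0|exact (HB _ unit_disk_0)]).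
  (* Any radius strictly between [alpha] and 1 serves: on |z| = r the bound gives Re (z h''/h') >= 2
     r (r - alpha) / (1 - r^2) > 0. *)
  set (r := (1 + alpha) / 2).
  assert (Hr : alpha < r < 1) by (unfold r; lra).
  set (h1 := C_derive h) in *. set (h2 := C_derive h1) in *. set (h3 := C_derive h2).
  assert (A1 : analytic_on_disk h1) by now apply analytic_C_derive.
  assert (A2 : analytic_on_disk h2) by now apply analytic_C_derive.
  assert (A3 : analytic_on_disk h3) by now apply analytic_C_derive.
  (* The derivative of h''/h', written out because the mean value property asks for its
     continuity. *)
  set (p1 := fun z => ((h3 z * h1 z + - (h2 z * h2 z)) * / (h1 z * h1 z))%C).
  assert (Q : r * (2 * (r - alpha) / (1 - r ^ 2)) <= Re (RtoC 0 * (h2 (RtoC 0) / h1 (RtoC 0)))%C).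
  { apply (mean_value_le (fun z => z * (h2 z / h1 z))%C (fun z => h2 z / h1 z + z * p1 z)%C) with (r := r).
    - intros z Hz. eapply Cder_eq; [|apply Cder_mult; [apply Cder_id|apply Cder_div; [now apply NZ|now apply analytic_Cder|now apply analytic_Cder]]].
      cbv beta. unfold p1. fold h2 h3. field. now apply NZ.
    - intros z Hz.
      assert (K : forall k, analytic_on_disk k -> Ccont k z).
      { intros k Hk. eapply Cder_cont. now apply analytic_Cder. }
      assert (NZ2 : (h1 z * h1 z)%C <> RtoC 0) by (apply Cmult_neq_0; now apply NZ).
      unfold p1, Cdiv.
      apply Ccont_plus; [|apply Ccont_mult; [apply Ccont_id|]]; apply Ccont_mult; auto.
      + apply Ccont_inv; auto.
      + apply Ccont_plus; [|apply Ccont_opp]; apply Ccont_mult; auto.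
      + apply (Ccont_inv (fun z => h1 z * h1 z)%C); auto. apply Ccont_mult; auto.
    - lra.
    - intros z Hz. specialize (HB z ltac:(unfold unit_disk; lra)).
      set (p := (h2 z / h1 z)%C) in *. rewrite Hz in HB.
      assert (P : 0 < (1 - r ^ 2) / 2) by nra.
      assert (B' : Rabs (Re ((RtoC ((1 - r ^ 2) / 2) * p - Cconj z) * z)%C) <= alpha * r).
      { eapply Rle_trans; [apply re_le_Cmod|]. rewrite Cmod_mult, Hz. apply Rmult_le_compat_r; lra. }
      assert (E : Re ((RtoC ((1 - r ^ 2) / 2) * p - Cconj z) * z)%C
         = (1 - r ^ 2) / 2 * Re (z * p)%C - r * r).
      { replace (r * r) with (Re z ^ 2 + Im z ^ 2) by (rewrite <- Cmod2_alt, Hz; ring).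
        destruct p, z. unfold Re, Im, Cmult, Cminus, Cplus, Copp, Cconj, RtoC; simpl. field. }
      rewrite E in B'.
      assert (T := Rle_abs (- ((1 - r ^ 2) / 2 * Re (z * p)%C - r * r))). rewrite Rabs_Ropp in T.
      apply Rmult_le_reg_l with ((1 - r ^ 2) / 2); [lra|].
      replace ((1 - r ^ 2) / 2 * (r * (2 * (r - alpha) / (1 - r ^ 2)))) with (r * r - alpha * r)
        by (field; nra). lra. }
  rewrite Cmult_0_l in Q. change (Re (RtoC 0)) with 0 in Q.
  assert (0 < r * (2 * (r - alpha) / (1 - r ^ 2))); [|lra].
  apply Rmult_lt_0_compat; [lra|]. apply Rdiv_lt_0_compat; nra.
Qed.

(** The supremum over an empty family is [m_infty], so a finite order provides a member. *)
Lemma family_order_nonempty (L : (C -> C) -> Prop) (alpha : R) :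
  family_order L = Finite alpha -> exists f h g, L f /\ harmonic_parts f h g.
Proof.
  intros HO. apply NNPP. intros N. unfold family_order in HO.
  destruct (Lub_Rbar_correct (fun x : R => exists f h g : C -> C,
    L f /\ harmonic_parts f h g /\ x = Cmod (coef_a2 h))) as [_ Lub].
  rewrite HO in Lub. apply (Lub m_infty). intros x (f & h & g & Hf & Hp & _). apply N. eauto.
Qed.

Lemma LIF_order_ge_1 (L : (C -> C) -> Prop) (alpha : R) :
  LIF L -> family_order L = Finite alpha -> 1 <= alpha.
Proof.
  intros HL HO. destruct (family_order_nonempty L alpha HO) as (f & h & g & Hf & Hp).
  apply (order_ge_1_of_pre_schwarzian_bound alpha h).
  - apply Hp.
  - intros z Hz. apply (sense_preserving_neq_0 h g); auto. now apply (LIF_parts L f h g).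
  - intros a Ha. now apply (LIF_pre_schwarzian_bound L alpha f h g).
Qed.

(** * Local inversion of harmonic maps *)

(** The real differential of h + conj g at [z], applied to [p]. *)
Definition hdiff (h g : C -> C) (z p : C) : C :=
  (C_derive h z * p + Cconj (C_derive g z * p))%C.

Lemma hdiff_lower (h g : C -> C) (z p : C) :
  (Cmod (C_derive h z) - Cmod (C_derive g z)) * Cmod p <= Cmod (hdiff h g z p).
Proof.
  unfold hdiff.
  assert (T := Cmod_triangle_inv (C_derive h z * p)%C (- Cconj (C_derive g z * p))%C).
  replace (C_derive h z * p - - Cconj (C_derive g z * p))%C
    with (C_derive h z * p + Cconj (C_derive g z * p))%C in T by ring.
  rewrite Cmod_opp, Cmod_conj, !Cmod_mult in T. lra.
Qed.

(** Cramer's rule for q = h' p + conj (g' p) together with its conjugate; the denominator is the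
    Jacobian. *)
Definition hdiff_inv (h g : C -> C) (z q : C) : C :=
  ((Cconj (C_derive h z) * q - Cconj (C_derive g z) * Cconj q)
    / RtoC (Cmod (C_derive h z) ^ 2 - Cmod (C_derive g z) ^ 2))%C.

Lemma hdiff_inv_correct (h g : C -> C) (z q : C) :
  Cmod (C_derive g z) < Cmod (C_derive h z) -> hdiff h g z (hdiff_inv h g z q) = q.
Proof.
  intros H. assert (P := Cmod_ge_0 (C_derive g z)).
  set (J := Cmod (C_derive h z) ^ 2 - Cmod (C_derive g z) ^ 2).
  assert (NJ : RtoC J <> RtoC 0) by (intros E; apply RtoC_inj in E; unfold J in E; nra).
  assert (EJ : RtoC J = (C_derive h z * Cconj (C_derive h z) - C_derive g z * Cconj (C_derive g z))%C).
  { unfold J. rewrite RtoC_minus, <- !Cmod2_conj, !RtoC_pow. reflexivity. }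
  unfold hdiff, hdiff_inv. fold J.
  rewrite Cmult_conj, Cdiv_conj by exact NJ.
  rewrite Cminus_conj, !Cmult_conj, !Cconj_conj, Cconj_RtoC.
  transitivity (RtoC J * q / RtoC J)%C; [|field; exact NJ].
  rewrite EJ at 3. field. exact NJ.
Qed.

Lemma harmonic_quad_estimate (f h g : C -> C) (r : R) :
  harmonic_parts f h g -> 0 <= r < 1 ->
  exists M, 0 < M /\ forall u z, Cmod u <= r -> Cmod z <= r ->
    Cmod (f u - f z - hdiff h g z (u - z)) <= M * Cmod (u - z) ^ 2.
Proof.
  intros (Ah & Ag & _ & _ & Ef) Hr.
  destruct (proj2 (analytic_quad_estimate h Ah) r Hr) as [M1 [P1 K1]].
  destruct (proj2 (analytic_quad_estimate g Ag) r Hr) as [M2 [P2 K2]].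
  exists (M1 + M2 + 1). split; [lra|]. intros u z Hu Hz.
  specialize (K1 u z Hu Hz). specialize (K2 u z Hu Hz).
  rewrite !Ef by (unfold unit_disk; lra).
  replace (h u + Cconj (g u) - (h z + Cconj (g z)) - hdiff h g z (u - z))%C with
    ((h u - h z - C_derive h z * (u - z)) + Cconj (g u - g z - C_derive g z * (u - z)))%C
    by (unfold hdiff; rewrite !Cminus_conj; ring).
  eapply Rle_trans; [apply Cmod_triangle|]. rewrite Cmod_conj.
  assert (T := pow2_ge_0 (Cmod (u - z))). lra.
Qed.

Lemma harmonic_cont (f h g : C -> C) (z : C) :
  harmonic_parts f h g -> unit_disk z -> Ccont f z.
Proof.
  intros (Ah & Ag & _ & _ & Ef) Hz. destruct (unit_disk_nbhd z Hz) as [P Q].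
  apply Ccont_ext_loc with (fun u => h u + Cconj (g u))%C (1 - Cmod z); auto.
  - intros u Hu. symmetry. auto.
  - apply Ccont_plus; [|apply Ccont_conj]; eapply Cder_cont, analytic_Cder; auto.
Qed.

Section Local.
Context (f h g : C -> C) (Hp : harmonic_parts f h g) (K : C -> Prop) (m M : R)
  (m_pos : 0 < m) (M_pos : 0 < M) (K_disk : forall z, K z -> unit_disk z)
  (m_le : forall z, K z -> m <= Cmod (C_derive h z) - Cmod (C_derive g z))
  (f_quad : forall u z, K u -> K z ->
    Cmod (f u - f z - hdiff h g z (u - z)) <= M * Cmod (u - z) ^ 2).

(** The differential stretches by at least [m], and at distance at most m / (2 M) the quadratic
    error takes away no more than half of that. *)
Lemma local_expansion (u z : C) :
  K u -> K z -> Cmod (u - z) <= m / (2 * M) -> m / 2 * Cmod (u - z) <= Cmod (f u - f z).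
Proof.
  intros Hu Hz Hd. assert (Q := f_quad u z Hu Hz).
  assert (D := hdiff_lower h g z (u - z)). assert (L := m_le z Hz).
  assert (T := Cmod_triangle_inv (hdiff h g z (u - z)) (- (f u - f z - hdiff h g z (u - z)))%C).
  replace (hdiff h g z (u - z) - - (f u - f z - hdiff h g z (u - z)))%C with (f u - f z)%C in T by ring.
  rewrite Cmod_opp in T.
  assert (P := Cmod_ge_0 (u - z)).
  assert (H1 : Cmod (u - z) * (2 * M) <= m).
  { apply Rle_trans with (m / (2 * M) * (2 * M)); [apply Rmult_le_compat_r; lra|right; field; lra]. }
  nra.
Qed.

(* Newton iteration with the derivative refreshed at each step: the residual is
   at least halved each time, so no Lipschitz bound on the derivative is used. *)
Lemma local_surjection (z w : C) :
  (forall u, Cmod (u - z) <= 2 / m * Cmod (w - f z) -> K u) ->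
  Cmod (w - f z) <= m ^ 2 / (2 * M) ->
  exists u, f u = w /\ Cmod (u - z) <= 2 / m * Cmod (w - f z).
Proof.
  intros HK Hw.
  set (rho := Cmod (w - f z)) in *. assert (Pr : 0 <= rho) by apply Cmod_ge_0.
  set (u := nat_rect (fun _ => C) z (fun _ v => v + hdiff_inv h g v (w - f v))%C).
  assert (uS : forall n, u (S n) = (u n + hdiff_inv h g (u n) (w - f (u n)))%C) by reflexivity.
  (* A Newton step is at most the residual over [m], and residuals halve; the steps sum to 2 rho /
     m, the radius in the statement. *)
  set (b := fun n => rho / m * (/ 2) ^ n).
  assert (Pm : 0 < 2 / m) by (apply Rdiv_lt_0_compat; lra).
  assert (Hrm : 0 <= rho / m) by (apply Rmult_le_pos; [auto|left; now apply Rinv_0_lt_compat]).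
  assert (P2 : forall n, 0 < (/ 2) ^ n) by (intros n; apply pow_lt; lra).
  assert (Step : forall n, K (u n) -> Cmod (w - f (u n)) <= rho * (/ 2) ^ n ->
     Cmod (u (S n) - u n) <= b n).
  { intros n Kn Hn.
    assert (L := m_le _ Kn).
    assert (E := hdiff_inv_correct h g (u n) (w - f (u n)) ltac:(lra)).
    assert (D := hdiff_lower h g (u n) (hdiff_inv h g (u n) (w - f (u n)))).
    rewrite E in D. rewrite uS.
    replace (u n + hdiff_inv h g (u n) (w - f (u n)) - u n)%C
      with (hdiff_inv h g (u n) (w - f (u n))) by ring.
    set (p := Cmod (hdiff_inv h g (u n) (w - f (u n)))) in *.
    assert (Pp : 0 <= p) by apply Cmod_ge_0.
    apply Rmult_le_reg_l with m; auto. unfold b.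
    replace (m * (rho / m * (/ 2) ^ n)) with (rho * (/ 2) ^ n) by (field; lra). nra. }
  assert (Inv : forall n, Cmod (w - f (u n)) <= rho * (/ 2) ^ n /\
     Cmod (u n - z) <= 2 / m * rho * (1 - (/ 2) ^ n)).
  { induction n as [|n [IH1 IH2]].
    - simpl. split; [fold rho; lra|].
      replace (z - z)%C with (RtoC 0) by ring. rewrite Cmod_0. lra.
    - assert (Kn : K (u n)).
      { apply HK. eapply Rle_trans; [exact IH2|]. rewrite <- Rmult_1_r.
        apply Rmult_le_compat_l; [|specialize (P2 n); lra]. apply Rmult_le_pos; lra. }
      assert (St := Step n Kn IH1).
      assert (D : Cmod (u (S n) - z) <= 2 / m * rho * (1 - (/ 2) ^ S n)).
      { eapply Rle_trans; [apply (Cmod_dist_triangle _ (u n))|].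
        eapply Rle_trans; [apply Rplus_le_compat; [exact St|exact IH2]|].
        right. unfold b. simpl. field. lra. }
      split; auto.
      assert (KS : K (u (S n))).
      { apply HK. eapply Rle_trans; [exact D|]. rewrite <- Rmult_1_r.
        apply Rmult_le_compat_l; [|specialize (P2 (S n)); lra]. apply Rmult_le_pos; lra. }
      assert (Q := f_quad _ _ KS Kn).
      assert (L := m_le _ Kn).
      replace (hdiff h g (u n) (u (S n) - u n)) with (w - f (u n))%C in Q.
      2: { rewrite uS. replace (u n + hdiff_inv h g (u n) (w - f (u n)) - u n)%C
             with (hdiff_inv h g (u n) (w - f (u n))) by ring.
           symmetry. apply hdiff_inv_correct. lra. }
      replace (f (u (S n)) - f (u n) - (w - f (u n)))%C with (- (w - f (u (S n))))%C in Q by ring.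
      rewrite Cmod_opp in Q. eapply Rle_trans; [exact Q|].
      assert (B1 : Cmod (u (S n) - u n) ^ 2 <= b n ^ 2)
        by (apply pow_incr; split; [apply Cmod_ge_0|exact St]).
      apply Rle_trans with (M * b n ^ 2); [apply Rmult_le_compat_l; lra|].
      unfold b. change ((/ 2) ^ S n) with (/ 2 * (/ 2) ^ n).
      assert (H1 : rho * (2 * M) <= m ^ 2).
      { apply Rle_trans with (m ^ 2 / (2 * M) * (2 * M)); [apply Rmult_le_compat_r; lra|right; field; lra]. }
      assert (H2 : (/ 2) ^ n <= 1).
      { rewrite <- (pow1 n). apply pow_incr. lra. }
      set (t := (/ 2) ^ n) in *. assert (Pt : 0 < t) by apply P2.
      (* The smallness of the initial residual makes the first factor at most 1, and t <= 1; what
         remains is half of the previous residual bound. *)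
      replace (M * (rho / m * t) ^ 2) with (rho * (2 * M) / m ^ 2 * (rho * (/ 2 * t) * t)) by (field; lra).
      assert (H3 : rho * (2 * M) / m ^ 2 <= 1).
      { apply Rmult_le_reg_r with (m ^ 2); [nra|]. unfold Rdiv. rewrite Rmult_assoc, Rinv_l by nra. lra. }
      assert (H4 : 0 <= rho * (/ 2 * t)) by (apply Rmult_le_pos; lra).
      assert (H5 : 0 <= rho * (2 * M) / m ^ 2).
      { apply Rmult_le_pos; [nra|]. left. apply Rinv_0_lt_compat. nra. }
      assert (H6 : rho * (/ 2 * t) * t <= rho * (/ 2 * t)) by nra.
      apply Rle_trans with (1 * (rho * (/ 2 * t))).
      + apply Rmult_le_compat; auto. apply Rmult_le_pos; lra.
      + rewrite Rmult_1_l. apply Rle_refl. }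
  assert (KU : forall n, K (u n)).
  { intros n. destruct (Inv n) as [_ I2]. apply HK. eapply Rle_trans; [exact I2|].
    rewrite <- Rmult_1_r. apply Rmult_le_compat_l; [|specialize (P2 n); lra]. apply Rmult_le_pos; lra. }
  assert (Sb : is_series b (2 / m * rho)).
  { replace (2 / m * rho) with (rho / m * (/ (1 - / 2))) by (field; lra).
    apply (is_series_scal_l (K := R_AbsRing) (V := R_NormedModule)).
    apply is_series_geom. rewrite Rabs_pos_eq; lra. }
  assert (Bx : forall n, Cmod (u (S n) - u n) <= b n) by (intros n; apply Step; [apply KU|apply Inv]).
  (* The limit of the iteration is obtained as the sum of its increments, which also bounds its
     distance from [z]. *)
  destruct (Cseries_ex (fun n => u (S n) - u n)%C) as [l Hl].
  { apply (@ex_series_le R_AbsRing R_CompleteNormedModule) with b; [|now eexists; exact Sb].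
    intros n. change (Rabs (Cmod (u (S n) - u n)) <= b n). rewrite Rabs_pos_eq; [apply Bx|apply Cmod_ge_0]. }
  assert (Ml : Cmod l <= 2 / m * rho).
  { rewrite <- (is_series_unique _ _ Sb). apply (Cseries_bound _ _ _ Hl Bx). now eexists; exact Sb. }
  assert (Tel : forall n, Csum (fun n => u (S n) - u n)%C n = (u (S n) - z)%C).
  { induction n; [rewrite sum_O; reflexivity|]. rewrite sum_Sn, IHn.
    change ((u (S n) - z) + (u (S (S n)) - u (S n)) = u (S (S n)) - z)%C. ring. }
  exists (z + l)%C.
  assert (Ez : (z + l - z)%C = l) by ring.
  split; [|rewrite Ez; exact Ml].
  apply Cmod_diff_0. apply Rle_antisym; [|apply Cmod_ge_0]. apply le_epsilon. intros e He.
  assert (Kl : K (z + l)%C) by (apply HK; rewrite Ez; exact Ml).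
  destruct (harmonic_cont f h g (z + l)%C Hp (K_disk _ Kl) (e / 2)) as [d [Hd Hc]]; [lra|].
  rewrite Cseries_iff in Hl. destruct (Hl d Hd) as [N1 HN1].
  assert (Lim : exists N2, forall n, (N2 <= n)%nat -> rho * (/ 2) ^ n < e / 2).
  { destruct (pow_lt_1_zero (/ 2) ltac:(rewrite Rabs_pos_eq; lra) (e / 2 / (rho + 1))) as [N2 HN2].
    { apply Rdiv_lt_0_compat; lra. }
    exists N2. intros n Hn. specialize (HN2 n Hn). rewrite Rabs_pos_eq in HN2 by (left; apply P2).
    assert (T : (/ 2) ^ n * (rho + 1) < e / 2).
    { apply Rlt_le_trans with (e / 2 / (rho + 1) * (rho + 1)); [apply Rmult_lt_compat_r; lra|right; field; lra]. }
    specialize (P2 n). nra. }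
  destruct Lim as [N2 HN2].
  set (n := max N1 N2).
  specialize (HN1 n ltac:(unfold n; lia)). rewrite Tel in HN1.
  replace (u (S n) - z - l)%C with (u (S n) - (z + l))%C in HN1 by ring.
  specialize (Hc _ HN1). specialize (HN2 (S n) ltac:(unfold n; lia)).
  destruct (Inv (S n)) as [I1 _].
  rewrite Rplus_0_l. eapply Rle_trans; [apply (Cmod_dist_triangle _ (f (u (S n))))|].
  rewrite (Cmod_minus_sym (f (z + l)%C)), (Cmod_minus_sym _ w). lra.
Qed.
End Local.

Lemma local_data (f h g : C -> C) (z0 : C) :
  harmonic_parts f h g -> sense_preserving h g -> unit_disk z0 ->
  exists r m M, 0 < r /\ 0 < m /\ 0 < M /\
    (forall z, Cmod (z - z0) <= r -> unit_disk z) /\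
    (forall z, Cmod (z - z0) <= r -> m <= Cmod (C_derive h z) - Cmod (C_derive g z)) /\
    (forall u z, Cmod (u - z0) <= r -> Cmod (z - z0) <= r ->
      Cmod (f u - f z - hdiff h g z (u - z)) <= M * Cmod (u - z) ^ 2).
Proof.
  intros Hp SP Hz. assert (L := sense_preserving_lt h g z0 SP Hz).
  destruct (Hp) as (Ah & Ag & _).
  (* A third of the gap at [z0]: near [z0] both h' and g' move by less than [m], which leaves at
     least [m]. *)
  set (m := (Cmod (C_derive h z0) - Cmod (C_derive g z0)) / 3).
  assert (Pm : 0 < m) by (unfold m; lra).
  assert (C1 := Cder_cont _ _ _ (analytic_Cder _ z0 (analytic_C_derive h Ah) Hz)).
  assert (C2 := Cder_cont _ _ _ (analytic_Cder _ z0 (analytic_C_derive g Ag) Hz)).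
  destruct (C1 m Pm) as [d1 [Hd1 K1]]. destruct (C2 m Pm) as [d2 [Hd2 K2]].
  unfold unit_disk in Hz. assert (Pz := Cmod_ge_0 z0).
  set (r := Rmin ((1 - Cmod z0) / 2) (Rmin (d1 / 2) (d2 / 2))).
  assert (Pr : 0 < r) by (repeat apply Rmin_glb_lt; lra).
  assert (r1 : r <= (1 - Cmod z0) / 2) by apply Rmin_l.
  assert (r2 : r <= d1 / 2) by (eapply Rle_trans; [apply Rmin_r|apply Rmin_l]).
  assert (r3 : r <= d2 / 2) by (eapply Rle_trans; [apply Rmin_r|apply Rmin_r]).
  destruct (harmonic_quad_estimate f h g ((1 + Cmod z0) / 2) Hp ltac:(lra)) as [M [PM KM]].
  assert (D : forall z, Cmod (z - z0) <= r -> Cmod z <= (1 + Cmod z0) / 2).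
  { intros z H. assert (T := Cmod_triangle_inv z z0). lra. }
  exists r, m, M. repeat split; auto.
  - intros z H. specialize (D z H). unfold unit_disk. lra.
  - intros z H. specialize (K1 z ltac:(lra)). specialize (K2 z ltac:(lra)).
    assert (T1 := Cmod_triangle_inv (C_derive h z0) (C_derive h z)).
    assert (T2 := Cmod_triangle_inv (C_derive g z) (C_derive g z0)).
    rewrite Cmod_minus_sym in K1. unfold m in *. lra.
Qed.

Lemma harmonic_local_injectivity (f h g : C -> C) (z0 : C) :
  harmonic_parts f h g -> sense_preserving h g -> unit_disk z0 ->
  exists delta, 0 < delta /\ forall u v, Cmod (u - z0) < delta -> Cmod (v - z0) < delta ->
    f u = f v -> u = v.
Proof.
  intros Hp SP Hz. destruct (local_data f h g z0 Hp SP Hz) as (r & m & M & Pr & Pm & PM & _ & Lm & Q).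
  (* Two points this close to [z0] are within m / (2 M) of each other, the range of
     [local_expansion]. *)
  exists (Rmin r (m / (4 * M))). split.
  { apply Rmin_glb_lt; auto. apply Rdiv_lt_0_compat; lra. }
  intros u v Hu Hv E.
  assert (A := Rmin_l r (m / (4 * M))). assert (B := Rmin_r r (m / (4 * M))).
  apply Cmod_diff_0.
  assert (T := Cmod_dist_triangle u z0 v). rewrite (Cmod_minus_sym z0 v) in T.
  assert (X := local_expansion f h g (fun z => Cmod (z - z0) <= r) m M PM Lm Q u v ltac:(lra) ltac:(lra)).
  replace (m / (2 * M)) with (2 * (m / (4 * M))) in X by (field; lra).
  specialize (X ltac:(lra)). rewrite E in X.
  replace (f v - f v)%C with (RtoC 0) in X by ring. rewrite Cmod_0 in X.
  assert (P := Cmod_ge_0 (u - v)). nra.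
Qed.

Lemma harmonic_local_surjectivity (f h g : C -> C) (z0 : C) (eps : R) :
  harmonic_parts f h g -> sense_preserving h g -> unit_disk z0 -> 0 < eps ->
  exists eta, 0 < eta /\ forall w, Cmod (w - f z0) < eta ->
    exists u, f u = w /\ Cmod (u - z0) < eps.
Proof.
  intros Hp SP Hz He.
  destruct (local_data f h g z0 Hp SP Hz) as (r & m & M & Pr & Pm & PM & Dk & Lm & Q).
  (* In order: convergence of the iteration, iterates inside the good neighbourhood, solution within
     [eps] of [z0]. *)
  exists (Rmin (m ^ 2 / (2 * M)) (Rmin (m * r / 2) (m * eps / 2))). split.
  { repeat apply Rmin_glb_lt; try nra. apply Rdiv_lt_0_compat; nra. }
  intros w Hw.
  assert (H1 : Cmod (w - f z0) < m ^ 2 / (2 * M)) by (eapply Rlt_le_trans; [exact Hw|apply Rmin_l]).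
  assert (H2 : Cmod (w - f z0) < m * r / 2)
    by (eapply Rlt_le_trans; [exact Hw|eapply Rle_trans; [apply Rmin_r|apply Rmin_l]]).
  assert (H3 : Cmod (w - f z0) < m * eps / 2)
    by (eapply Rlt_le_trans; [exact Hw|eapply Rle_trans; [apply Rmin_r|apply Rmin_r]]).
  assert (F : forall x, Cmod (w - f z0) < m * x / 2 -> 2 / m * Cmod (w - f z0) < x).
  { intros x Hx. apply Rmult_lt_reg_l with (m / 2); [lra|].
    replace (m / 2 * (2 / m * Cmod (w - f z0))) with (Cmod (w - f z0)) by (field; lra). lra. }
  destruct (local_surjection f h g Hp (fun z => Cmod (z - z0) <= r) m M Pm PM Dk Lm Q z0 w)
    as [u [E D]].
  - intros u Hu. specialize (F r H2). lra.
  - lra.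
  - exists u. split; auto. specialize (F eps H3). lra.
Qed.

(** * Lifting disks *)

(* The primitive of [c * stretch_minorant alpha] vanishing at 0; it tends to
   [c / (2 alpha)] as [r] tends to 1. *)
Definition stretch_primitive (alpha c r : R) : R :=
  c / (2 * alpha) * (1 - exp (alpha * (ln (1 - r) - ln (1 + r)))).

Lemma stretch_minorant_pos (alpha r : R) : 0 < stretch_minorant alpha r.
Proof. apply exp_pos. Qed.

Lemma stretch_minorant_decreasing (alpha r s : R) :
  1 <= alpha -> 0 <= r <= s -> s < 1 -> stretch_minorant alpha s <= stretch_minorant alpha r.
Proof.
  intros Ha Hr Hs. unfold stretch_minorant. destruct (Req_dec r s) as [->|N]; [lra|].
  left. apply exp_increasing.
  assert (L1 : ln (1 - s) < ln (1 - r)) by (apply ln_increasing; lra).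
  assert (L2 : ln (1 + r) < ln (1 + s)) by (apply ln_increasing; lra). nra.
Qed.

Lemma stretch_primitive_derive (alpha c r : R) : 0 < alpha -> -1 < r < 1 ->
  is_derive (stretch_primitive alpha c) r (c * stretch_minorant alpha r).
Proof.
  intros Ha Hr. unfold stretch_primitive. auto_derive; [repeat split; lra|].
  unfold stretch_minorant. replace (1 + - r) with (1 - r) by ring.
  replace (ln (1 - r) + - ln (1 + r)) with (ln (1 - r) - ln (1 + r)) by ring.
  replace ((alpha - 1) * ln (1 - r) - (alpha + 1) * ln (1 + r))
    with (alpha * (ln (1 - r) - ln (1 + r)) + (- ln (1 - r) + - ln (1 + r))) by ring.
  rewrite !exp_plus, !exp_Ropp, !exp_ln by lra. field. repeat split; lra.
Qed.

Lemma stretch_primitive_increasing (alpha c r s : R) : 0 < alpha -> 0 <= c -> 0 <= r <= s -> s < 1 ->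
  stretch_primitive alpha c r <= stretch_primitive alpha c s.
Proof.
  intros Ha Hc Hr Hs.
  apply (nondecreasing_of_derive (stretch_primitive alpha c) (fun t => c * stretch_minorant alpha t)); [lra| |].
  - intros t Ht. apply stretch_primitive_derive; lra.
  - intros t Ht. assert (P := stretch_minorant_pos alpha t). nra.
Qed.

(** Concavity: the derivative decreases, so the tangent at [r] lies above. A move inward costs
    nothing, hence the maximum with 0. *)
Lemma stretch_primitive_step (alpha c r s : R) : 1 <= alpha -> 0 <= c -> 0 <= r < 1 -> 0 <= s < 1 ->
  stretch_primitive alpha c s <= stretch_primitive alpha c r + c * stretch_minorant alpha r * Rmax 0 (s - r).
Proof.
  intros Ha Hc Hr Hs. destruct (Rle_lt_dec s r) as [L|L].
  - assert (M := stretch_primitive_increasing alpha c s r ltac:(lra) Hc ltac:(lra) ltac:(lra)).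
    rewrite Rmax_left by lra. lra.
  - rewrite Rmax_right by lra.
    destruct (MVT_gen (stretch_primitive alpha c) r s (fun t => c * stretch_minorant alpha t)) as [t [Ht E]].
    + intros x Hx. rewrite Rmin_left, Rmax_right in Hx by lra. apply stretch_primitive_derive; lra.
    + intros x Hx. rewrite Rmin_left, Rmax_right in Hx by lra.
      apply continuity_pt_filterlim.
      apply (ex_derive_continuous (K := R_AbsRing) (V := R_NormedModule) (stretch_primitive alpha c) x).
      eexists. apply stretch_primitive_derive; lra.
    + rewrite Rmin_left, Rmax_right in Ht by lra.
      assert (B := stretch_minorant_decreasing alpha r t Ha ltac:(lra) ltac:(lra)).
      assert (c * stretch_minorant alpha t <= c * stretch_minorant alpha r) by (apply Rmult_le_compat_l; lra). nra.
Qed.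

Lemma stretch_primitive_0 (alpha c : R) : stretch_primitive alpha c 0 = 0.
Proof. unfold stretch_primitive. rewrite Rminus_0_r, Rplus_0_r, ln_1, Rminus_0_r, Rmult_0_r, exp_0. ring. Qed.

(** For alpha >= 1 one has ((1 - r)/(1 + r))^alpha <= 1 - r. The linear bound yields explicit radii
    close to 1 where the primitive is close to its limit. *)
Lemma stretch_primitive_lower (alpha c r : R) : 1 <= alpha -> 0 <= c -> 0 <= r < 1 ->
  c / (2 * alpha) * r <= stretch_primitive alpha c r.
Proof.
  intros Ha Hc Hr. unfold stretch_primitive.
  apply Rmult_le_compat_l.
  - apply Rmult_le_pos; auto. left. apply Rinv_0_lt_compat. lra.
  - assert (L1 : ln (1 - r) <= 0) by (rewrite <- ln_1; apply ln_le; lra).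
    assert (L2 : 0 <= ln (1 + r)) by (rewrite <- ln_1; apply ln_le; lra).
    assert (L3 : alpha * (ln (1 - r) - ln (1 + r)) <= ln (1 - r)) by nra.
    assert (exp (alpha * (ln (1 - r) - ln (1 + r))) <= 1 - r); [|lra].
    rewrite <- (exp_ln (1 - r)) at 2 by lra.
    destruct (Rle_lt_or_eq_dec _ _ L3) as [T|T]; [left; now apply exp_increasing|right; now rewrite T].
Qed.

Section Lift.
Context (f h g : C -> C) (Hp : harmonic_parts f h g) (alpha c : R) (Ha : 1 <= alpha) (Hc : 0 < c)
  (stretch : forall z, unit_disk z -> c * stretch_minorant alpha (Cmod z) <= Cmod (C_derive h z) - Cmod (C_derive g z)).

(** The gauge increases by at most the stretching at [z] times |u - z|, and this is at most |w - f
    z| up to the quadratic error. The margin R1 - R0 leaves room for the Newton iteration. *)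
Lemma lift_step (R0 R1 m M : R) :
  0 <= R0 < R1 -> R1 < 1 -> m = c * stretch_minorant alpha R1 -> 0 < M ->
  (forall u z, Cmod u <= R1 -> Cmod z <= R1 ->
    Cmod (f u - f z - hdiff h g z (u - z)) <= M * Cmod (u - z) ^ 2) ->
  forall z w, Cmod z <= R0 -> Cmod (w - f z) <= m ^ 2 / (2 * M) ->
    2 / m * Cmod (w - f z) <= R1 - R0 ->
    exists u, f u = w /\ Cmod (u - z) <= 2 / m * Cmod (w - f z) /\ Cmod u <= R1 /\
      stretch_primitive alpha c (Cmod u) <= stretch_primitive alpha c (Cmod z) + Cmod (w - f z) + M * (2 / m * Cmod (w - f z)) ^ 2.
Proof.
  intros H01 H1 Em HM Q z w Hz Hw1 Hw2.
  assert (Pm : 0 < m) by (rewrite Em; apply Rmult_lt_0_compat; auto; apply stretch_minorant_pos).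
  assert (Near : forall u, Cmod (u - z) <= 2 / m * Cmod (w - f z) -> Cmod u <= R1).
  { intros u Hu. assert (T := Cmod_triangle_inv u z). lra. }
  destruct (local_surjection f h g Hp (fun u => Cmod u <= R1) m M Pm HM) with (z := z) (w := w)
    as [u [E D]]; auto.
  - intros v Hv. unfold unit_disk. lra.
  - intros v Hv. eapply Rle_trans; [|apply stretch; unfold unit_disk; lra]. rewrite Em.
    apply Rmult_le_compat_l; [lra|]. apply stretch_minorant_decreasing; auto.
    split; [apply Cmod_ge_0|auto].
  - exists u. assert (Nu := Near u D). repeat split; auto.
    assert (Zd : unit_disk z) by (unfold unit_disk; lra).
    assert (S := stretch_primitive_step alpha c (Cmod z) (Cmod u) Ha ltac:(lra)
      ltac:(split; [apply Cmod_ge_0|lra]) ltac:(split; [apply Cmod_ge_0|lra])).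
    eapply Rle_trans; [exact S|].
    assert (Qu := Q u z Nu ltac:(lra)). rewrite E in Qu.
    assert (DL := hdiff_lower h g z (u - z)). assert (St := stretch z Zd).
    assert (T := Cmod_triangle_inv (hdiff h g z (u - z)) (- (w - f z - hdiff h g z (u - z)))%C).
    replace (hdiff h g z (u - z) - - (w - f z - hdiff h g z (u - z)))%C with (w - f z)%C in T by ring.
    rewrite Cmod_opp in T.
    assert (Pd := Cmod_ge_0 (u - z)).
    assert (T2 : Rmax 0 (Cmod u - Cmod z) <= Cmod (u - z)).
    { apply Rmax_lub; auto. apply Cmod_triangle_inv. }
    assert (PB : 0 < c * stretch_minorant alpha (Cmod z)) by (apply Rmult_lt_0_compat; auto; apply stretch_minorant_pos).
    assert (T3 : c * stretch_minorant alpha (Cmod z) * Rmax 0 (Cmod u - Cmod z)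
      <= (Cmod (C_derive h z) - Cmod (C_derive g z)) * Cmod (u - z)).
    { apply Rmult_le_compat; try lra. apply Rmax_l. }
    assert (T4 : M * Cmod (u - z) ^ 2 <= M * (2 / m * Cmod (w - f z)) ^ 2).
    { apply Rmult_le_compat_l; [lra|]. apply pow_incr. auto. }
    lra.
Qed.

(** After k of N steps, [sec] sends w to a lift of (k/N) w. The gauge confines the lifts to |z| <=
    R0, and the Lipschitz bound makes them a coherent branch; at k = N, [sec] is a right inverse of
    f whose range is the open set sought. *)
Lemma univalent_disk_lift (rho : R) :
  0 < rho < c / (2 * alpha) -> univalent_disk f (RtoC 0) rho.
Proof.
  intros Hrho.
  assert (f0 : f (RtoC 0) = RtoC 0).
  { destruct Hp as (_ & _ & h0 & g0 & Ef). rewrite (Ef _ unit_disk_0), h0, g0.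
    rewrite Cconj_RtoC. ring. }
  set (q := rho / (c / (2 * alpha))).
  assert (Pc : 0 < c / (2 * alpha)) by lra.
  assert (Hq : 0 < q < 1).
  { unfold q. split; [apply Rdiv_lt_0_compat; lra|].
    apply Rmult_lt_reg_r with (c / (2 * alpha)); auto. unfold Rdiv at 1.
    rewrite Rmult_assoc, Rinv_l by lra. lra. }
  (* R0 > q makes the gauge at R0 exceed [rho], so lifts cannot leave |z| <= R0; between R0 and R1
     there is room for one more step. *)
  set (R0 := (1 + q) / 2). set (R1 := (1 + R0) / 2).
  assert (H0 : q < R0 < 1) by (unfold R0; lra).
  assert (H1 : R0 < R1 < 1) by (unfold R1; lra).
  (* The budget for the second-order errors of all steps together. *)
  set (gap := stretch_primitive alpha c R0 - rho).
  assert (Pgap : 0 < gap).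
  { unfold gap. assert (T := stretch_primitive_lower alpha c R0 Ha ltac:(lra) ltac:(lra)).
    assert (c / (2 * alpha) * q < c / (2 * alpha) * R0) by (apply Rmult_lt_compat_l; lra).
    replace (c / (2 * alpha) * q) with rho in H by (unfold q; field; lra). lra. }
  destruct (harmonic_quad_estimate f h g R1 Hp ltac:(lra)) as [M [PM Q]].
  set (m := c * stretch_minorant alpha R1).
  assert (Pm : 0 < m) by (apply Rmult_lt_0_compat; auto; apply stretch_minorant_pos).
  assert (P2m : 0 < 2 / m) by (apply Rdiv_lt_0_compat; lra).
  set (delta := m / (2 * M)). assert (Pdelta : 0 < delta) by (apply Rdiv_lt_0_compat; lra).
  (* [s] is the step length of the lift: small enough for [lift_step] and for the
     accumulated second-order errors to stay below [gap]. *)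
  set (s0 := Rmin (m ^ 2 / (2 * M)) (Rmin (m / 2 * (R1 - R0)) (Rmin (m / 2 * (delta / 4)) (gap / (rho * M * (2 / m) ^ 2))))).
  assert (PE : 0 < rho * M * (2 / m) ^ 2).
  { apply Rmult_lt_0_compat; [nra|]. apply pow_lt. lra. }
  assert (Ps0 : 0 < s0).
  { repeat apply Rmin_glb_lt; try (apply Rmult_lt_0_compat; lra).
    - apply Rdiv_lt_0_compat; nra.
    - apply Rdiv_lt_0_compat; lra. }
  destruct (archimed_cor1 (s0 / rho)) as [N [HN NN]]; [apply Rdiv_lt_0_compat; lra|].
  assert (PN : 0 < INR N) by (apply lt_0_INR; lia).
  set (s := rho / INR N).
  assert (Ps : 0 < s) by (apply Rdiv_lt_0_compat; lra).
  assert (Hs : s <= s0).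
  { unfold s. apply Rmult_lt_compat_r with (r := rho) in HN; [|lra].
    replace (s0 / rho * rho) with s0 in HN by (field; lra). unfold Rdiv. lra. }
  assert (S1 : s <= m ^ 2 / (2 * M)) by (eapply Rle_trans; [exact Hs|apply Rmin_l]).
  assert (S2 : s <= m / 2 * (R1 - R0))
    by (eapply Rle_trans; [exact Hs|eapply Rle_trans; [apply Rmin_r|apply Rmin_l]]).
  assert (S3 : s <= m / 2 * (delta / 4))
    by (eapply Rle_trans; [exact Hs|eapply Rle_trans; [apply Rmin_r|eapply Rle_trans; [apply Rmin_r|apply Rmin_l]]]).
  assert (S4 : s <= gap / (rho * M * (2 / m) ^ 2))
    by (eapply Rle_trans; [exact Hs|eapply Rle_trans; [apply Rmin_r|eapply Rle_trans; [apply Rmin_r|apply Rmin_r]]]).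
  assert (Half : forall x y, x <= m / 2 * y -> 2 / m * x <= y).
  { intros x y Hxy. apply Rmult_le_reg_l with (m / 2); [lra|].
    replace (m / 2 * (2 / m * x)) with x by (field; lra). lra. }
  apply Half in S2. apply Half in S3.
  (* Upper bound for the second-order error of one step. It is quadratic in [s], so N of them total
     O(s). *)
  set (E := M * (2 / m * s) ^ 2).
  assert (PEE : 0 <= E) by (unfold E; apply Rmult_le_pos; [lra|apply pow2_ge_0]).
  assert (EN : INR N * E <= gap).
  { apply Rmult_le_compat_r with (r := rho * M * (2 / m) ^ 2) in S4; [|lra].
    replace (gap / (rho * M * (2 / m) ^ 2) * (rho * M * (2 / m) ^ 2)) with gap in S4.
    2: { field. split; [lra|]. split; lra. }
    eapply Rle_trans; [right|exact S4]. unfold E. unfold s at 1. unfold s. field. split; lra. }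
  (* Points of the target within [tau] have previous lifts within delta / 2. Two new steps of length
     at most delta / 4 keep the new lifts within [delta], the range where f expands. *)
  set (tau := m / 2 * (delta / 2)).
  assert (Ptau : 0 < tau) by (apply Rmult_lt_0_compat; lra).
  assert (Htau : 2 / m * tau = delta / 2) by (unfold tau; field; lra).
  assert (Exp : forall u v, Cmod u <= R1 -> Cmod v <= R1 -> Cmod (u - v) <= delta ->
     Cmod (u - v) <= 2 / m * Cmod (f u - f v)).
  { intros u v Hu Hv Huv.
    assert (X := local_expansion f h g (fun z => Cmod z <= R1) m M PM).
    assert (Y : m / 2 * Cmod (u - v) <= Cmod (f u - f v)).
    { apply X; auto. intros z Hz. eapply Rle_trans; [|apply stretch; unfold unit_disk; lra].
      unfold m. apply Rmult_le_compat_l; [lra|]. apply stretch_minorant_decreasing; auto; [|lra].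
      split; [apply Cmod_ge_0|auto]. }
    apply Rmult_le_reg_l with (m / 2); [lra|].
    replace (m / 2 * (2 / m * Cmod (f u - f v))) with (Cmod (f u - f v)) by (field; lra). lra. }
  assert (Lift : forall k, (k <= N)%nat -> exists sec : C -> C,
    sec (RtoC 0) = RtoC 0 /\
    (forall w, Cmod w < rho ->
      f (sec w) = (RtoC (INR k / INR N) * w)%C /\ Cmod (sec w) <= R0 /\
      stretch_primitive alpha c (Cmod (sec w)) <= INR k * (Cmod w / INR N + E)) /\
    (forall w w', Cmod w < rho -> Cmod w' < rho -> Cmod (w - w') <= tau ->
      Cmod (sec w - sec w') <= 2 / m * Cmod (w - w'))).
  { induction k as [|k IH].
    - intros _. exists (fun _ => RtoC 0). split; [auto|]. split.
      + intros w Hw. rewrite f0, Cmod_0, stretch_primitive_0. simpl. split; [|split; lra].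
        unfold Rdiv. rewrite Rmult_0_l. ring.
      + intros w w' _ _ _. replace (RtoC 0 - RtoC 0)%C with (RtoC 0) by ring. rewrite Cmod_0.
        apply Rmult_le_pos; [lra|apply Cmod_ge_0].
    - intros Hk. destruct IH as (sec & sec0 & Hsec & Hlip); [lia|].
      assert (Inc : forall w, Cmod w < rho ->
        Cmod (RtoC (INR (S k) / INR N) * w - f (sec w)) = Cmod w / INR N).
      { intros w Hw. destruct (Hsec w Hw) as [-> _].
        replace (RtoC (INR (S k) / INR N) * w - RtoC (INR k / INR N) * w)%C
          with (RtoC (/ INR N) * w)%C.
        - rewrite Cmod_mult, Cmod_R, Rabs_pos_eq; [unfold Rdiv; ring|].
          left. now apply Rinv_0_lt_compat.
        - rewrite S_INR. replace ((INR k + 1) / INR N) with (INR k / INR N + / INR N) by (field; lra).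
          rewrite RtoC_plus. ring. }
      assert (Ws : forall w, Cmod w < rho -> 0 <= Cmod w / INR N <= s).
      { intros w Hw. split.
        - apply Rmult_le_pos; [apply Cmod_ge_0|left; now apply Rinv_0_lt_compat].
        - unfold s. apply Rmult_le_compat_r; [left; now apply Rinv_0_lt_compat|lra]. }
      (* The bound on [w] is put under the existential so that choice yields a total function. *)
      assert (Ex : forall w, exists u, Cmod w < rho ->
        f u = (RtoC (INR (S k) / INR N) * w)%C /\ Cmod (u - sec w) <= 2 / m * (Cmod w / INR N) /\
        Cmod u <= R1 /\
        stretch_primitive alpha c (Cmod u) <= stretch_primitive alpha c (Cmod (sec w)) + Cmod w / INR N
           + M * (2 / m * (Cmod w / INR N)) ^ 2).
      { intros w. destruct (Rlt_le_dec (Cmod w) rho) as [Hw|Hw]; [|exists (RtoC 0); lra].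
        destruct (lift_step R0 R1 m M ltac:(lra) ltac:(lra) eq_refl PM Q (sec w)
           (RtoC (INR (S k) / INR N) * w)%C) as [u Hu].
        - now apply Hsec.
        - rewrite (Inc w Hw). specialize (Ws w Hw). lra.
        - rewrite (Inc w Hw). eapply Rle_trans; [|exact S2]. apply Rmult_le_compat_l; [lra|].
          now apply Ws.
        - exists u. rewrite (Inc w Hw) in Hu. auto. }
      set (sec' := fun w => proj1_sig (constructive_indefinite_description _ (Ex w))).
      assert (Hsec' : forall w, Cmod w < rho ->
        f (sec' w) = (RtoC (INR (S k) / INR N) * w)%C /\
        Cmod (sec' w - sec w) <= 2 / m * (Cmod w / INR N) /\ Cmod (sec' w) <= R1 /\
        stretch_primitive alpha c (Cmod (sec' w)) <= stretch_primitive alpha c (Cmod (sec w)) + Cmod w / INR N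
           + M * (2 / m * (Cmod w / INR N)) ^ 2).
      { intros w. exact (proj2_sig (constructive_indefinite_description _ (Ex w))). }
      clearbody sec'. clear Ex. exists sec'.
      assert (Hphi : forall w, Cmod w < rho ->
         stretch_primitive alpha c (Cmod (sec' w)) <= INR (S k) * (Cmod w / INR N + E)).
      { intros w Hw. destruct (Hsec' w Hw) as (_ & _ & _ & T).
        destruct (Hsec w Hw) as (_ & _ & T').
        assert (T2 : M * (2 / m * (Cmod w / INR N)) ^ 2 <= E).
        { unfold E. apply Rmult_le_compat_l; [lra|]. destruct (Ws w Hw) as [W1 W2].
          apply pow_incr. split; [apply Rmult_le_pos; lra|apply Rmult_le_compat_l; lra]. }
        rewrite S_INR. lra. }
      assert (Z : Cmod (RtoC 0) < rho) by (rewrite Cmod_0; lra).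
      split; [|split].
      + destruct (Hsec' _ Z) as (_ & T & _). rewrite sec0, Cmod_0 in T.
        unfold Rdiv in T at 2. rewrite Rmult_0_l, Rmult_0_r in T.
        apply Cmod_diff_0. apply Rle_antisym; [exact T|apply Cmod_ge_0].
      + intros w Hw. destruct (Hsec' w Hw) as (T1 & T2 & T3 & T4).
        split; [exact T1|]. split; [|now apply Hphi].
        (* Beyond R0 the gauge would be at least rho + gap, while the accumulated bound is at most
           |w| + N E < rho + gap. *)
        apply Rnot_lt_le. intros L.
        assert (HP := Hphi w Hw).
        destruct (Ws w Hw) as [W1 _].
        assert (B1 : INR (S k) * (Cmod w / INR N + E) <= INR N * (Cmod w / INR N + E)).
        { apply Rmult_le_compat_r; [lra|]. apply le_INR. lia. }
        assert (B2 : INR N * (Cmod w / INR N) = Cmod w) by (field; lra).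
        assert (B3 := stretch_primitive_increasing alpha c R0 (Cmod (sec' w)) ltac:(lra) ltac:(lra) ltac:(lra) ltac:(lra)).
        unfold gap in EN. lra.
      (* The old Lipschitz bound only serves to bring the new lifts within [delta]; the expansion of
         f then gives the bound afresh with the same constant, so nothing deteriorates with k. *)
      + intros w w' Hw Hw' D.
        destruct (Hsec' w Hw) as (A1 & A2 & A3 & _).
        destruct (Hsec' w' Hw') as (B1 & B2 & B3 & _).
        assert (L := Hlip w w' Hw Hw' D).
        assert (W1 := Ws w Hw). assert (W2 := Ws w' Hw').
        assert (I1 : 2 / m * (Cmod w / INR N) <= delta / 4)
          by (eapply Rle_trans; [apply Rmult_le_compat_l|exact S3]; lra).
        assert (I2 : 2 / m * (Cmod w' / INR N) <= delta / 4)
          by (eapply Rle_trans; [apply Rmult_le_compat_l|exact S3]; lra).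
        assert (I3 : 2 / m * Cmod (w - w') <= delta / 2)
          by (rewrite <- Htau; apply Rmult_le_compat_l; lra).
        assert (T1 := Cmod_dist_triangle (sec' w) (sec w) (sec' w')).
        assert (T2 := Cmod_dist_triangle (sec w) (sec w') (sec' w')).
        rewrite (Cmod_minus_sym (sec w') (sec' w')) in T2.
        eapply Rle_trans; [apply Exp; auto; lra|].
        rewrite A1, B1. apply Rmult_le_compat_l; [lra|].
        replace (RtoC (INR (S k) / INR N) * w - RtoC (INR (S k) / INR N) * w')%C
          with (RtoC (INR (S k) / INR N) * (w - w'))%C by ring.
        rewrite Cmod_mult, Cmod_R.
        assert (F : 0 <= INR (S k) / INR N <= 1).
        { split; [apply Rmult_le_pos; [apply pos_INR|left; now apply Rinv_0_lt_compat]|].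
          apply Rmult_le_reg_r with (INR N); auto. unfold Rdiv. rewrite Rmult_assoc, Rinv_l by lra.
          rewrite Rmult_1_r, Rmult_1_l. apply le_INR. lia. }
        rewrite Rabs_pos_eq by lra. assert (P := Cmod_ge_0 (w - w')). nra. }
  destruct (Lift N (Nat.le_refl N)) as (sec & sec0 & Hsec & Hlip).
  assert (Hf : forall w, Cmod w < rho -> f (sec w) = w).
  { intros w Hw. destruct (Hsec w Hw) as [-> _]. replace (INR N / INR N) with 1 by (field; lra). ring. }
  split; [lra|]. exists (fun v => exists w, Cmod w < rho /\ v = sec w).
  split; [|split; [|split; [|split]]].
  (* Openness: for v near sec w0, the points v and sec (f v) lie within [delta] and have the same
     image, so they coincide. *)
  - intros v0 [w0 [Hw0 ->]]. apply locally_Cmod_iff.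
    assert (B0 : Cmod (sec w0) <= R0) by now apply Hsec.
    destruct (harmonic_cont f h g (sec w0) Hp ltac:(unfold unit_disk; lra) (Rmin tau (rho - Cmod w0)))
      as [d [Hd K]]; [apply Rmin_glb_lt; lra|].
    exists (Rmin d (Rmin (delta / 2) (R1 - R0))). split; [repeat apply Rmin_glb_lt; lra|].
    intros v Hv.
    assert (V1 : Cmod (v - sec w0) < d) by (eapply Rlt_le_trans; [exact Hv|apply Rmin_l]).
    assert (V2 : Cmod (v - sec w0) < delta / 2)
      by (eapply Rlt_le_trans; [exact Hv|eapply Rle_trans; [apply Rmin_r|apply Rmin_l]]).
    assert (V3 : Cmod (v - sec w0) < R1 - R0)
      by (eapply Rlt_le_trans; [exact Hv|eapply Rle_trans; [apply Rmin_r|apply Rmin_r]]).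
    specialize (K v V1). rewrite (Hf w0 Hw0) in K.
    assert (K1 : Cmod (f v - w0) < tau) by (eapply Rlt_le_trans; [exact K|apply Rmin_l]).
    assert (K2 : Cmod (f v - w0) < rho - Cmod w0) by (eapply Rlt_le_trans; [exact K|apply Rmin_r]).
    assert (Hfv : Cmod (f v) < rho) by (assert (T := Cmod_triangle_inv (f v) w0); lra).
    exists (f v). split; auto.
    assert (L := Hlip (f v) w0 Hfv Hw0 ltac:(lra)).
    assert (Bv : Cmod (sec (f v)) <= R0) by now apply Hsec.
    assert (L2 : 2 / m * Cmod (f v - w0) <= delta / 2)
      by (rewrite <- Htau; apply Rmult_le_compat_l; lra).
    assert (T := Cmod_dist_triangle v (sec w0) (sec (f v))).
    rewrite (Cmod_minus_sym (sec w0)) in T.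
    assert (T2 := Cmod_triangle_inv v (sec w0)).
    assert (X := Exp v (sec (f v)) ltac:(lra) ltac:(lra) ltac:(lra)).
    rewrite (Hf (f v) Hfv) in X. replace (f v - f v)%C with (RtoC 0) in X by ring.
    rewrite Cmod_0, Rmult_0_r in X. apply Cmod_diff_0.
    apply Rle_antisym; [exact X|apply Cmod_ge_0].
  - intros u [w [Hw ->]]. unfold unit_disk. assert (T : Cmod (sec w) <= R0) by now apply Hsec. lra.
  - exists (RtoC 0). rewrite Cmod_0. split; [lra|auto].
  - intros u v [w [Hw ->]] [w' [Hw' ->]]. rewrite !Hf by auto. now intros ->.
  - intros w. rewrite f0. replace (w - RtoC 0)%C with w by ring. split.
    + intros Hw. exists (sec w). split; eauto.
    + intros [u [[w' [Hw' ->]] <-]]. now rewrite Hf.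
Qed.
End Lift.

(** * Moving the centre, and the lower bound for the univalent radius *)

Lemma disk_aut_inverse (a v : C) :
  Cmod a < 1 -> unit_disk v ->
  unit_disk (disk_aut 0 (- a)%C v) /\ disk_aut 0 a (disk_aut 0 (- a)%C v) = v.
Proof.
  intros Ha Hv. assert (Ha' : Cmod (- a) < 1) by now rewrite Cmod_opp.
  assert (Hu : unit_disk (disk_aut 0 (- a)%C v)) by now apply disk_aut_disk.
  split; auto.
  assert (D1 := disk_aut_denom _ v Ha' Hv).
  assert (D2 := disk_aut_denom a _ Ha Hu).
  assert (N : (RtoC 1 - a * Cconj a)%C <> RtoC 0).
  { rewrite one_minus_conj. intros E. apply RtoC_inj in E. assert (P := Cmod_ge_0 a). nra. }
  assert (R1 : (cos 0, sin 0) = RtoC 1) by (unfold RtoC; now rewrite cos_0, sin_0).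
  unfold disk_aut in *. rewrite R1, Cmult_1_l in *. rewrite Copp_conj in *.
  field_simplify_eq; [|split; auto].
  - ring.
  (* The denominator of the composed map collapses to 1 - |a|^2. *)
  - intros E. apply N.
    replace (RtoC 1 - a * Cconj a)%C with (RtoC 1 + - Cconj a * v + Cconj a * (v + - a))%C by ring.
    rewrite <- E. ring.
Qed.

Lemma disk_aut_inverse_l (a u : C) :
  Cmod a < 1 -> unit_disk u -> disk_aut 0 (- a)%C (disk_aut 0 a u) = u.
Proof.
  intros Ha Hu. destruct (disk_aut_inverse (- a)%C u) as [_ E]; auto.
  - now rewrite Cmod_opp.
  - now replace (- - a)%C with a in E by ring.
Qed.

(** The Koebe transform is f after the automorphism, followed by a similarity of ratio 1 / |A|
    taking f(a) to 0; univalent disks are carried back with radius multiplied by |A|. *)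
Lemma univalent_disk_koebe (f h : C -> C) (a A : C) (rho : R) :
  Cmod a < 1 -> A <> RtoC 0 ->
  (C_derive h (disk_aut 0 a (RtoC 0)) * C_derive (disk_aut 0 a) (RtoC 0))%C = A ->
  univalent_disk (koebe_transform (disk_aut 0 a) f h) (RtoC 0) rho ->
  univalent_disk f a (Cmod A * rho).
Proof.
  intros Ha NA EA (Pr & U & OU & DU & U0 & Inj & Img).
  assert (PA := proj1 (Cmod_gt_0 _) NA).
  assert (Ea : disk_aut 0 a (RtoC 0) = a).
  { rewrite disk_aut_at_0. unfold rot. rewrite cos_0, sin_0. change (1, 0) with (RtoC 1). ring. }
  assert (K : forall u, koebe_transform (disk_aut 0 a) f h u = ((f (disk_aut 0 a u) - f a) / A)%C).
  { intros u. unfold koebe_transform. rewrite EA, Ea. reflexivity. }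
  split; [now apply Rmult_lt_0_compat|].
  exists (fun v => unit_disk v /\ U (disk_aut 0 (- a)%C v)).
  assert (Ha' : Cmod (- a) < 1) by now rewrite Cmod_opp.
  split; [|split; [|split; [|split]]].
  - intros v [Hv Uv]. apply locally_Cmod_iff.
    apply OU in Uv. apply locally_Cmod_iff in Uv. destruct Uv as [d [Hd Kd]].
    destruct (Cder_cont _ _ _ (disk_aut_Cder 0 (- a)%C v Ha' Hv) d Hd) as [d' [Hd' Kd']].
    destruct (unit_disk_nbhd v Hv) as [P Q].
    exists (Rmin d' (1 - Cmod v)). split; [now apply Rmin_glb_lt|]. intros x Hx. split.
    + apply Q. eapply Rlt_le_trans; [exact Hx|apply Rmin_r].
    + apply Kd, Kd'. eapply Rlt_le_trans; [exact Hx|apply Rmin_l].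
  - tauto.
  - split; [exact Ha|]. assert (I := disk_aut_inverse_l a _ Ha unit_disk_0). rewrite Ea in I.
    now rewrite I.
  - intros u v [Hu Uu] [Hv Uv] E.
    destruct (disk_aut_inverse a u Ha Hu) as [_ Iu]. destruct (disk_aut_inverse a v Ha Hv) as [_ Iv].
    rewrite <- Iu, <- Iv. f_equal. apply Inj; auto. rewrite !K, Iu, Iv, E. reflexivity.
  - intros w.
    assert (Img0 := Img ((w - f a) / A)%C). rewrite K, Ea in Img0.
    replace ((w - f a) / A - (f a - f a) / A)%C with ((w - f a) / A)%C in Img0 by (field; auto).
    rewrite Cmod_div in Img0 by auto. split.
    + intros Hw. destruct (proj1 Img0) as [u [Uu Eu]].
      { apply Rmult_lt_reg_r with (Cmod A); auto. unfold Rdiv.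
        rewrite Rmult_assoc, Rinv_l, Rmult_1_r by lra. lra. }
      rewrite K in Eu. exists (disk_aut 0 a u). split.
      * split; [apply disk_aut_disk; auto|]. rewrite disk_aut_inverse_l; auto.
      * replace (f (disk_aut 0 a u)) with ((f (disk_aut 0 a u) - f a) / A * A + f a)%C by (field; auto).
        rewrite Eu. field. auto.
    + intros [v [[Hv Uv] <-]]. destruct (disk_aut_inverse a v Ha Hv) as [_ Iv].
      assert (T : Cmod (f v - f a) / Cmod A < rho).
      { apply Img0. exists (disk_aut 0 (- a)%C v). split; auto. rewrite K, Iv. reflexivity. }
      apply Rmult_lt_reg_r with (/ Cmod A); [now apply Rinv_0_lt_compat|].
      replace (Cmod A * rho * / Cmod A) with rho by (field; lra). exact T.
Qed.

Lemma Rbar_le_Lub (E : R -> Prop) (x : R) :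
  0 < x -> (forall y, 0 < y < x -> E y) -> Rbar_le (Finite x) (Lub_Rbar E).
Proof.
  intros Hx H. destruct (Lub_Rbar_correct E) as [Ub _].
  destruct (Lub_Rbar E) as [l| |].
  - simpl. apply le_epsilon. intros e He.
    assert (P : 0 < Rmin (x / 2) e) by (apply Rmin_glb_lt; lra).
    assert (B1 := Rmin_l (x / 2) e). assert (B2 := Rmin_r (x / 2) e).
    assert (Ey : E (x - Rmin (x / 2) e)) by (apply H; lra).
    assert (T := Ub _ Ey). simpl in T. lra.
  - exact Logic.I.
  - assert (Ey : E (x / 2)) by (apply H; lra). exact (Ub _ Ey).
Qed.

Lemma univalent_radius_lower (L : (C -> C) -> Prop) (alpha : R) (f h g : C -> C) (z : C) :
  ALIF L -> family_order L = Finite alpha -> L f -> harmonic_parts f h g -> unit_disk z ->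
  Rbar_le
    (Finite ((1 - Cmod (dilatation h g z)) / (2 * alpha) * Rpower ((1 - Cmod z) / (1 + Cmod z)) alpha))
    (univalent_radius f z).
Proof.
  intros HA HO Hf Hp Hz. assert (HL := proj1 HA).
  assert (Al := LIF_order_ge_1 L alpha HL HO).
  destruct (LIF_parts L f h g HL Hf Hp) as (_ & SP & N1 & KT).
  assert (NZ : forall w, unit_disk w -> C_derive h w <> RtoC 0)
    by (intros w Hw; now apply (sense_preserving_neq_0 h g)).
  set (A := koebe_const 0 z h).
  assert (NA : A <> RtoC 0) by (apply (koebe_const_neq_0 0 z h Hz NZ)).
  assert (PA := proj1 (Cmod_gt_0 _) NA).
  assert (LF := KT 0 z Hz). set (F := koebe_transform (disk_aut 0 z) f h) in *.
  destruct (HL F LF) as (h1 & g1 & Hp1 & _ & SP1 & M1 & _).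
  assert (R1 : rot 0 = RtoC 1) by (unfold rot, RtoC; now rewrite cos_0, sin_0).
  assert (Ez : disk_aut 0 z (RtoC 0) = z) by (rewrite disk_aut_at_0, R1; ring).
  (* The transform carries the modulus of the dilatation at [z] to the origin, where its analytic
     part has derivative 1. *)
  assert (G1 : Cmod (C_derive g1 (RtoC 0)) = Cmod (dilatation h g z)).
  { destruct (koebe_parts_derive 0 z f h g Hz Hp NZ h1 g1 Hp1 _ unit_disk_0) as [_ ->].
    assert (ND := disk_aut_derive_neq_0 0 z (RtoC 0) Hz unit_disk_0).
    unfold dilatation, koebe_const. rewrite Ez.
    assert (NC := NZ z Hz).
    rewrite !Cmod_div, !Cmod_mult, Cmod_conj, Cmod_mult; auto.
    - apply Cmod_gt_0 in ND. apply Cmod_gt_0 in NC. field. lra.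
    - apply Cconj_neq_0, Cmult_neq_0; auto. }
  set (W := 1 - Cmod (dilatation h g z)) in *.
  assert (PW : 0 < W).
  { assert (T := sense_preserving_lt h1 g1 _ SP1 unit_disk_0). rewrite M1, Cmod_1, G1 in T. unfold W. lra. }
  assert (Lower : forall rho, 0 < rho < W / (2 * alpha) -> univalent_disk f z (Cmod A * rho)).
  { intros rho Hrho. apply (univalent_disk_koebe f h z A); auto.
    - apply koebe_const_eq; auto.
    - apply (univalent_disk_lift F h1 g1 Hp1 alpha W Al PW); auto.
      intros w Hw. unfold W. rewrite <- G1. now apply (ALIF_stretch_bound L alpha F h1 g1). }
  assert (Pq : 0 < W / (2 * alpha)) by (apply Rdiv_lt_0_compat; lra).
  assert (LR : Rbar_le (Finite (Cmod A * (W / (2 * alpha)))) (univalent_radius f z)).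
  { apply Rbar_le_Lub; [now apply Rmult_lt_0_compat|]. intros y Hy.
    replace y with (Cmod A * (y / Cmod A)) by (field; lra). apply Lower.
    split; [apply Rdiv_lt_0_compat; lra|]. apply Rmult_lt_reg_l with (Cmod A); auto.
    replace (Cmod A * (y / Cmod A)) with y by (field; lra). lra. }
  eapply Rbar_le_trans; [|exact LR]. simpl. rewrite Rmult_comm.
  apply Rmult_le_compat_r; [lra|].
  set (r := Cmod z) in *. assert (Hr : 0 <= r < 1) by (split; [apply Cmod_ge_0|exact Hz]).
  assert (GB : stretch_minorant alpha r <= Cmod (C_derive h z)).
  { apply growth_bound; auto; [apply Hp|]. intros a Ha.
    now apply (LIF_pre_schwarzian_bound L alpha f h g). }
  unfold A, koebe_const. rewrite Ez, Cmod_mult.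
  replace (disk_aut_derive 0 z (RtoC 0)) with (RtoC (1 - r ^ 2)).
  2: { unfold disk_aut_derive. rewrite R1, one_minus_conj. fold r. field. }
  rewrite Cmod_R, Rabs_pos_eq by nra.
  (* |A| = |h'(z)| (1 - r^2), and this factor completes the exponents alpha - 1 and -(alpha + 1) to
     alpha and -alpha. *)
  apply Rle_trans with (stretch_minorant alpha r * (1 - r ^ 2)); [right|apply Rmult_le_compat_r; nra].
  unfold Rpower, stretch_minorant. unfold Rdiv. rewrite ln_mult, ln_Rinv by (try apply Rinv_0_lt_compat; lra).
  replace (1 - r ^ 2) with (exp (ln (1 - r) + ln (1 + r))) by (rewrite exp_plus, !exp_ln by lra; ring).
  rewrite <- exp_plus. f_equal. ring.
Qed.

(** * Extremal family *)

Fixpoint binom_coef (beta : R) (b : C) (n : nat) : C :=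
  match n with
  | O => RtoC 1
  | S m => (RtoC ((beta - INR m) / INR (S m)) * b * binom_coef beta b m)%C
  end.

(** The coefficients of (1 - x)^(-m). For m > 0 they never vanish, unlike binomial coefficients with
    a natural exponent, so the ratio test applies to them. *)
Fixpoint binom_majorant (m : R) (n : nat) : R :=
  match n with
  | O => 1
  | S k => (m + INR k) / INR (S k) * binom_majorant m k
  end.

Lemma binom_coef_S (beta : R) (b : C) (n : nat) :
  binom_coef beta b (S n) = (RtoC ((beta - INR n) / INR (S n)) * b * binom_coef beta b n)%C.
Proof. reflexivity. Qed.

Lemma binom_majorant_S (m : R) (n : nat) :
  binom_majorant m (S n) = (m + INR n) / INR (S n) * binom_majorant m n.
Proof. reflexivity. Qed.

Lemma binom_majorant_pos (m : R) (n : nat) : 0 < m -> 0 < binom_majorant m n.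
Proof.
  intros Hm. induction n as [|n IH]; [simpl; lra|].
  assert (P := pos_INR n). rewrite binom_majorant_S, S_INR. apply Rmult_lt_0_compat; auto.
  apply Rdiv_lt_0_compat; lra.
Qed.

Lemma binom_majorant_radius (m : R) : 0 < m -> CV_radius (binom_majorant m) = Finite 1.
Proof.
  intros Hm. replace 1 with (/ 1) by lra.
  apply CV_radius_finite_DAlembert; [|lra|].
  - intros n. assert (P := binom_majorant_pos m n Hm). lra.
  - apply is_lim_seq_ext with (fun n => 1 + (m - 1) * / INR (S n)).
    + intros n. assert (P := binom_majorant_pos m n Hm). assert (Pn := pos_INR n).
      rewrite binom_majorant_S, S_INR.
      replace ((m + INR n) / (INR n + 1) * binom_majorant m n / binom_majorant m n)
        with ((m + INR n) / (INR n + 1)) by (field; lra).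
      rewrite Rabs_pos_eq; [field; lra|]. left. apply Rdiv_lt_0_compat; lra.
    + replace (Finite 1) with (Rbar_plus 1 (Rbar_mult (m - 1) 0)).
      2: { simpl. f_equal. ring. }
      apply is_lim_seq_plus'; [apply is_lim_seq_const|].
      apply is_lim_seq_mult'; [apply is_lim_seq_const|].
      apply (is_lim_seq_incr_1 (fun n => / INR n)).
      replace (Finite 0) with (Rbar_inv p_infty) by reflexivity.
      apply is_lim_seq_inv; [apply is_lim_seq_INR|discriminate].
Qed.

Lemma binom_coef_bound (beta : R) (b : C) (n : nat) :
  Cmod b <= 1 -> Cmod (binom_coef beta b n) <= binom_majorant (Rabs beta + 1) n.
Proof.
  intros Hb. assert (Pb := Cmod_ge_0 b). assert (Pbeta := Rabs_pos beta).
  induction n as [|n IH].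
  - simpl. rewrite Cmod_1. lra.
  - rewrite binom_coef_S, binom_majorant_S, !Cmod_mult, Cmod_R. assert (Pn := pos_INR n). rewrite S_INR.
    assert (Pc := Cmod_ge_0 (binom_coef beta b n)).
    apply Rmult_le_compat; auto.
    + apply Rmult_le_pos; auto. apply Rabs_pos.
    + rewrite <- (Rmult_1_r ((Rabs beta + 1 + INR n) / (INR n + 1))).
      apply Rmult_le_compat; auto; [apply Rabs_pos|].
      unfold Rdiv. rewrite Rabs_mult, (Rabs_pos_eq (/ (INR n + 1))).
      2: { left. apply Rinv_0_lt_compat. lra. }
      apply Rmult_le_compat_r; [left; apply Rinv_0_lt_compat; lra|].
      eapply Rle_trans; [apply Rabs_triang|]. rewrite Rabs_Ropp, (Rabs_pos_eq (INR n)); lra.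
Qed.

Lemma binom_conv_disk (beta : R) (b : C) : Cmod b <= 1 -> conv_disk (binom_coef beta b).
Proof.
  intros Hb r Hr. assert (Pbeta := Rabs_pos beta).
  apply (@ex_series_le R_AbsRing R_CompleteNormedModule)
    with (fun n => Rabs (binom_majorant (Rabs beta + 1) n * r ^ n)).
  - intros n. change (Rabs (Cmod (binom_coef beta b n) * r ^ n)
      <= Rabs (binom_majorant (Rabs beta + 1) n * r ^ n)).
    assert (P : 0 <= r ^ n) by (apply pow_le; lra).
    assert (Q := binom_majorant_pos (Rabs beta + 1) n ltac:(lra)).
    rewrite (Rabs_pos_eq (Cmod _ * _)) by (apply Rmult_le_pos; auto using Cmod_ge_0).
    rewrite (Rabs_pos_eq (binom_majorant _ _ * _)) by (apply Rmult_le_pos; auto; lra).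
    apply Rmult_le_compat_r; auto. now apply binom_coef_bound.
  - apply CV_disk_inside. rewrite binom_majorant_radius by lra. simpl.
    rewrite Rabs_pos_eq; lra.
Qed.

Lemma one_plus_neq_0 (b z : C) : Cmod b = 1 -> unit_disk z -> (RtoC 1 + b * z)%C <> RtoC 0.
Proof.
  intros Hb Hz E. unfold unit_disk in Hz.
  assert (T := Cmod_triangle_inv (RtoC 1) (- (b * z))%C).
  replace (RtoC 1 - - (b * z))%C with (RtoC 1 + b * z)%C in T by ring.
  rewrite E, Cmod_1, Cmod_0, Cmod_opp, Cmod_mult, Hb in T. lra.
Qed.

(* [E z = (1 + b z) ^ beta]: the differential equation avoids branches of the power. *)
Lemma binomial_function (beta : R) (b : C) :
  Cmod b = 1 ->
  exists E, analytic_on_disk E /\ E (RtoC 0) = RtoC 1 /\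
    forall z, unit_disk z -> Cder E z (RtoC beta * b / (RtoC 1 + b * z) * E z)%C.
Proof.
  intros Hb.
  assert (CD := binom_conv_disk beta b ltac:(lra)).
  destruct (sum_fun _ CD) as [E HE]. destruct (sum_fun _ (conv_disk_dcoef _ CD)) as [E1 HE1].
  exists E. split; [|split].
  - apply analytic_on_disk_iff. eauto.
  - apply (Cseries_at_0 (binom_coef beta b)), HE, unit_disk_0.
  - intros z Hz.
    assert (D := quad_estimate_Cder E E1 (pseries_quad_estimate _ E E1 CD HE HE1) z Hz).
    eapply Cder_eq; [|exact D].
    assert (NZ := one_plus_neq_0 b z Hb Hz).
    assert (S1 := HE1 z Hz).
    assert (S2 : Cseries (fun n => RtoC (INR n) * b * binom_coef beta b n * z ^ n)%C (b * z * E1 z)%C).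
    { apply is_series_decr_1.
      assert (Q : @eq C (plus (b * z * E1 z)%C (opp (RtoC (INR 0) * b * binom_coef beta b 0 * z ^ 0)%C))
              (scal (b * z)%C (E1 z : C_NormedModule))).
      { change ((b * z * E1 z - RtoC 0 * b * RtoC 1 * RtoC 1)%C = (b * z * E1 z)%C). ring. }
      refine (eq_ind_r (Cseries _) _ Q).
      eapply is_series_ext; [|apply (is_series_scal_l (K := C_AbsRing) (V := C_NormedModule) (b * z)%C), S1].
      intros n. unfold dcoef.
      match goal with |- @eq _ ?x ?y => change (@eq C
        (b * z * (RtoC (INR (S n)) * binom_coef beta b (S n) * z ^ n))%C y) end.
      rewrite Cpow_S. ring. }
    assert (S3 := is_series_plus (K := C_AbsRing) (V := C_NormedModule) _ _ _ _ S1 S2).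
    assert (S4 := is_series_scal_l (K := C_AbsRing) (V := C_NormedModule) (RtoC beta * b)%C _ _ (HE z Hz)).
    (* The recurrence of the coefficients is (1 + b z) E' = beta b E read termwise. *)
    assert (Q : (E1 z + b * z * E1 z)%C = (RtoC beta * b * E z)%C).
    { eapply Cseries_unique; [exact S3|].
      eapply is_series_ext; [|exact S4].
      intros n. match goal with |- @eq _ ?x ?y => change (@eq C
        (RtoC beta * b * (binom_coef beta b n * z ^ n))%C
        (dcoef (binom_coef beta b) n * z ^ n + RtoC (INR n) * b * binom_coef beta b n * z ^ n)%C) end.
      unfold dcoef. rewrite binom_coef_S.
      assert (NS : RtoC (INR (S n)) <> RtoC 0).
      { intros E'. apply RtoC_inj in E'. revert E'. apply not_0_INR. lia. }
      rewrite RtoC_div, RtoC_minus by (apply not_0_INR; lia). field. exact NS. }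
    symmetry. transitivity ((RtoC beta * b * E z) / (RtoC 1 + b * z))%C; [field; auto|].
    rewrite <- Q. field. auto.
Qed.

(* The logarithmic derivative of (1 + b z)^(alpha - 1) (1 + d z)^(-alpha - 1). *)
Definition pole_log_derivative (alpha : R) (b d z : C) : C :=
  (RtoC (alpha - 1) * b / (RtoC 1 + b * z) - RtoC (alpha + 1) * d / (RtoC 1 + d * z))%C.

(** [w] is built with the opposite exponents and solves the equation with the opposite sign, so it
    plays the part of 1 / y before y is known not to vanish. *)
Lemma pole_log_derivative_solution (alpha : R) (b d : C) :
  Cmod b = 1 -> Cmod d = 1 ->
  exists y w : C -> C, analytic_on_disk y /\ y (RtoC 0) = RtoC 1 /\ w (RtoC 0) = RtoC 1 /\
    forall z, unit_disk z ->
      Cder y z (pole_log_derivative alpha b d z * y z)%C /\ Cder w z (- pole_log_derivative alpha b d z * w z)%C.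
Proof.
  intros Hb Hd.
  destruct (binomial_function (alpha - 1) b Hb) as (E1 & A1 & Z1 & D1).
  destruct (binomial_function (- (alpha + 1)) d Hd) as (E2 & A2 & Z2 & D2).
  destruct (binomial_function (- (alpha - 1)) b Hb) as (E3 & A3 & Z3 & D3).
  destruct (binomial_function (alpha + 1) d Hd) as (E4 & A4 & Z4 & D4).
  exists (fun z => E1 z * E2 z)%C, (fun z => E3 z * E4 z)%C.
  split; [now apply analytic_mult|]. split; [rewrite Z1, Z2; ring|]. split; [rewrite Z3, Z4; ring|].
  intros z Hz. assert (N1 := one_plus_neq_0 b z Hb Hz). assert (N2 := one_plus_neq_0 d z Hd Hz).
  split; (eapply Cder_eq; [|apply Cder_mult; [now auto|now auto]]); unfold pole_log_derivative;
    rewrite RtoC_opp; field; auto.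
Qed.

(** Any normalised solution times the fixed [w] has zero derivative, hence equals 1; this gives
    uniqueness and nonvanishing together. *)
Lemma pole_log_derivative_unique (alpha : R) (b d : C) (y1 y2 : C -> C) :
  Cmod b = 1 -> Cmod d = 1 -> y1 (RtoC 0) = RtoC 1 -> y2 (RtoC 0) = RtoC 1 ->
  (forall z, unit_disk z -> Cder y1 z (pole_log_derivative alpha b d z * y1 z)%C) ->
  (forall z, unit_disk z -> Cder y2 z (pole_log_derivative alpha b d z * y2 z)%C) ->
  forall z, unit_disk z -> y1 z = y2 z /\ y1 z <> RtoC 0.
Proof.
  intros Hb Hd Z1 Z2 D1 D2 z Hz.
  destruct (pole_log_derivative_solution alpha b d Hb Hd) as (y0 & w & _ & _ & Zw & Dw).
  assert (K : forall y, y (RtoC 0) = RtoC 1 ->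
    (forall z, unit_disk z -> Cder y z (pole_log_derivative alpha b d z * y z)%C) -> (y z * w z)%C = RtoC 1).
  { intros y Zy Dy.
    rewrite (disk_const (fun z => y z * w z)%C); auto.
    - rewrite Zy, Zw. ring.
    - intros v Hv. eapply Cder_eq; [|apply Cder_mult; [now apply Dy|now apply Dw]]. ring. }
  assert (K1 := K y1 Z1 D1). assert (K2 := K y2 Z2 D2).
  assert (N1 : RtoC 1 <> RtoC 0) by (intros E; apply RtoC_inj in E; lra).
  split.
  - transitivity (y1 z * (y2 z * w z))%C; [rewrite K2; ring|].
    transitivity (y2 z * (y1 z * w z))%C; [ring|]. rewrite K1. ring.
  - intros E. rewrite E, Cmult_0_l in K1. now symmetry in K1.
Qed.

(* [b = 1], [d = -1] gives the generalized Koebe function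
   h(z) = (((1 + z) / (1 - z))^alpha - 1) / (2 alpha); its Koebe transforms are the
   [h] for the other boundary points [b], [d]. *)
Definition extremal_family (alpha : R) (f : C -> C) : Prop :=
  exists (b d k : C) (h : C -> C),
    Cmod b = 1 /\ Cmod d = 1 /\ unit_disk k /\
    analytic_on_disk h /\ h (RtoC 0) = RtoC 0 /\ C_derive h (RtoC 0) = RtoC 1 /\
    (forall z, unit_disk z -> C_derive (C_derive h) z = (pole_log_derivative alpha b d z * C_derive h z)%C) /\
    forall z, unit_disk z -> f z = (h z + Cconj (k * h z))%C.

(** * Closure of the extremal family under affine and Koebe transforms *)

Section Family.
Context (alpha : R) (f h : C -> C) (b d k : C) (Hb : Cmod b = 1) (Hd : Cmod d = 1)
  (Hk : unit_disk k) (Ah : analytic_on_disk h) (h0 : h (RtoC 0) = RtoC 0)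
  (h'0 : C_derive h (RtoC 0) = RtoC 1)
  (ODE : forall z, unit_disk z -> C_derive (C_derive h) z = (pole_log_derivative alpha b d z * C_derive h z)%C)
  (Ef : forall z, unit_disk z -> f z = (h z + Cconj (k * h z))%C).

Lemma family_derive_ode (z : C) : unit_disk z ->
  Cder (C_derive h) z (pole_log_derivative alpha b d z * C_derive h z)%C.
Proof. intros Hz. rewrite <- ODE by auto. apply analytic_Cder; auto. now apply analytic_C_derive. Qed.

Lemma family_derive_neq_0 (z : C) : unit_disk z -> C_derive h z <> RtoC 0.
Proof.
  intros Hz. apply (pole_log_derivative_unique alpha b d (C_derive h) (C_derive h)); auto; apply family_derive_ode.
Qed.

Lemma analytic_scal (c : C) : analytic_on_disk (fun z => c * h z)%C.
Proof.
  apply analytic_on_disk_iff in Ah. destruct Ah as [a [_ Ha]].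
  exists (fun n => c * a n)%C. intros z Hz. apply Cis_pseries_iff.
  eapply is_series_ext; [|apply (is_series_scal_l (K := C_AbsRing) (V := C_NormedModule) c), (Ha z Hz)].
  intros n. apply Cmult_assoc.
Qed.

Lemma family_parts : harmonic_parts f h (fun z => k * h z)%C.
Proof.
  split; [exact Ah|]. split; [apply analytic_scal|]. split; [exact h0|]. split; [rewrite h0; ring|exact Ef].
Qed.

Lemma family_g_derive (z : C) : unit_disk z -> C_derive (fun z => k * h z)%C z = (k * C_derive h z)%C.
Proof. intros Hz. apply Cder_C_derive, Cder_scal. now apply analytic_Cder. Qed.

Lemma family_sense_preserving : sense_preserving h (fun z => k * h z)%C.
Proof.
  intros z Hz. rewrite family_g_derive, Cmod_mult by auto.
  assert (P := proj1 (Cmod_gt_0 _) (family_derive_neq_0 z Hz)).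
  unfold unit_disk in Hk. assert (Pk := Cmod_ge_0 k).
  assert (Cmod k * Cmod (C_derive h z) < Cmod (C_derive h z)) by nra.
  assert (0 <= Cmod k * Cmod (C_derive h z)) by nra. nra.
Qed.

Lemma family_locally_univalent : locally_univalent f.
Proof.
  intros z Hz. destruct (harmonic_local_injectivity f h _ z family_parts family_sense_preserving Hz)
    as [delta [P K]].
  exists delta. split; auto.
Qed.

(** The analytic part [h] is unchanged; only the constant dilatation [k] moves, to (k + conj eps) /
    (1 + conj k conj eps), which is a disk automorphism and so stays in the disk. *)
Lemma family_affine (h1 g1 : C -> C) (eps : C) :
  harmonic_parts f h1 g1 -> unit_disk eps -> extremal_family alpha (affine_transform eps f g1).
Proof.
  intros Hp1 He.
  assert (G : C_derive g1 (RtoC 0) = k).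
  { destruct (C_derive_of_parts f h1 g1 h (fun z => k * h z)%C (C_derive h)
      (fun z => k * C_derive h z)%C Hp1) with (z := RtoC 0) as [_ ->]; auto using unit_disk_0.
    - intros z Hz. now apply analytic_Cder.
    - intros z Hz. apply Cder_scal. now apply analytic_Cder.
    - rewrite h'0. ring. }
  assert (He' : unit_disk (Cconj eps)) by (unfold unit_disk; now rewrite Cmod_conj).
  assert (K2 := disk_aut_disk 0 k (Cconj eps) Hk He').
  assert (N := disk_aut_denom k (Cconj eps) Hk He').
  exists b, d, (disk_aut 0 k (Cconj eps)), h. repeat (split; [assumption|]).
  intros z Hz. unfold affine_transform, dzbar. rewrite Cconj_conj, G, (Ef z Hz).
  unfold disk_aut. rewrite cos_0, sin_0. change (1, 0) with (RtoC 1).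
  assert (N' : (RtoC 1 + eps * k)%C <> RtoC 0).
  { intros E. apply N. apply (f_equal Cconj) in E.
    rewrite Cplus_conj, Cmult_conj, !Cconj_RtoC in E. rewrite <- E. ring. }
  rewrite !Cmult_conj, Cdiv_conj by auto.
  rewrite !Cplus_conj, !Cmult_conj, !Cconj_conj, Cconj_RtoC.
  field. intros E. apply N'. rewrite <- E. ring.
Qed.

(** If e is the rotation of the automorphism and c' the quotient here, then -1/c' is the boundary
    point sent to -1/c. Its modulus is 1 because the numerator is c e times the conjugate of the
    denominator. *)
Lemma boundary_point_transform (c a e : C) :
  Cmod c = 1 -> Cmod e = 1 -> Cmod a < 1 ->
  (RtoC 1 + c * e * a)%C <> RtoC 0 /\ Cmod ((Cconj a + c * e) / (RtoC 1 + c * e * a)) = 1.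
Proof.
  intros Hc He Ha.
  assert (Hce : Cmod (c * e) = 1) by (rewrite Cmod_mult, Hc, He; ring).
  assert (N := one_plus_neq_0 (c * e) a Hce Ha). split; auto.
  rewrite Cmod_div by auto.
  assert (E : (Cconj a + c * e)%C = (c * e * Cconj (RtoC 1 + c * e * a))%C).
  { rewrite Cplus_conj, Cmult_conj, Cconj_RtoC.
    assert (M : (c * e * Cconj (c * e))%C = RtoC 1).
    { rewrite <- Cmod2_conj, Hce. f_equal. ring. }
    transitivity (c * e + (c * e * Cconj (c * e)) * Cconj a)%C; [rewrite M; ring|ring]. }
  rewrite E, Cmod_mult, Hce, Cmod_conj. field. apply Rgt_not_eq. now apply Cmod_gt_0.
Qed.

(** Logarithmic differentiation of 1 + c phi(z) = const (1 + c' z) / (1 + conj a z). *)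
Lemma boundary_point_identity (c a z : C) (theta : R) :
  Cmod c = 1 -> Cmod a < 1 -> unit_disk z ->
  let c' := ((Cconj a + c * rot theta) / (RtoC 1 + c * rot theta * a))%C in
  (c * disk_aut_derive theta a z / (RtoC 1 + c * disk_aut theta a z))%C
  = (c' / (RtoC 1 + c' * z) - Cconj a / (RtoC 1 + Cconj a * z))%C.
Proof.
  intros Hc Ha Hz c'.
  destruct (boundary_point_transform c a (rot theta) Hc (Cmod_rot theta) Ha) as [N1 M].
  fold c' in M.
  assert (N2 := disk_aut_denom a z Ha Hz).
  assert (N3 := one_plus_neq_0 c' z M Hz).
  assert (N4 := one_plus_neq_0 c _ Hc (disk_aut_disk theta a z Ha Hz)).
  assert (E1 : (RtoC 1 + c' * z)%C =
     ((RtoC 1 + c * rot theta * a + (Cconj a + c * rot theta) * z) / (RtoC 1 + c * rot theta * a))%C).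
  { unfold c'. field. auto. }
  assert (E2 : (RtoC 1 + c * disk_aut theta a z)%C =
     ((RtoC 1 + c * rot theta * a + (Cconj a + c * rot theta) * z) / (RtoC 1 + Cconj a * z))%C).
  { unfold disk_aut. fold (rot theta). field. auto. }
  set (W := (RtoC 1 + c * rot theta * a + (Cconj a + c * rot theta) * z)%C) in *.
  assert (NW : W <> RtoC 0).
  { intros E. apply N3. rewrite E1, E. unfold Cdiv. apply Cmult_0_l. }
  rewrite E1, E2. unfold c', disk_aut_derive.
  transitivity (c * rot theta * (RtoC 1 - a * Cconj a) / ((RtoC 1 + Cconj a * z) * W))%C;
    [field; auto|].
  transitivity (((Cconj a + c * rot theta) * (RtoC 1 + Cconj a * z) - Cconj a * W) / ((RtoC 1 + Cconj a * z) * W))%C;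
    [|field; auto].
  f_equal. unfold W. ring.
Qed.

(** The derivative [Y] of the transformed analytic part satisfies the same equation at the boundary
    parameters b', d'; uniqueness identifies it with the solution [y], whose primitive is analytic
    by construction. *)
Lemma family_koebe (theta : R) (a : C) :
  Cmod a < 1 -> extremal_family alpha (koebe_transform (disk_aut theta a) f h).
Proof.
  intros Ha.
  set (b' := ((Cconj a + b * rot theta) / (RtoC 1 + b * rot theta * a))%C).
  set (d' := ((Cconj a + d * rot theta) / (RtoC 1 + d * rot theta * a))%C).
  assert (Mb : Cmod b' = 1) by (apply boundary_point_transform; auto using Cmod_rot).
  assert (Md : Cmod d' = 1) by (apply boundary_point_transform; auto using Cmod_rot).
  destruct (pole_log_derivative_solution alpha b' d' Mb Md) as (y & w & Ay & y0 & _ & Dy).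
  destruct (analytic_primitive y Ay) as (h2 & Ah2 & h20 & Dh2).
  set (A := koebe_const theta a h).
  assert (NA : A <> RtoC 0) by (apply koebe_const_neq_0; auto; apply family_derive_neq_0).
  set (phi := disk_aut theta a).
  set (Y := fun z => (C_derive h (phi z) * disk_aut_derive theta a z / A)%C).
  assert (Y0 : Y (RtoC 0) = RtoC 1) 
    by (unfold Y; change (A / A = RtoC 1)%C; field; exact NA).
  assert (DY : forall z, unit_disk z -> Cder Y z (pole_log_derivative alpha b' d' z * Y z)%C).
  { intros z Hz. refine (Cder_eq _ _ _ _ _ (koebe_Cder2 theta a Ha h A z Ah NA Hz)).
    assert (Hphi := disk_aut_disk theta a z Ha Hz). rewrite ODE by auto.
    assert (I1 := boundary_point_identity b a z theta Hb Ha Hz).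
    assert (I2 := boundary_point_identity d a z theta Hd Ha Hz).
    cbv zeta in I1, I2. fold b' in I1. fold d' in I2.
    assert (N2 := disk_aut_denom a z Ha Hz).
    assert (N3 := one_plus_neq_0 b' z Mb Hz). assert (N4 := one_plus_neq_0 d' z Md Hz).
    assert (N5 := one_plus_neq_0 b _ Hb Hphi). assert (N6 := one_plus_neq_0 d _ Hd Hphi).
    (* Each pole contributes a term in conj a; with weights alpha - 1 and -(alpha + 1) they add up
       to exactly the logarithmic derivative of phi'. *)
    assert (EP : pole_log_derivative alpha b' d' z =
      (pole_log_derivative alpha b d (disk_aut theta a z) * disk_aut_derive theta a z
         - (RtoC 1 + RtoC 1) * Cconj a / (RtoC 1 + Cconj a * z))%C).
    { transitivity (RtoC (alpha - 1) * (b * disk_aut_derive theta a z / (RtoC 1 + b * disk_aut theta a z)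
          + Cconj a / (RtoC 1 + Cconj a * z))
        - RtoC (alpha + 1) * (d * disk_aut_derive theta a z / (RtoC 1 + d * disk_aut theta a z)
          + Cconj a / (RtoC 1 + Cconj a * z)))%C.
      - rewrite I1, I2. unfold pole_log_derivative. field. auto.
      - unfold pole_log_derivative. rewrite RtoC_minus, RtoC_plus. field. auto. }
    rewrite EP. unfold Y, disk_aut_derive2. fold phi. field. auto. }
  assert (EY : forall z, unit_disk z -> y z = Y z).
  { intros z Hz. apply (pole_log_derivative_unique alpha b' d' y Y Mb Md y0 Y0); auto. intros v Hv. now apply Dy. }
  assert (EH : forall z, unit_disk z -> ((h (phi z) - h (phi (RtoC 0))) / A)%C = h2 z).
  { intros z Hz.
    assert (K := disk_const (fun z => (h (phi z) - h (phi (RtoC 0))) / A - h2 z)%C).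
    cbv beta in K. assert (K' : ((h (phi z) - h (phi (RtoC 0))) / A - h2 z)%C = RtoC 0).
    { rewrite K; auto.
      - rewrite h20. field. exact NA.
      - intros v Hv. eapply Cder_eq; [|apply Cder_minus; [exact (koebe_Cder theta a Ha h A v Ah NA Hv)|now apply Dh2]].
        rewrite EY by auto. unfold Y. fold phi. ring. }
    replace ((h (phi z) - h (phi (RtoC 0))) / A)%C
      with ((h (phi z) - h (phi (RtoC 0))) / A - h2 z + h2 z)%C by ring.
    rewrite K'. ring. }
  assert (Eh2 : forall z, unit_disk z -> C_derive h2 z = y z)
    by (intros z Hz; now apply Cder_C_derive, Dh2).
  assert (NcA := Cconj_neq_0 A NA).
  (* The analytic part is divided by [A] and g = k h by conj A, so [k] is only rotated. *)
  exists b', d', (k * A / Cconj A)%C, h2. repeat (split; [assumption|]). split; [|split; [|split; [|split; [|split]]]]; auto.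
  - unfold unit_disk. rewrite Cmod_div, Cmod_mult, Cmod_conj by auto.
    replace (Cmod k * Cmod A / Cmod A) with (Cmod k); [exact Hk|].
    field. apply Rgt_not_eq. now apply Cmod_gt_0.
  - rewrite Eh2; [exact y0|apply unit_disk_0].
  - intros z Hz. rewrite (Eh2 z Hz). apply Cder_C_derive.
    eapply Cder_ext_disk; [exact Hz| |now apply Dy]. intros u Hu. now rewrite Eh2.
  - intros z Hz. fold phi.
    assert (T := koebe_transform_eq theta a f h (fun z => k * h z)%C Ha family_parts family_derive_neq_0 z Hz).
    cbv zeta in T. fold phi in T. fold A in T. rewrite T, <- (EH z Hz). f_equal. f_equal. field. auto.
Qed.
End Family.

Lemma extremal_family_ALIF (alpha : R) : ALIF (extremal_family alpha).
Proof.
  split.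
  - intros f (b & d & k & h & Hb & Hd & Hk & Ah & h0 & h'0 & ODE & Ef).
    exists h, (fun z => k * h z)%C. split; [now apply (family_parts f h k)|].
    split; [now apply (family_locally_univalent alpha f h b d k)|].
    split; [now apply (family_sense_preserving alpha h b d k)|].
    split; [exact h'0|]. intros theta a Ha. now apply (family_koebe alpha f h b d k).
  - intros f h1 g1 (b & d & k & h & Hb & Hd & Hk & Ah & h0 & h'0 & ODE & Ef) Hp1 eps He.
    now apply (family_affine alpha f h b d k) with h1.
Qed.

Lemma extremal_family_member (alpha : R) (b d k : C) :
  Cmod b = 1 -> Cmod d = 1 -> unit_disk k ->
  exists h, analytic_on_disk h /\ h (RtoC 0) = RtoC 0 /\ C_derive h (RtoC 0) = RtoC 1 /\
    (forall z, unit_disk z -> C_derive (C_derive h) z = (pole_log_derivative alpha b d z * C_derive h z)%C) /\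
    extremal_family alpha (fun z => h z + Cconj (k * h z))%C.
Proof.
  intros Hb Hd Hk.
  destruct (pole_log_derivative_solution alpha b d Hb Hd) as (y & w & Ay & y0 & _ & Dy).
  destruct (analytic_primitive y Ay) as (h & Ah & h0 & Dh).
  assert (Eh : forall z, unit_disk z -> C_derive h z = y z)
    by (intros z Hz; now apply Cder_C_derive, Dh).
  assert (h'0 : C_derive h (RtoC 0) = RtoC 1) by (rewrite Eh; [exact y0|apply unit_disk_0]).
  assert (ODE : forall z, unit_disk z -> C_derive (C_derive h) z = (pole_log_derivative alpha b d z * C_derive h z)%C).
  { intros z Hz. rewrite (Eh z Hz). apply Cder_C_derive.
    eapply Cder_ext_disk; [exact Hz| |now apply Dy]. intros u Hu. now rewrite Eh. }
  exists h. repeat (split; [assumption|]). exists b, d, k, h. repeat (split; [assumption|]). auto.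
Qed.

(** Here a_2 = ((alpha - 1) b - (alpha + 1) d) / 2, of modulus at most [alpha] once alpha >= 1, with
    equality at b = 1, d = -1. *)
Lemma extremal_family_order (alpha : R) :
  1 <= alpha -> family_order (extremal_family alpha) = Finite alpha.
Proof.
  intros Ha. apply is_lub_Rbar_unique. split.
  - intros x (f & h1 & g1 & (b & d & k & h & Hb & Hd & Hk & Ah & h0 & h'0 & ODE & Ef) & Hp1 & ->).
    simpl.
    assert (E1 : forall z, unit_disk z -> C_derive h1 z = C_derive h z).
    { intros z Hz. apply (C_derive_of_parts f h1 g1 h (fun z => k * h z)%C (C_derive h)
        (fun z => k * C_derive h z)%C Hp1); auto.
      - intros w Hw. now apply analytic_Cder.
      - intros w Hw. apply Cder_scal. now apply analytic_Cder. }
    assert (E2 : C_derive (C_derive h1) (RtoC 0) = (RtoC (alpha - 1) * b - RtoC (alpha + 1) * d)%C).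
    { apply Cder_C_derive. eapply Cder_ext_disk; [apply unit_disk_0| |].
      - intros u Hu. symmetry. now apply E1.
      - eapply Cder_eq; [|apply (family_derive_ode alpha h b d Ah ODE), unit_disk_0].
        rewrite h'0. unfold pole_log_derivative. field. }
    unfold coef_a2. rewrite E2, Cmod_div by (intros E; apply RtoC_inj in E; lra).
    assert (T := Cmod_triangle_minus (RtoC (alpha - 1) * b) (RtoC (alpha + 1) * d)).
    rewrite !Cmod_mult, Hb, Hd, !Cmod_R, !Rabs_pos_eq in T by lra.
    rewrite Cmod_R, Rabs_pos_eq by lra. lra.
  - intros l Hl. apply Hl.
    assert (M1 : Cmod (- RtoC 1) = 1) by (rewrite Cmod_opp; apply Cmod_1).
    destruct (extremal_family_member alpha (RtoC 1) (- RtoC 1)%C (RtoC 0) Cmod_1 M1 unit_disk_0)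
      as (h & Ah & h0 & h'0 & ODE & Hf).
    exists (fun z => h z + Cconj (RtoC 0 * h z))%C, h, (fun z => RtoC 0 * h z)%C.
    split; [exact Hf|]. split.
    + apply family_parts; auto.
    + unfold coef_a2. rewrite ODE by apply unit_disk_0. rewrite h'0.
      replace (pole_log_derivative alpha (RtoC 1) (- RtoC 1) (RtoC 0) * RtoC 1 / RtoC 2)%C with (RtoC alpha).
      * rewrite Cmod_R, Rabs_pos_eq; lra.
      * unfold pole_log_derivative. replace (RtoC (alpha - 1) * RtoC 1 / (RtoC 1 + RtoC 1 * RtoC 0) -
          RtoC (alpha + 1) * - RtoC 1 / (RtoC 1 + - RtoC 1 * RtoC 0))%C
          with (RtoC (alpha - 1) + RtoC (alpha + 1))%C by field.
        rewrite <- RtoC_plus, Cmult_1_r, <- RtoC_div by lra. f_equal. field.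
Qed.

(** * The universal family *)

Definition ALIF_union (alpha : R) (f : C -> C) : Prop :=
  exists L, ALIF L /\ family_order L = Finite alpha /\ L f.

(** Both invariances hold because the transforms of f stay in the single family that contains f. The
    order is at most [alpha] memberwise, and reaches it through the extremal family. *)
Lemma ALIF_union_universal (alpha : R) :
  1 <= alpha -> universal_ALIF alpha (ALIF_union alpha).
Proof.
  intros Ha. split; [|split].
  - split.
    + intros f (L & HA & HO & Hf). destruct (proj1 HA f Hf) as (h & g & Hp & LU & SP & N & K).
      exists h, g. repeat (split; [assumption|]). intros theta a Ha'. exists L. auto.
    + intros f h g (L & HA & HO & Hf) Hp eps He. exists L. repeat (split; [assumption|]).
      now apply (proj2 HA) with h.
  - apply is_lub_Rbar_unique. split.
    + intros x (f & h & g & (L & HA & HO & Hf) & Hp & ->).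
      exact (family_order_bound L alpha f h g HO Hf Hp).
    + intros l Hl. assert (HO := extremal_family_order alpha Ha).
      rewrite <- HO. apply Lub_Rbar_correct. intros x (f & h & g & Hf & Hp & ->). apply Hl.
      exists f, h, g. split; auto. exists (extremal_family alpha).
      split; [apply extremal_family_ALIF|auto].
  - intros L HA HO f Hf. now exists L.
Qed.

(** * Sharpness *)

Lemma stretch_minorant_derive (alpha r : R) : -1 < r < 1 ->
  is_derive (stretch_minorant alpha) r (- ((alpha - 1) / (1 - r) + (alpha + 1) / (1 + r)) * stretch_minorant alpha r).
Proof.
  intros Hr. unfold stretch_minorant. auto_derive; [repeat split; lra|].
  replace (1 + - r) with (1 - r) by ring. fold (Rminus ((alpha - 1) * ln (1 - r)) ((alpha + 1) * ln (1 + r))).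
  field. lra.
Qed.

(** On the negative axis h'(-t) and [stretch_minorant] satisfy the same linear equation with the
    same initial value, so the growth bound is attained there. *)
Lemma negative_axis (alpha : R) (h : C -> C) :
  0 < alpha -> analytic_on_disk h -> h (RtoC 0) = RtoC 0 -> C_derive h (RtoC 0) = RtoC 1 ->
  (forall z, unit_disk z ->
     C_derive (C_derive h) z = (pole_log_derivative alpha (RtoC 1) (- RtoC 1) z * C_derive h z)%C) ->
  forall t, 0 <= t < 1 -> h (RtoC (- t)) = RtoC (- stretch_primitive alpha 1 t).
Proof.
  intros Ha Ah h0 h'0 ODE.
  assert (Pt : forall t : R, (RtoC 0 + RtoC t * - RtoC 1)%C = RtoC (- t)).
  { intros t. rewrite RtoC_opp. ring. }
  assert (Dk : forall t, 0 <= t < 1 -> unit_disk (RtoC (- t))).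
  { intros t Ht. unfold unit_disk. rewrite Cmod_R, Rabs_Ropp, Rabs_pos_eq; lra. }
  set (p := fun t => (alpha - 1) / (1 - t) + (alpha + 1) / (1 + t)).
  assert (EP : forall t, 0 <= t < 1 -> pole_log_derivative alpha (RtoC 1) (- RtoC 1) (RtoC (- t)) = RtoC (p t)).
  { intros t Ht. unfold p, pole_log_derivative. rewrite !RtoC_plus, !RtoC_div, !RtoC_plus, !RtoC_minus, !RtoC_opp by lra.
    assert (N1 : (RtoC 1 - RtoC t)%C <> RtoC 0)
      by (rewrite <- RtoC_minus; intros E; apply RtoC_inj in E; lra).
    assert (N2 : (RtoC 1 + RtoC t)%C <> RtoC 0)
      by (rewrite <- RtoC_plus; intros E; apply RtoC_inj in E; lra).
    field. repeat split; auto; intros E; first [apply N2; rewrite <- E; ring | apply N1; rewrite <- E; ring]. }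
  assert (Re_p : forall r (w : C), Re (RtoC r * w * - RtoC 1)%C = - r * Re w)
    by (intros r w; destruct w; unfold Re, RtoC, Cmult, Copp; simpl; ring).
  assert (Im_p : forall r (w : C), Im (RtoC r * w * - RtoC 1)%C = - r * Im w)
    by (intros r w; destruct w; unfold Im, RtoC, Cmult, Copp; simpl; ring).
  (* Two solutions of q' = - p q have a constant quotient; this is applied to the real and imaginary
     parts of h'(-t) separately. *)
  assert (DQ : forall (q : R -> R) (t : R), 0 <= t < 1 -> is_derive q t (- p t * q t) ->
     is_derive (fun s => q s / stretch_minorant alpha s) t 0).
  { intros q t Ht Dq. assert (PB := stretch_minorant_pos alpha t).
    replace 0 with ((- p t * q t * stretch_minorant alpha t - q t * (- p t * stretch_minorant alpha t)) / stretch_minorant alpha t ^ 2) by (field; lra).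
    apply is_derive_div; auto; [|lra]. apply stretch_minorant_derive. lra. }
  assert (B0 : stretch_minorant alpha 0 = 1).
  { unfold stretch_minorant. rewrite Rminus_0_r, Rplus_0_r, ln_1, !Rmult_0_r, Rminus_0_r. apply exp_0. }
  assert (Y : forall t, 0 <= t < 1 -> C_derive h (RtoC (- t)) = RtoC (stretch_minorant alpha t)).
  { intros t Ht.
    assert (D : forall s, 0 <= s <= t ->
      is_derive (fun x => Re (C_derive h (RtoC (- x)))) s (- p s * Re (C_derive h (RtoC (- s)))) /\
      is_derive (fun x => Im (C_derive h (RtoC (- x)))) s (- p s * Im (C_derive h (RtoC (- s))))).
    { intros s Hs.
      destruct (Cder_line (C_derive h) (RtoC 0) (- RtoC 1)%C (C_derive (C_derive h) (RtoC (- s))) s) as [D1 D2].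
      { rewrite Pt. apply analytic_Cder; [now apply analytic_C_derive|]. apply Dk. lra. }
      rewrite ODE, EP in D1, D2 by (try apply Dk; lra). rewrite Re_p in D1. rewrite Im_p in D2.
      split; (eapply is_derive_ext; [|first [exact D1|exact D2]]); intros x; cbv beta; now rewrite Pt. }
    assert (PB := stretch_minorant_pos alpha t).
    assert (E1 := const_of_derive_0 (fun x => Re (C_derive h (RtoC (- x))) / stretch_minorant alpha x) 0 t ltac:(lra)).
    assert (E2 := const_of_derive_0 (fun x => Im (C_derive h (RtoC (- x))) / stretch_minorant alpha x) 0 t ltac:(lra)).
    cbv beta in E1, E2. rewrite Ropp_0, h'0, B0 in E1, E2.
    change (Re (RtoC 1)) with 1 in E1. change (Im (RtoC 1)) with 0 in E2.
    apply C_eq_ReIm.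
    - change (Re (RtoC (stretch_minorant alpha t))) with (stretch_minorant alpha t).
      replace (Re (C_derive h (RtoC (- t)))) with (Re (C_derive h (RtoC (- t))) / stretch_minorant alpha t * stretch_minorant alpha t)
        by (field; lra).
      rewrite <- E1; [field|]. intros s Hs. apply (DQ (fun x => Re (C_derive h (RtoC (- x))))); [lra|].
      now apply D.
    - change (Im (RtoC (stretch_minorant alpha t))) with 0.
      replace (Im (C_derive h (RtoC (- t)))) with (Im (C_derive h (RtoC (- t))) / stretch_minorant alpha t * stretch_minorant alpha t)
        by (field; lra).
      rewrite <- E2; [field|]. intros s Hs. apply (DQ (fun x => Im (C_derive h (RtoC (- x))))); [lra|].
      now apply D. }
  intros t Ht.
  assert (D : forall s, 0 <= s <= t ->
    is_derive (fun x => Re (h (RtoC (- x)))) s (- (1 * stretch_minorant alpha s)) /\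
    is_derive (fun x => Im (h (RtoC (- x)))) s 0).
  { intros s Hs.
    destruct (Cder_line h (RtoC 0) (- RtoC 1)%C (C_derive h (RtoC (- s))) s) as [D1 D2].
    { rewrite Pt. apply analytic_Cder; auto. apply Dk. lra. }
    rewrite Y in D1, D2 by lra. split.
    - replace (- (1 * stretch_minorant alpha s)) with (Re (RtoC (stretch_minorant alpha s) * - RtoC 1)%C)
        by (unfold Re, RtoC, Cmult, Copp; simpl; ring).
      eapply is_derive_ext; [|exact D1]. intros x; cbv beta; now rewrite Pt.
    - replace 0 with (Im (RtoC (stretch_minorant alpha s) * - RtoC 1)%C)
        by (unfold Im, RtoC, Cmult, Copp; simpl; ring).
      eapply is_derive_ext; [|exact D2]. intros x; cbv beta; now rewrite Pt. }
  assert (E1 := const_of_derive_0 (fun x => Re (h (RtoC (- x))) + stretch_primitive alpha 1 x) 0 t ltac:(lra)).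
  assert (E2 := const_of_derive_0 (fun x => Im (h (RtoC (- x)))) 0 t ltac:(lra)).
  cbv beta in E1, E2. rewrite Ropp_0, h0 in E1, E2. rewrite stretch_primitive_0 in E1.
  change (Re (RtoC 0)) with 0 in E1. change (Im (RtoC 0)) with 0 in E2.
  apply C_eq_ReIm.
  - change (Re (RtoC (- stretch_primitive alpha 1 t))) with (- stretch_primitive alpha 1 t).
    assert (T : 0 + 0 = Re (h (RtoC (- t))) + stretch_primitive alpha 1 t); [|lra].
    apply E1. intros s Hs.
    replace 0 with (- (1 * stretch_minorant alpha s) + 1 * stretch_minorant alpha s) by ring.
    apply (is_derive_plus (K := R_AbsRing) (V := R_NormedModule)); [now apply D|]. apply stretch_primitive_derive; lra.
  - change (Im (RtoC (- stretch_primitive alpha 1 t))) with 0. symmetry. apply E2. intros s Hs. now apply D.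
Qed.

Lemma stretch_primitive_lt_limit (alpha c r : R) : 0 < alpha -> 0 < c -> stretch_primitive alpha c r < c / (2 * alpha).
Proof.
  intros Ha Hc. unfold stretch_primitive. assert (P := exp_pos (alpha * (ln (1 - r) - ln (1 + r)))).
  assert (0 < c / (2 * alpha)) by (apply Rdiv_lt_0_compat; lra). nra.
Qed.

Lemma stretch_primitive_nonneg (alpha c r : R) : 0 < alpha -> 0 <= c -> 0 <= r < 1 -> 0 <= stretch_primitive alpha c r.
Proof.
  intros Ha Hc Hr. rewrite <- (stretch_primitive_0 alpha c). apply stretch_primitive_increasing; lra.
Qed.

(** If rho exceeded the limit of |f| along the negative axis, the sheet U over the disk could never
    lose that axis: the image of -t tends to a point of the disk, whose preimage in U must be the
    end point reached. Hence U would contain -1. *)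
Lemma univalent_disk_upper (f h g : C -> C) (alpha c rho : R) :
  harmonic_parts f h g -> sense_preserving h g -> 1 <= alpha -> 0 < c ->
  (forall t, 0 <= t < 1 -> f (RtoC (- t)) = RtoC (- stretch_primitive alpha c t)) ->
  univalent_disk f (RtoC 0) rho -> rho <= c / (2 * alpha).
Proof.
  intros Hp SP Ha Hc Ef (Pr & U & OU & DU & U0 & Inj & Img).
  apply Rnot_lt_le. intros Hrho.
  set (lim := c / (2 * alpha)) in *.
  assert (f0 : f (RtoC 0) = RtoC 0).
  { specialize (Ef 0 ltac:(lra)). now rewrite stretch_primitive_0, Ropp_0 in Ef. }
  rewrite f0 in Img.
  (* The radii up to which the whole segment lies in U; T is their supremum. *)
  set (S := fun t => 0 <= t < 1 /\ forall s, 0 <= s <= t -> U (RtoC (- s))).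
  assert (S0 : S 0).
  { split; [lra|]. intros s Hs. replace (- s) with 0 by lra. exact U0. }
  assert (Extend : forall t, 0 <= t < 1 -> (forall s, 0 <= s < t -> U (RtoC (- s))) ->
     U (RtoC (- t)) -> exists t', t < t' /\ S t').
  { intros t Ht Hlt Ut. apply OU in Ut. apply locally_Cmod_iff in Ut. destruct Ut as [e [He K]].
    exists (Rmin (t + e / 2) ((t + 1) / 2)).
    assert (B1 := Rmin_l (t + e / 2) ((t + 1) / 2)). assert (B2 := Rmin_r (t + e / 2) ((t + 1) / 2)).
    assert (B3 : t < Rmin (t + e / 2) ((t + 1) / 2)) by (apply Rmin_glb_lt; lra).
    split; auto. split; [lra|]. intros s Hs. destruct (Rlt_le_dec s t) as [L|L].
    - apply Hlt. lra.
    - apply K. rewrite <- RtoC_minus, Cmod_R. apply Rabs_def1; lra. }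
  destruct (completeness S) as [T [Ub Lub]].
  { exists 1. intros t [Ht _]. lra. }
  { exists 0. exact S0. }
  assert (T0 : 0 < T).
  { destruct (Extend 0) as [t' [Ht' St']]; [lra| |now rewrite Ropp_0|].
    - intros s Hs. lra.
    - assert (L := Ub t' St'). lra. }
  assert (T1 : T <= 1) by (apply Lub; intros t [Ht _]; lra).
  assert (Below : forall s, 0 <= s < T -> U (RtoC (- s))).
  { intros s Hs. apply NNPP. intros N.
    assert (T <= s); [|lra]. apply Lub. intros t [Ht K].
    apply Rnot_lt_le. intros L. apply N, K. lra. }
  (* For T < 1 the limit is the value at T by continuity; for T = 1 it is c / (2 alpha). Either way
     it is less than rho. *)
  assert (Limit : exists l, 0 <= l <= lim /\ forall e, 0 < e -> exists d, 0 < d /\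
     forall s, 0 <= s < T -> T - d < s -> Rabs (stretch_primitive alpha c s - l) < e).
  { destruct (Rlt_le_dec T 1) as [L|L].
    - exists (stretch_primitive alpha c T). split.
      + split; [apply stretch_primitive_nonneg; lra|left; apply stretch_primitive_lt_limit; lra].
      + intros e He.
        assert (Cn : continuous (stretch_primitive alpha c) T).
        { apply (ex_derive_continuous (K := R_AbsRing) (V := R_NormedModule) (stretch_primitive alpha c) T).
          eexists. apply stretch_primitive_derive; lra. }
        destruct (Cn (fun y => Rabs (y - stretch_primitive alpha c T) < e)) as [d Hd].
        { exists (mkposreal e He). intros y Hy. exact Hy. }
        exists d. split; [apply cond_pos|]. intros s Hs Hs'. apply Hd.
        change (Rabs (s - T) < d). apply Rabs_def1; [|lra]. assert (P := cond_pos d). lra.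
    - exists lim. assert (P : 0 < lim) by (apply Rdiv_lt_0_compat; lra). split; [lra|].
      intros e He. exists (e / lim). split; [now apply Rdiv_lt_0_compat|]. intros s Hs Hs'.
      assert (A1 := stretch_primitive_lt_limit alpha c s ltac:(lra) Hc).
      assert (A2 := stretch_primitive_lower alpha c s Ha ltac:(lra) ltac:(lra)). fold lim in A1, A2.
      assert (A3 : lim * (1 - s) < lim * (e / lim)) by (apply Rmult_lt_compat_l; lra).
      replace (lim * (e / lim)) with e in A3 by (field; lra).
      apply Rabs_def1; lra. }
  destruct Limit as [l [Hl Lim]].
  destruct (proj1 (Img (RtoC (- l)))) as [u0 [Uu0 Eu0]].
  { replace (RtoC (- l) - RtoC 0)%C with (RtoC (- l)) by ring.
    rewrite Cmod_R, Rabs_Ropp, Rabs_pos_eq; lra. }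
  (* Near [u0] the map takes every value close to -l, in particular f(-s) for s near T. Injectivity
     on U identifies the preimage with -s, so -s is close to both u0 and -T. *)
  assert (Eu : u0 = RtoC (- T)).
  { apply Cmod_diff_0. apply Rle_antisym; [|apply Cmod_ge_0]. apply le_epsilon. intros e He.
    assert (Ou := OU u0 Uu0). apply locally_Cmod_iff in Ou. destruct Ou as [e' [He' Ku]].
    destruct (harmonic_local_surjectivity f h g u0 (Rmin e' (e / 2)) Hp SP (DU u0 Uu0))
      as [eta [Heta K]]; [apply Rmin_glb_lt; lra|].
    destruct (Lim eta Heta) as [d [Hd Kd]].
    set (s := T - Rmin (d / 2) (Rmin (e / 2) (T / 2))).
    assert (M0 : 0 < Rmin (d / 2) (Rmin (e / 2) (T / 2))) by (repeat apply Rmin_glb_lt; lra).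
    assert (M1 : Rmin (d / 2) (Rmin (e / 2) (T / 2)) <= d / 2) by apply Rmin_l.
    assert (M2 : Rmin (d / 2) (Rmin (e / 2) (T / 2)) <= e / 2)
      by (eapply Rle_trans; [apply Rmin_r|apply Rmin_l]).
    assert (M3 : Rmin (d / 2) (Rmin (e / 2) (T / 2)) <= T / 2)
      by (eapply Rle_trans; [apply Rmin_r|apply Rmin_r]).
    assert (Hs : 0 <= s < T) by (unfold s; lra).
    specialize (Kd s Hs ltac:(unfold s; lra)).
    destruct (K (f (RtoC (- s)))) as [v [Ev Dv]].
    { rewrite Ef, Eu0, <- RtoC_minus, Cmod_R by lra.
      replace (- stretch_primitive alpha c s - - l) with (- (stretch_primitive alpha c s - l)) by ring. now rewrite Rabs_Ropp. }
    assert (Uv : U v) by (apply Ku; eapply Rlt_le_trans; [exact Dv|apply Rmin_l]).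
    assert (Ev' : v = RtoC (- s)) by (apply Inj; auto).
    assert (D1 : Cmod (RtoC (- s) - u0) < e / 2)
      by (rewrite <- Ev'; eapply Rlt_le_trans; [exact Dv|apply Rmin_r]).
    assert (Tr := Cmod_dist_triangle u0 (RtoC (- s)) (RtoC (- T))).
    rewrite (Cmod_minus_sym u0 (RtoC (- s))) in Tr.
    assert (D2 : Cmod (RtoC (- s) - RtoC (- T)) <= e / 2).
    { rewrite <- RtoC_minus, Cmod_R, Rabs_pos_eq; unfold s; lra. }
    lra. }
  subst u0.
  (* Membership of -T in U excludes T = 1; for T < 1 openness extends the segment past the
     supremum. *)
  assert (TD := DU _ Uu0). unfold unit_disk in TD.
  rewrite Cmod_R, Rabs_Ropp, Rabs_pos_eq in TD by lra.
  destruct (Extend T (conj (Rlt_le _ _ T0) TD) Below Uu0) as [t' [Ht' St']].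
  assert (L := Ub t' St'). lra.
Qed.

Theorem theorem3 :
  forall (alpha : R) (L : (C -> C) -> Prop),
    ALIF L -> family_order L = Finite alpha ->
    (forall f h g : C -> C,
       L f -> harmonic_parts f h g -> locally_quasiconformal f h g ->
       forall z : C, unit_disk z ->
         Rbar_le
           (Finite ((1 - Cmod (dilatation h g z)) / (2 * alpha)
                    * Rpower ((1 - Cmod z) / (1 + Cmod z)) alpha))
           (univalent_radius f z))
    /\
    (exists U : (C -> C) -> Prop,
       universal_ALIF alpha U /\
       forall r : R, 0 <= r < 1 ->
         exists f h g : C -> C,
           U f /\ harmonic_parts f h g /\ locally_quasiconformal f h g /\
           Cmod (dilatation h g (RtoC 0)) = r /\
           univalent_radius f (RtoC 0) = Finite ((1 - r) / (2 * alpha))).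
Proof.
  intros alpha L HA HO. split.
  { intros f h g Hf Hp _ z Hz. now apply (univalent_radius_lower L alpha f h g). }
  assert (Ha := LIF_order_ge_1 L alpha (proj1 HA) HO).
  assert (HU := ALIF_union_universal alpha Ha).
  exists (ALIF_union alpha). split; [exact HU|]. intros r Hr.
  (* The dilatation has constant modulus r, and the sign makes f = (1 - r) h on the negative axis,
     where h is real; this is the smallest stretching allowed. *)
  set (k := RtoC (- r)).
  assert (Mk : Cmod k = r) by (unfold k; rewrite Cmod_R, Rabs_Ropp, Rabs_pos_eq; lra).
  assert (Hk : unit_disk k) by (unfold unit_disk; lra).
  assert (M1 : Cmod (- RtoC 1) = 1) by (rewrite Cmod_opp; apply Cmod_1).
  destruct (extremal_family_member alpha (RtoC 1) (- RtoC 1)%C k Cmod_1 M1 Hk)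
    as (h & Ah & h0 & h'0 & ODE & Hf).
  set (f := fun z => (h z + Cconj (k * h z))%C) in *.
  set (g := fun z => (k * h z)%C).
  assert (Hp : harmonic_parts f h g) by now apply family_parts.
  assert (SP : sense_preserving h g)
    by exact (family_sense_preserving alpha h _ _ k Cmod_1 M1 Hk Ah h'0 ODE).
  assert (NZ : forall z, unit_disk z -> C_derive h z <> RtoC 0)
    by (intros z Hz; now apply (sense_preserving_neq_0 h g)).
  assert (Dil : forall z, unit_disk z -> Cmod (dilatation h g z) = r).
  { intros z Hz. unfold dilatation, g. rewrite (family_g_derive h k Ah z Hz), <- Mk.
    f_equal. field. now apply NZ. }
  assert (Uf : ALIF_union alpha f).
  { exists (extremal_family alpha). split; [apply extremal_family_ALIF|].
    split; [now apply extremal_family_order|exact Hf]. }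
  exists f, h, g. split; [exact Uf|]. split; [exact Hp|]. split; [|split].
  - intros z Hz. destruct (harmonic_local_injectivity f h g z Hp SP Hz) as [delta [Pd K]].
    exists delta, r. split; auto. split; [lra|]. split; [auto|].
    intros u Hu _. split; [auto|]. rewrite Dil; auto. lra.
  - apply Dil, unit_disk_0.
  - apply Rbar_le_antisym.
    + apply Lub_Rbar_correct. intros rho Hrho. simpl.
      apply (univalent_disk_upper f h g alpha (1 - r) rho); auto; [lra|].
      intros t Ht. unfold f, k. rewrite (negative_axis alpha h) by (auto; lra).
      rewrite <- RtoC_mult, Cconj_RtoC, <- RtoC_plus. f_equal. unfold stretch_primitive. field. lra.
    + assert (T := univalent_radius_lower _ alpha f h g (RtoC 0) (proj1 HU) (proj1 (proj2 HU)) Uf Hp unit_disk_0).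
      rewrite Dil, Cmod_0 in T by apply unit_disk_0.
      replace ((1 - 0) / (1 + 0)) with 1 in T by field.
      unfold Rpower in T. rewrite ln_1, Rmult_0_r, exp_0, Rmult_1_r in T. exact T.
Qed.
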